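(* Every countable model of set theory $\langle M,\in^M\rangle$ is isomorphic to a submodel of its own constructible universe $\langle L^M,\in^M\rangle$. In other words, there is a function $j:M\to L^M$ such that $x\in^M y \iff j(x)\in^M j(y)$ for all $x,y\in M$, and $j$ is an isomorphism of $\langle M,\in^M\rangle$ with the submodel of $\langle L^M,\in^M\rangle$ on its range.
   Context: A model of set theory is a first-order structure $\langle M,\in^M\rangle$ in the language with one binary relation symbol that satisfies at least the axioms of Kripke–Platek set theory KP; it need not be well-founded or transitive. $L^M$ is the constructible universe as defined inside $M$, i.e. the set of all $x\in M$ with $M\models x\in L$. A submodel of $\langle N,\in^N\rangle$ is an arbitrary subset of $N$ with the restriction of $\in^N$ (an induced substructure, not required to satisfy any axioms). An embedding of one such structure into another is an isomorphism onto a submodel. No definability of $j$ in $M$ is claimed. *)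

(* Defs.v *)
From Stdlib Require Import FinFun.

Set Implicit Arguments.
Unset Strict Implicit.

Record structure : Type := Structure {
  carrier :> Type;
  mem : carrier -> carrier -> Prop
}.

Notation "x ∈ y" := (mem x y) (at level 70, no associativity).
Notation "x ∉ y" := (~ mem x y) (at level 70, no associativity).

Definition submodel (N : structure) (P : N -> Prop) : structure :=
  {| carrier := {x : carrier N | P x};
     mem := fun x y => proj1_sig x ∈ proj1_sig y |}.

Definition isomorphism (M N : structure) (f : M -> N) : Prop :=
  Injective f /\ Surjective f /\ forall x y : M, x ∈ y <-> f x ∈ f y.

Definition range (M N : structure) (f : M -> N) : N -> Prop :=
  fun y => exists x, f x = y.

Definition corestrict (M N : structure) (f : M -> N) (x : M) :
    submodel (range f) :=
  exist _ (f x) (ex_intro _ x eq_refl).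

Definition embedding (M N : structure) (f : M -> N) : Prop :=
  isomorphism (corestrict f).

Definition countable (M : structure) : Prop :=
  exists e : M -> nat, Injective e.

Inductive form : Type :=
| fMem (i j : nat)
| fEq (i j : nat)
| fBot
| fImp (p q : form)
| fAnd (p q : form)
| fOr (p q : form)
| fAll (p : form)
| fEx (p : form).

Definition scons (T : Type) (x : T) (e : nat -> T) (i : nat) : T :=
  match i with 0 => x | S i => e i end.

Fixpoint sat (M : structure) (e : nat -> M) (p : form) : Prop :=
  match p with
  | fMem i j => e i ∈ e j
  | fEq i j => e i = e j
  | fBot => False
  | fImp p q => sat e p -> sat e q
  | fAnd p q => sat e p /\ sat e q
  | fOr p q => sat e p \/ sat e q
  | fAll p => forall x, sat (scons x e) p
  | fEx p => exists x, sat (scons x e) p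
  end.

(* The bound [i] is shifted under the binder, so it is never the bound
   variable itself. *)
Inductive delta0 : form -> Prop :=
| d0_mem i j : delta0 (fMem i j)
| d0_eq i j : delta0 (fEq i j)
| d0_bot : delta0 fBot
| d0_imp p q : delta0 p -> delta0 q -> delta0 (fImp p q)
| d0_and p q : delta0 p -> delta0 q -> delta0 (fAnd p q)
| d0_or p q : delta0 p -> delta0 q -> delta0 (fOr p q)
| d0_all i p : delta0 p -> delta0 (fAll (fImp (fMem 0 (S i)) p))
| d0_ex i p : delta0 p -> delta0 (fEx (fAnd (fMem 0 (S i)) p)).

(* Foundation is the full schema; Infinity is not assumed.  Parameters enter
   the schemas through the assignment [e].  The empty-set axiom also makes
   the structure nonempty. *)
Record KP (M : structure) : Prop := {
  KP_extensionality :
    forall x y : M, (forall z, z ∈ x <-> z ∈ y) -> x = y;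
  KP_empty : exists x : M, forall y, y ∉ x;
  KP_pairing : forall x y : M, exists z, x ∈ z /\ y ∈ z;
  KP_union :
    forall x : M, exists u, forall y z, z ∈ y -> y ∈ x -> z ∈ u;
  KP_foundation : forall (p : form) (e : nat -> M),
    (exists x, sat (scons x e) p) ->
    exists x, sat (scons x e) p /\
      forall y, y ∈ x -> ~ sat (scons y e) p;
  KP_separation : forall p : form, delta0 p -> forall (e : nat -> M) (a : M),
    exists b, forall x, x ∈ b <-> x ∈ a /\ sat (scons x e) p;
  KP_collection : forall p : form, delta0 p -> forall (e : nat -> M) (a : M),
    (forall x, x ∈ a -> exists y, sat (scons y (scons x e)) p) ->
    exists b, forall x, x ∈ a ->
      exists y, y ∈ b /\ sat (scons y (scons x e)) p
}.

(* All quantifiers in this section range over the structure [M], so each predicate is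
   the interpretation in [M] of a first-order formula of set theory.  In
   particular "natural number", "formula" and "ordinal" mean what [M] takes
   them to be, and may be nonstandard. *)

Section Inside.
Context {M : structure}.
Implicit Types a b c f i j k l m n p q s t x y z A D R S X Y α β γ φ ψ : M.

Definition is_empty x : Prop := forall z, z ∉ x.

Definition is_upair p a b : Prop := forall z, z ∈ p <-> z = a \/ z = b.

Definition is_opair p a b : Prop :=
  exists u v, is_upair u a a /\ is_upair v a b /\ is_upair p u v.

Definition is_succ y x : Prop := forall z, z ∈ y <-> z ∈ x \/ z = x.

Definition is_transitive x : Prop := forall y z, z ∈ y -> y ∈ x -> z ∈ x.

Definition is_ordinal α : Prop :=
  is_transitive α /\ forall β, β ∈ α -> is_transitive β.

Definition is_limit α : Prop :=
  is_ordinal α /\ ~ is_empty α /\ ~ exists β, is_succ α β.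

Definition is_natural n : Prop :=
  is_ordinal n /\
  forall k, k ∈ n \/ k = n -> is_empty k \/ exists l, is_succ k l.

Fixpoint is_numeral (d : nat) (x : M) : Prop :=
  match d with
  | 0 => is_empty x
  | S d => exists y, is_numeral d y /\ is_succ x y
  end.

Definition maps f x y : Prop := exists p, is_opair p x y /\ p ∈ f.

Definition function_on f X : Prop :=
  (forall p, p ∈ f -> exists x y, x ∈ X /\ is_opair p x y) /\
  (forall x, x ∈ X -> exists! y, maps f x y).

(* [s] assigns an element of [A] to each of the variables [v_i], [i < m]. *)
Definition assignment A m s : Prop :=
  function_on s m /\ forall i x, maps s i x -> x ∈ A.

(* [t] is the assignment of [m] variables with [t(i) = x] that agrees with [s]
   elsewhere; if [m] is [i + 1], then [s] need only be defined below [i], and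
   [t] is the sequence [s] followed by [x]. *)
Definition update A m s i x t : Prop :=
  assignment A m t /\ maps t i x /\
  forall k, k ∈ m -> k <> i -> forall y, maps s k y <-> maps t k y.

(* [c] is the triple (d, a, b).  Formulas are coded by
     (0, i, j)  v_i ∈ v_j        (2, φ, φ)  not φ
     (1, i, j)  v_i = v_j        (3, φ, ψ)  φ and ψ
                                 (4, i, φ)  there is v_i such that φ *)
Definition is_code (d : nat) c a b : Prop :=
  exists t q, is_numeral d t /\ is_opair q a b /\ is_opair c t q.

Definition entry f k φ R : Prop := exists p, maps f k p /\ is_opair p φ R.

(* Given that each [entry f l ψ S] with [l < k] lists a formula [ψ] together
   with the set [S] of the assignments of [m] variables that satisfy it in
   (A, ∈), [φ] is atomic or built in one step from formulas listed before [k],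
   and [R] is the set of the assignments that satisfy [φ]. *)
Definition sat_step A m f k φ R : Prop :=
  (exists i j, i ∈ m /\ j ∈ m /\ is_code 0 φ i j /\
     forall s, s ∈ R <-> assignment A m s /\
       exists x y, maps s i x /\ maps s j y /\ x ∈ y)
  \/
  (exists i j, i ∈ m /\ j ∈ m /\ is_code 1 φ i j /\
     forall s, s ∈ R <-> assignment A m s /\
       exists x y, maps s i x /\ maps s j y /\ x = y)
  \/
  (exists l ψ S, l ∈ k /\ entry f l ψ S /\ is_code 2 φ ψ ψ /\
     forall s, s ∈ R <-> assignment A m s /\ s ∉ S)
  \/
  (exists l ψ S l' ψ' S', l ∈ k /\ entry f l ψ S /\
     l' ∈ k /\ entry f l' ψ' S' /\ is_code 3 φ ψ ψ' /\
     forall s, s ∈ R <-> assignment A m s /\ s ∈ S /\ s ∈ S')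
  \/
  (exists i l ψ S, i ∈ m /\ l ∈ k /\ entry f l ψ S /\ is_code 4 φ i ψ /\
     forall s, s ∈ R <-> assignment A m s /\
       exists x t, x ∈ A /\ update A m s i x t /\ t ∈ S).

(* [φ] is (the code of) a formula in the variables [v_i], [i < m], and [R] is
   the set of the assignments that satisfy it in (A, ∈), as witnessed by a
   finite construction sequence [f] for [φ]. *)
Definition satisfaction_set A m φ R : Prop :=
  exists n n' f, is_natural n /\ is_succ n' n /\ function_on f n' /\
    (forall k, k ∈ n' ->
       exists ψ S, entry f k ψ S /\ sat_step A m f k ψ S) /\
    entry f n φ R.

(* [y = {x ∈ A : (A, ∈) ⊨ φ(s_0, ..., s_(m-1), x)}] for some formula [φ] and
   parameters [s : m -> A].  The free variable comes last so that [A = ∅] is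
   covered, with [m = 0]. *)
Definition definable_over A y : Prop :=
  exists m m' s φ R, is_natural m /\ is_succ m' m /\ assignment A m s /\
    satisfaction_set A m' φ R /\
    forall x, x ∈ y <-> x ∈ A /\ exists t, update A m' s m x t /\ t ∈ R.

Definition is_Def A D : Prop := forall y, y ∈ D <-> definable_over A y.

(* [f] is the sequence of the L_β for [β ≤ α]. *)
Definition L_sequence α f : Prop :=
  is_ordinal α /\
  exists α', is_succ α' α /\ function_on f α' /\
  forall β X, β ∈ α' -> maps f β X ->
    (is_empty β -> is_empty X) /\
    (forall γ Y, is_succ β γ -> maps f γ Y -> is_Def Y X) /\
    (is_limit β ->
       forall x, x ∈ X <-> exists γ Y, γ ∈ β /\ maps f γ Y /\ x ∈ Y).

Definition constructible x : Prop :=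
  exists α f X, L_sequence α f /\ maps f α X /\ x ∈ X.

End Inside.

Definition L (M : structure) : structure := submodel (@constructible M).

(* Main.v *)
Require Import Defs.
From Stdlib Require Import Classical ClassicalEpsilon FunctionalExtensionality
  PropExtensionality Lia PeanoNat.

(* If [M] has no limit ordinal, then it believes that every set is finite; hence
   separation and collection hold for all formulas, and V = L holds in [M], so
   the identity will do.

   Otherwise let [omega] be the least limit ordinal of [M], let [rk] be a rank
   function of [M] with values above [omega], and enumerate [M] externally as
   a_0, a_1, ...  Choose hereditarily finite sets (elements of L_omega)
     c_s = 2s + 1,
     e_s = {0, 2s + 2} + {c_t : t < s and a_s in a_t},
     d_s = {e_t : t < s and a_t in a_s},
   so that, for all s <> t, a_s in a_t iff c_t in e_s or e_s in d_t.  Then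
     j(a_s) = {y in L_(rk a_s) : y = e_s, or 0 is not in y and some z in y has
                                 0 in z and (c_s in z or z in d_s)}
   is constructible, and e_s is its only element that contains 0.  If a_s is in
   a_t, then j(a_s) lies in L_(rk a_t); so j(a_s) is in j(a_t) iff a_s is in
   a_t.  Nothing has to be known about elements of j(a_s) other than e_s.

   Def(A) exists when there is omega because a set closed under the operations
   that build assignments, construction sequences and satisfaction sets bounds
   every quantifier in its definition, which also makes Def a Sigma_1 operation,
   as the recursion for L_alpha requires. *)

Set Implicit Arguments.
Unset Strict Implicit.

(** * Predicates definable with parameters *)

(** Seen from outside, [M] may be ill-founded, so [j] cannot be built by recursion along membership;
    and as [j] depends on an external enumeration, no set of [M] need collect its values. Hence no
    value of [j] refers to another value: each is a single definable subset of a level of L, and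
    membership between values is decoded from finite parameters. These are sets of [M] because a_s
    is compared only with the finitely many a_t that precede it. Of two elements, the later one
    records the relation, in its e if it is the member and in its d if it is the container. Odd
    numerals are names, 2s + 2 makes e_s determine s, and 0 is a tag that lies in every e_s and in
    no j(a_s), which lets a formula find e_s inside j(a_s). The rank, an internal notion, deals with
    the one remaining obstacle: j(a_t) is cut out of a level, which must already contain j(a_s) when
    a_s is in a_t. Most of the work goes into the levels of L, since KP offers neither power sets
    nor separation for the unbounded definition of Def. *)

Definition up (r : nat -> nat) (i : nat) : nat :=
  match i with 0 => 0 | S i => S (r i) end.

Fixpoint ren (r : nat -> nat) (p : form) : form :=
  match p with
  | fMem i j => fMem (r i) (r j)
  | fEq i j => fEq (r i) (r j)
  | fBot => fBot
  | fImp p q => fImp (ren r p) (ren r q)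
  | fAnd p q => fAnd (ren r p) (ren r q)
  | fOr p q => fOr (ren r p) (ren r q)
  | fAll p => fAll (ren (up r) p)
  | fEx p => fEx (ren (up r) p)
  end.

Lemma scons_up (T : Type) (x : T) e r :
  (fun i => scons x e (up r i)) = scons x (fun i => e (r i)).
Proof. apply functional_extensionality. intros [|i]; reflexivity. Qed.

Lemma sat_ren (M : structure) p : forall r (e : nat -> M),
  sat e (ren r p) <-> sat (fun i => e (r i)) p.
Proof.
  induction p; intros r e; simpl; try tauto; try (rewrite IHp1, IHp2; tauto).
  - split; intros H x; specialize (H x); rewrite IHp, scons_up in *; exact H.
  - split; intros [x H]; exists x; rewrite IHp, scons_up in *; exact H.
Qed.

Lemma delta0_ren p : delta0 p -> forall r, delta0 (ren r p).
Proof. induction 1; intros r; simpl; constructor; auto. Qed.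

Section Definability.
Context {M : structure}.
Notation env := (nat -> M).

Definition ev (o : nat + M) (e : env) : M :=
  match o with inl k => e k | inr a => a end.

(** Variables and parameters are the only terms, the language being relational. Substituting them
    amounts to reading the variables of the same formula differently, which preserves Delta_0. *)
Definition term (t : env -> M) : Prop := exists o, forall e, t e = ev o e.

(* Definability with parameters in [M]: each variable of the formula is read
   off the assignment or is a constant.  With [b = true] the formula is required
   to be Delta_0. *)
Definition definable (b : bool) (P : env -> Prop) : Prop :=
  exists p (o : nat -> nat + M), (b = true -> delta0 p) /\
    forall e, P e <-> sat (fun i => ev (o i) e) p.

Lemma term_var k : term (fun e => e k).
Proof. exists (inl k). reflexivity. Qed.

Lemma term_const a : term (fun _ => a).
Proof. exists (inr a). reflexivity. Qed.

Lemma term_ren t r : term t -> term (fun e => t (fun n => e (r n))).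
Proof.
  intros [[k|a] H]; [exists (inl (r k)) | exists (inr a)]; intros e; rewrite H;
    reflexivity.
Qed.

Lemma definable_ext b P Q :
  definable b P -> (forall e, P e <-> Q e) -> definable b Q.
Proof.
  intros (p & o & Hp & H) HPQ. exists p, o. split; [exact Hp|].
  intros e. rewrite <- HPQ. apply H.
Qed.

Lemma definable_any b P : definable true P -> definable b P.
Proof. intros (p & o & Hp & H). exists p, o. split; auto. Qed.

Lemma definable_atom b (c : nat -> nat -> form) (R : M -> M -> Prop) t u :
  (forall e i j, sat e (c i j) <-> R (e i) (e j)) ->
  (forall i j, delta0 (c i j)) ->
  term t -> term u -> definable b (fun e => R (t e) (u e)).
Proof.
  intros Hc H0 [o Ho] [o' Ho'].
  exists (c 0 1), (fun i => match i with 0 => o | _ => o' end).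
  split; [auto|]. intros e. rewrite Hc, Ho, Ho'. reflexivity.
Qed.

Lemma definable_mem b t u : term t -> term u -> definable b (fun e => t e ∈ u e).
Proof. apply (@definable_atom b fMem); [reflexivity | constructor]. Qed.

Lemma definable_eq b t u : term t -> term u -> definable b (fun e => t e = u e).
Proof. apply (@definable_atom b fEq (@eq M)); [reflexivity | constructor]. Qed.

Lemma definable_const b (P : Prop) : definable b (fun _ => P).
Proof.
  destruct (classic P).
  - exists (fImp fBot fBot), (fun i => inl i). repeat constructor; simpl; tauto.
  - exists fBot, (fun i => inl i). repeat constructor; simpl; tauto.
Qed.

(** The two formulas read their variables through different maps. Moving those of [p] to even
    positions and those of [q] to odd ones lets one map serve both. *)
Lemma definable_binary b (c : form -> form -> form) (R : Prop -> Prop -> Prop) P Q :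
  (forall e p q, @sat M e (c p q) = R (sat e p) (sat e q)) ->
  (forall p q, delta0 p -> delta0 q -> delta0 (c p q)) ->
  definable b P -> definable b Q -> definable b (fun e => R (P e) (Q e)).
Proof.
  intros Hc H0 (p & o & Hp & HP) (q & o' & Hq & HQ).
  exists (c (ren (fun i => 2 * i) p) (ren (fun i => S (2 * i)) q)),
    (fun i => if Nat.even i then o (Nat.div2 i) else o' (Nat.div2 i)).
  split; [intros; apply H0; apply delta0_ren; auto|].
  intros e. rewrite Hc.
  replace (P e) with (sat (fun i => ev (o i) e) p)
    by (symmetry; apply propositional_extensionality; apply HP).
  replace (Q e) with (sat (fun i => ev (o' i) e) q)
    by (symmetry; apply propositional_extensionality; apply HQ).
  assert (E : forall X Y X' Y' : Prop, (X <-> X') -> (Y <-> Y') -> (R X Y <-> R X' Y')).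
  { intros X Y X' Y' H1 H2. apply propositional_extensionality in H1, H2.
    subst. reflexivity. }
  apply E; rewrite sat_ren.
  - replace (fun i : nat => ev (o i) e) with
      (fun i => ev (if Nat.even (2 * i) then o (Nat.div2 (2 * i))
                    else o' (Nat.div2 (2 * i))) e); [reflexivity|].
    apply functional_extensionality. intros i.
    rewrite Nat.div2_double, Nat.even_even. reflexivity.
  - replace (fun i : nat => ev (o' i) e) with
      (fun i => ev (if Nat.even (S (2 * i)) then o (Nat.div2 (S (2 * i)))
                    else o' (Nat.div2 (S (2 * i)))) e); [reflexivity|].
    apply functional_extensionality. intros i.
    rewrite Nat.div2_succ_double, Nat.even_succ, Nat.odd_even. reflexivity.
Qed.

Lemma definable_and b P Q :
  definable b P -> definable b Q -> definable b (fun e => P e /\ Q e).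
Proof. apply (@definable_binary b fAnd); [reflexivity | constructor; auto]. Qed.

Lemma definable_or b P Q :
  definable b P -> definable b Q -> definable b (fun e => P e \/ Q e).
Proof. apply (@definable_binary b fOr); [reflexivity | constructor; auto]. Qed.

Lemma definable_imp b P Q :
  definable b P -> definable b Q -> definable b (fun e => P e -> Q e).
Proof.
  apply (@definable_binary b fImp (fun X Y => X -> Y));
    [reflexivity | constructor; auto].
Qed.

Lemma definable_iff b P Q :
  definable b P -> definable b Q -> definable b (fun e => P e <-> Q e).
Proof. intros. apply definable_and; apply definable_imp; assumption. Qed.

Lemma definable_not b P : definable b P -> definable b (fun e => ~ P e).
Proof. intros. apply definable_imp; [assumption | apply definable_const]. Qed.

(** A quantifier binds one de Bruijn variable, whereas the formula of the body may read [e 0] at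
    many positions; all of these are merged into position 0. Position 1 under the binder is kept for
    [o0], the bound of a bounded quantifier, which [delta0] requires to be a variable. *)
Lemma definable_body b (P : M -> env -> Prop) (o0 : nat + M) :
  definable b (fun e => P (e 0) (fun n => e (S n))) ->
  exists p (o : nat -> nat + M), (b = true -> delta0 p) /\ o 0 = o0 /\
    forall x e, P x e <-> sat (scons x (fun i => ev (o i) e)) p.
Proof.
  intros (p & o & Hp & H).
  set (r := fun i => match o i with inl 0 => 0 | _ => S (S i) end).
  exists (ren r p),
    (fun i => match i with
              | 0 => o0
              (* The result [inl 0] in the case [inl 0] is a filler: [r] has sent these positions to
                 0. *)
              | S i => match o i with inl (S k) => inl k | inl 0 => inl 0
                                 | inr a => inr a end
              end).
  split; [intros; apply delta0_ren; auto | split; [reflexivity|]].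
  intros x e. rewrite sat_ren. rewrite (H (scons x e)).
  match goal with |- sat ?f _ <-> sat ?g _ => replace g with f; [reflexivity|] end.
  apply functional_extensionality. intros i. unfold r.
  destruct (o i) as [[|k]|a] eqn:E; simpl; rewrite ?E; reflexivity.
Qed.

Lemma definable_ball b t (P : M -> env -> Prop) : term t ->
  definable b (fun e => P (e 0) (fun n => e (S n))) ->
  definable b (fun e => forall x, x ∈ t e -> P x e).
Proof.
  intros [o0 H0] HP. destruct (definable_body o0 HP) as (p & o & Hp & Ho & H).
  exists (fAll (fImp (fMem 0 1) p)), o. split; [constructor; auto|].
  intros e. simpl. rewrite Ho, <- H0.
  split; intros G x Hx; apply H, G, Hx.
Qed.

Lemma definable_bex b t (P : M -> env -> Prop) : term t ->
  definable b (fun e => P (e 0) (fun n => e (S n))) ->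
  definable b (fun e => exists x, x ∈ t e /\ P x e).
Proof.
  intros [o0 H0] HP. destruct (definable_body o0 HP) as (p & o & Hp & Ho & H).
  exists (fEx (fAnd (fMem 0 1) p)), o. split; [constructor; auto|].
  intros e. simpl. rewrite Ho, <- H0.
  split; intros (x & Hx & G); exists x; (split; [exact Hx|]);
    apply H, G.
Qed.

Lemma definable_all (P : M -> env -> Prop) :
  definable false (fun e => P (e 0) (fun n => e (S n))) ->
  definable false (fun e => forall x, P x e).
Proof.
  intros HP. destruct (definable_body (inl 0) HP) as (p & o & _ & _ & H).
  exists (fAll p), o. split; [discriminate|].
  intros e. simpl. split; intros G x; apply H, G.
Qed.

Lemma definable_ex (P : M -> env -> Prop) :
  definable false (fun e => P (e 0) (fun n => e (S n))) ->
  definable false (fun e => exists x, P x e).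
Proof.
  intros HP. destruct (definable_body (inl 0) HP) as (p & o & _ & _ & H).
  exists (fEx p), o. split; [discriminate|].
  intros e. simpl. split; intros (x & G); exists x; apply H, G.
Qed.

Lemma definable_subst b (P : env -> Prop) (u : nat -> env -> M) :
  definable b P -> (forall i, term (u i)) -> definable b (fun e => P (fun i => u i e)).
Proof.
  intros (p & o & Hp & H) Hu.
  exists p, (fun i => match o i with
                      | inl k => proj1_sig (constructive_indefinite_description _ (Hu k))
                      | inr a => inr a end).
  split; [exact Hp|]. intros e. rewrite H.
  match goal with |- sat ?f _ <-> sat ?g _ => replace g with f; [reflexivity|] end.
  apply functional_extensionality. intros i.
  destruct (o i) as [k|a]; [|reflexivity].
  destruct (constructive_indefinite_description _ (Hu k)) as [c Hc]. simpl. apply Hc.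
Qed.

Lemma definable_subst2 b (R : M -> M -> Prop) t u :
  definable b (fun e => R (e 0) (e 1)) -> term t -> term u ->
  definable b (fun e => R (t e) (u e)).
Proof.
  intros H Ht Hu.
  apply (definable_subst (P := fun e => R (e 0) (e 1))
    (u := fun i => match i with 0 => t | _ => u end)); [exact H|].
  intros [|i]; assumption.
Qed.

Lemma definable_subst3 b (R : M -> M -> M -> Prop) t u v :
  definable b (fun e => R (e 0) (e 1) (e 2)) -> term t -> term u -> term v ->
  definable b (fun e => R (t e) (u e) (v e)).
Proof.
  intros H Ht Hu Hv.
  apply (definable_subst (P := fun e => R (e 0) (e 1) (e 2))
    (u := fun i => match i with 0 => t | 1 => u | _ => v end)); [exact H|].
  intros [|[|i]]; assumption.
Qed.

End Definability.

Ltac term_tac :=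
  lazymatch goal with
  | |- forall _ : nat, term _ => intro; term_tac
  | |- term _ =>
    first [ assumption | apply term_var | apply term_const
          | apply term_ren; assumption ]
  end.

Create HintDb definability.

(** A hook, redefined once quantifiers over the components of an ordered pair are known to be
    bounded. *)
Ltac def_extra := fail.

(** Bounded rules are tried before unbounded ones. The latter apply only with the flag [false], so a
    Delta_0 goal is solved only by rules that bound every quantifier. *)
Ltac def_step :=
  cbv beta;
  lazymatch goal with
  | |- term _ => term_tac
  | |- definable _ (fun e => @?P e /\ @?Q e) => apply definable_and
  | |- definable _ (fun e => @?P e \/ @?Q e) => apply definable_or
  | |- definable _ (fun e => ~ @?P e) => apply definable_not
  | |- definable _ (fun e => @?P e <-> @?Q e) => apply definable_iff
  | |- definable _ (fun e => exists x, x ∈ _ /\ _) => refine (@definable_bex _ _ _ _ _ _)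
  | |- definable _ (fun e => exists x, _) =>
    first [ solve [eauto 2 with definability nocore] | def_extra
          | refine (@definable_ex _ _ _) ]
  | |- definable _ (fun e => @mem _ _ _) => apply definable_mem
  | |- definable _ (fun e => @eq _ _ _) =>
    first [ solve [apply definable_eq; term_tac]
          | solve [eauto 2 with definability nocore] ]
  | |- definable _ (fun e => False) => apply definable_const
  | |- definable _ (fun e => True) => apply definable_const
  | |- definable _ _ =>
    first [ assumption
          | solve [eauto 2 with definability nocore]
          | refine (@definable_ball _ _ _ _ _ _)
          | apply definable_imp
          | refine (@definable_all _ _ _) ]
  end.

Ltac def_tac := repeat def_step.

(** * Elementary set operations *)

Section SetOperations.
Context {M : structure}.
Implicit Types a b x y z : M.

(** Hilbert's epsilon makes the set operations total, so they can be written without proofs of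
    existence; [the_set_spec] recovers the specification wherever the set exists. *)
Definition the_set (d : M) (P : M -> Prop) : M :=
  epsilon (inhabits d) (fun y => forall z, z ∈ y <-> P z).

Definition upair a b := the_set a (fun z => z = a \/ z = b).
Definition opair a b := upair (upair a a) (upair a b).
Definition union x := the_set x (fun z => exists y, z ∈ y /\ y ∈ x).
Definition cup x y := union (upair x y).
Definition adj x a := cup x (upair a a).
Definition sep x (P : M -> Prop) := the_set x (fun z => z ∈ x /\ P z).

End SetOperations.

(** * Delta_0 forms of the basic notions *)

Section DefinableNotions.
Context {M : structure}.
Notation env := (nat -> M).
Variable b : bool.
Implicit Types t u v w : env -> M.

Lemma definable_ren (P : env -> Prop) r :
  definable b P -> definable b (fun e => P (fun n => e (r n))).
Proof.
  intros H. apply (definable_subst (u := fun i e => e (r i))); [exact H|].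
  intros i. apply term_var.
Qed.

Lemma definable_is_empty t : term t -> definable b (fun e => is_empty (t e)).
Proof.
  intros. apply definable_ext with (fun e => forall z, z ∈ t e -> False);
    [def_tac | reflexivity].
Qed.

Lemma definable_is_upair t u v : term t -> term u -> term v ->
  definable b (fun e => is_upair (t e) (u e) (v e)).
Proof.
  intros. apply definable_ext with (fun e => u e ∈ t e /\ v e ∈ t e /\
    forall z, z ∈ t e -> z = u e \/ z = v e).
  - def_tac.
  - intros e. unfold is_upair. firstorder (subst; auto).
Qed.

Hint Extern 1 (term _) => term_tac : definability.
Hint Resolve definable_is_upair definable_is_empty : definability.

Lemma definable_is_opair t u v : term t -> term u -> term v ->
  definable b (fun e => is_opair (t e) (u e) (v e)).
Proof.
  intros. apply definable_ext with (fun e => exists x, x ∈ t e /\ exists y, y ∈ t e /\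
    is_upair x (u e) (u e) /\ is_upair y (u e) (v e) /\ is_upair (t e) x y).
  - def_tac.
  - intros e. unfold is_opair. split.
    + intros (x & Hx & y & Hy & H'). eauto.
    + intros (x & y & Hx & Hy & Hp). exists x. split; [apply Hp; auto|].
      exists y. split; [apply Hp; auto|]. auto.
Qed.

(* The components of an ordered pair lie in its union, which bounds the
   quantifiers over them. *)
Lemma definable_ex_opair t (P : M -> M -> env -> Prop) : term t ->
  definable b (fun e => P (e 1) (e 0) (fun n => e (S (S n)))) ->
  definable b (fun e => exists x y, is_opair (t e) x y /\ P x y e).
Proof.
  intros Ht HP.
  apply definable_ext with (fun e => exists p, p ∈ t e /\ exists q, q ∈ t e /\
    exists x, x ∈ p /\ exists y, y ∈ q /\ is_opair (t e) x y /\ P x y e).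
  - repeat first [apply definable_bex; cbv beta; [def_tac|]].
    apply definable_and; [apply definable_is_opair; def_tac|].
    apply (definable_ren (fun n => match n with S (S n) => S (S (S (S n))) | n => n end)) in HP.
    exact HP.
  - intros e. split.
    + intros (p & _ & q & _ & x & _ & y & _ & H). eauto.
    + intros (x & y & (p & q & Hp & Hq & H) & HP').
      exists p. split; [apply H; auto|]. exists q. split; [apply H; auto|].
      exists x. split; [apply Hp; auto|]. exists y. split; [apply Hq; auto|].
      split; [exists p, q|]; auto.
Qed.

Lemma definable_is_succ t u : term t -> term u ->
  definable b (fun e => is_succ (t e) (u e)).
Proof.
  intros. apply definable_ext with (fun e => u e ∈ t e /\
    (forall z, z ∈ u e -> z ∈ t e) /\ forall z, z ∈ t e -> z ∈ u e \/ z = u e).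
  - def_tac.
  - intros e. unfold is_succ. firstorder (subst; auto).
Qed.

Lemma definable_is_transitive t : term t -> definable b (fun e => is_transitive (t e)).
Proof.
  intros. apply definable_ext with
    (fun e => forall y, y ∈ t e -> forall z, z ∈ y -> z ∈ t e); [def_tac|].
  firstorder.
Qed.

Lemma definable_maps t u v : term t -> term u -> term v ->
  definable b (fun e => maps (t e) (u e) (v e)).
Proof.
  intros. apply definable_ext with
    (fun e => exists p, p ∈ t e /\ is_opair p (u e) (v e)).
  - apply definable_bex; [assumption|]. apply definable_is_opair; def_tac.
  - firstorder.
Qed.
End DefinableNotions.

#[export] Hint Extern 1 (term _) => term_tac : definability.
#[export] Hint Resolve definable_is_upair definable_is_empty definable_is_opair
  definable_is_succ definable_is_transitive definable_maps : definability.

Ltac def_extra ::= refine (@definable_ex_opair _ _ _ _ _ _).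

Section MoreDefinableNotions.
Context {M : structure}.
Notation env := (nat -> M).
Variable b : bool.
Implicit Types t u v w : env -> M.

Lemma definable_is_ordinal t : term t -> definable b (fun e => is_ordinal (t e)).
Proof. intros. unfold is_ordinal. def_tac. Qed.

Lemma definable_ex_succ t : term t -> definable b (fun e => exists y, is_succ (t e) y).
Proof.
  intros. apply definable_ext with (fun e => exists y, y ∈ t e /\ is_succ (t e) y).
  - def_tac.
  - intros e. split; [firstorder|]. intros [y Hy]. exists y. split; [|exact Hy].
    apply Hy. auto.
Qed.
End MoreDefinableNotions.
#[export] Hint Resolve definable_is_ordinal definable_ex_succ : definability.

Section DefinableNaturals.
Context {M : structure}.
Notation env := (nat -> M).
Variable b : bool.
Implicit Types t u v w : env -> M.

Lemma definable_is_limit t : term t -> definable b (fun e => is_limit (t e)).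
Proof.
  intros. unfold is_limit. def_tac.
Qed.

Lemma definable_is_natural t : term t -> definable b (fun e => is_natural (t e)).
Proof.
  intros. apply definable_ext with (fun e => is_ordinal (t e) /\
    (is_empty (t e) \/ exists l, is_succ (t e) l) /\
    forall k, k ∈ t e -> is_empty k \/ exists l, is_succ k l).
  - def_tac.
  - intros e. unfold is_natural. firstorder (subst; auto).
Qed.

Lemma definable_is_numeral d : forall t, term t ->
  definable b (fun e => is_numeral d (t e)).
Proof.
  induction d; intros t Ht; simpl; [auto with definability|].
  apply definable_ext with
    (fun e => exists y, y ∈ t e /\ is_numeral d y /\ is_succ (t e) y).
  - apply definable_bex; [assumption|].
    apply definable_and; [apply IHd; def_tac | def_tac].
  - intros e. split; [firstorder|]. intros (y & Hy & Hs). exists y.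
    split; [apply Hs|]; auto.
Qed.

End DefinableNaturals.
#[export] Hint Resolve definable_is_limit definable_is_natural definable_is_numeral
  : definability.

(** * The axioms for definable predicates; pairs and foundation *)

Section Basics.
Context {M : structure} (HKP : KP M).
Notation env := (nat -> M).
Implicit Types a b x y z u v w : M.

(** As [P] looks only at [e 0], its formula may be evaluated at the constant assignment [x], and all
    variables that read the assignment merge into one. *)
Lemma formula1 c (P : M -> Prop) : definable c (fun e => P (e 0)) ->
  exists p e, (c = true -> delta0 p) /\ forall x, P x <-> sat (scons x e) p.
Proof.
  intros (p & o & Hp & H). destruct (KP_empty HKP) as [d _].
  exists (ren (fun i => match o i with inl _ => 0 | inr _ => S i end) p),
    (fun i => match o i with inl _ => d | inr a => a end).
  split; [intros; apply delta0_ren; auto|].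
  intros x. rewrite sat_ren, (H (fun _ => x)).
  match goal with |- sat ?f _ <-> sat ?g _ => replace g with f; [reflexivity|] end.
  apply functional_extensionality. intros i.
  destruct (o i) eqn:E; simpl; rewrite ?E; reflexivity.
Qed.

(** The same merging at the assignment x, y, y, ...; the order [scons y (scons x e)] is the one in
    the collection axiom, so [x] gets position 1. *)
Lemma formula2 c (P : M -> M -> Prop) : definable c (fun e => P (e 0) (e 1)) ->
  exists p e, (c = true -> delta0 p) /\
    forall x y, P x y <-> sat (scons y (scons x e)) p.
Proof.
  intros (p & o & Hp & H). destruct (KP_empty HKP) as [d _].
  exists (ren (fun i => match o i with inl 0 => 1 | inl _ => 0 | inr _ => S (S i) end) p),
    (fun i => match o i with inl _ => d | inr a => a end).
  split; [intros; apply delta0_ren; auto|].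
  intros x y. rewrite sat_ren, (H (scons x (fun _ => y))).
  match goal with |- sat ?f _ <-> sat ?g _ => replace g with f; [reflexivity|] end.
  apply functional_extensionality. intros i.
  destruct (o i) as [[|k]|a] eqn:E; simpl; rewrite ?E; reflexivity.
Qed.

Lemma set_ext x y : (forall z, z ∈ x <-> z ∈ y) -> x = y.
Proof. apply (KP_extensionality HKP). Qed.

Lemma separation (P : M -> Prop) : definable true (fun e => P (e 0)) ->
  forall a, exists c, forall x, x ∈ c <-> x ∈ a /\ P x.
Proof.
  intros H a. destruct (formula1 H) as (p & e & Hp & E).
  destruct (KP_separation HKP (Hp eq_refl) e a) as [c Hc]. exists c.
  intros x. rewrite E. apply Hc.
Qed.

Lemma delta0_collection (P : M -> M -> Prop) :
  definable true (fun e => P (e 0) (e 1)) ->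
  forall a, (forall x, x ∈ a -> exists y, P x y) ->
  exists c, forall x, x ∈ a -> exists y, y ∈ c /\ P x y.
Proof.
  intros H a Ha. destruct (formula2 H) as (p & e & Hp & E).
  destruct (KP_collection HKP (p := p)) with (e := e) (a := a) as [c Hc]; auto.
  - intros x Hx. destruct (Ha x Hx) as [y Hy]. exists y. apply E, Hy.
  - exists c. intros x Hx. destruct (Hc x Hx) as (y & Hy & Hs). exists y.
    split; [exact Hy|]. apply E, Hs.
Qed.

(** Foundation is a schema for all formulas, so predicates of any complexity are allowed. This
    replaces external well-foundedness throughout. *)
Lemma mem_induction (P : M -> Prop) : definable false (fun e => P (e 0)) ->
  (forall x, (forall y, y ∈ x -> P y) -> P x) -> forall x, P x.
Proof.
  intros H IH x. apply NNPP. intros Hx.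
  destruct (formula1 (P := fun x => ~ P x) (definable_not H)) as (p & e & _ & E).
  destruct (KP_foundation HKP (p := p) (e := e)) as (m & Hm & Hmin).
  - exists x. apply E, Hx.
  - apply E in Hm. apply Hm, IH. intros y Hy. apply NNPP. intros Hn.
    apply (Hmin y Hy), E, Hn.
Qed.

Lemma the_set_spec d (P : M -> Prop) :
  (exists y, forall z, z ∈ y <-> P z) -> forall z, z ∈ the_set d P <-> P z.
Proof. intros H. unfold the_set. apply epsilon_spec, H. Qed.

Lemma in_upair a b z : z ∈ upair a b <-> z = a \/ z = b.
Proof.
  revert z. apply the_set_spec. destruct (KP_pairing HKP a b) as (c & Ha & Hb).
  destruct (@separation (fun x => x = a \/ x = b)) with (a := c) as [y Hy]; [def_tac|].
  exists y. intros z. rewrite Hy. split; [tauto|]. intros [->| ->]; auto.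
Qed.

Lemma in_union x z : z ∈ union x <-> exists y, z ∈ y /\ y ∈ x.
Proof.
  revert z. apply the_set_spec. destruct (KP_union HKP x) as (c & Hc).
  destruct (@separation (fun z => exists y, y ∈ x /\ z ∈ y)) with (a := c) as [u Hu];
    [def_tac|].
  exists u. intros z. rewrite Hu. firstorder.
Qed.

Lemma in_cup x y z : z ∈ cup x y <-> z ∈ x \/ z ∈ y.
Proof.
  unfold cup. rewrite in_union. split.
  - intros (w & Hz & Hw). apply in_upair in Hw. destruct Hw; subst; auto.
  - intros [H|H]; [exists x | exists y]; (split; [exact H | apply in_upair; auto]).
Qed.

Lemma in_adj x a z : z ∈ adj x a <-> z ∈ x \/ z = a.
Proof. unfold adj. rewrite in_cup, in_upair. tauto. Qed.

Lemma in_sep x (P : M -> Prop) : definable true (fun e => P (e 0)) ->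
  forall z, z ∈ sep x P <-> z ∈ x /\ P z.
Proof. intros H. apply the_set_spec, separation, H. Qed.

Lemma is_upair_iff p a b : is_upair p a b <-> p = upair a b.
Proof.
  split.
  - intros H. apply set_ext. intros z. rewrite in_upair. apply H.
  - intros -> z. apply in_upair.
Qed.

Lemma is_opair_iff p a b : is_opair p a b <-> p = opair a b.
Proof.
  split.
  - intros (u & v & Hu & Hv & Hp). apply is_upair_iff in Hu, Hv, Hp. subst. reflexivity.
  - intros ->. exists (upair a a), (upair a b). rewrite !is_upair_iff. auto.
Qed.

Lemma is_succ_iff y x : is_succ y x <-> y = adj x x.
Proof.
  split.
  - intros H. apply set_ext. intros z. rewrite in_adj. apply H.
  - intros -> z. apply in_adj.
Qed.

Lemma upair_inj a b c d : upair a b = upair c d -> a = c /\ b = d \/ a = d /\ b = c.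
Proof.
  intros E.
  assert (H : forall z, z = a \/ z = b <-> z = c \/ z = d)
    by (intros z; rewrite <- !in_upair, E; reflexivity).
  destruct (proj1 (H a) (or_introl eq_refl)) as [->|Ha];
  destruct (proj1 (H b) (or_intror eq_refl)) as [Hb|Hb];
  destruct (proj2 (H c) (or_introl eq_refl)) as [Hc|Hc];
  destruct (proj2 (H d) (or_intror eq_refl)) as [Hd|Hd]; subst; auto.
Qed.

Lemma opair_inj a b c d : opair a b = opair c d -> a = c /\ b = d.
Proof.
  intros E. destruct (upair_inj E) as [[E1 E2]|[E1 E2]];
  apply upair_inj in E1; apply upair_inj in E2;
  destruct E1 as [[? ?]|[? ?]]; destruct E2 as [[? ?]|[? ?]]; subst; auto.
Qed.

Lemma maps_iff f x y : maps f x y <-> opair x y ∈ f.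
Proof.
  split.
  - intros (p & Hp & Hf). apply is_opair_iff in Hp. subst. exact Hf.
  - intros H. exists (opair x y). rewrite is_opair_iff. auto.
Qed.

Lemma foundation_set a : (exists x, x ∈ a) ->
  exists x, x ∈ a /\ forall y, y ∈ x -> y ∉ a.
Proof.
  intros H. apply NNPP. intros Hn. destruct H as [x Hx]. revert x Hx.
  apply (@mem_induction (fun x => x ∉ a)); [def_tac|].
  intros x IH Hx. apply Hn. eauto.
Qed.

Lemma mem_irrefl x : x ∉ x.
Proof.
  intros H. destruct (foundation_set (a := upair x x)) as (m & Hm & Hmin).
  - exists x. apply in_upair. auto.
  - apply in_upair in Hm. assert (m = x) by tauto. subst.
    apply (Hmin x H), in_upair. auto.
Qed.

Lemma mem_asym x y : x ∈ y -> y ∉ x.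
Proof.
  intros H H'. destruct (foundation_set (a := upair x y)) as (m & Hm & Hmin).
  - exists x. apply in_upair. auto.
  - apply in_upair in Hm. destruct Hm; subst.
    + apply (Hmin y H'), in_upair. auto.
    + apply (Hmin x H), in_upair. auto.
Qed.

End Basics.

(** * Collection and recursion along membership *)

(* What recursion along the membership relation needs of a class of definable
   predicates: collection, and closure under the positive connectives. *)
Record collective (M : structure) (C : ((nat -> M) -> Prop) -> Prop) : Prop := {
  coll_delta0 : forall P, definable true P -> C P;
  coll_definable : forall P, C P -> definable false P;
  coll_ext : forall P Q, C P -> (forall e, P e <-> Q e) -> C Q;
  coll_and : forall P Q, C P -> C Q -> C (fun e => P e /\ Q e);
  coll_ex : forall P : M -> (nat -> M) -> Prop,
    C (fun e => P (e 0) (fun n => e (S n))) -> C (fun e => exists x, P x e);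
  coll_ball : forall t (P : M -> (nat -> M) -> Prop), term t ->
    C (fun e => P (e 0) (fun n => e (S n))) ->
    C (fun e => forall x, x ∈ t e -> P x e);
  coll_subst : forall P (u : nat -> (nat -> M) -> M),
    C P -> (forall i, term (u i)) -> C (fun e => P (fun i => u i e));
  coll_collection : forall P : M -> M -> Prop, C (fun e => P (e 0) (e 1)) ->
    forall a, (forall x, x ∈ a -> exists y, P x y) ->
    exists c, (forall x, x ∈ a -> exists y, y ∈ c /\ P x y) /\
      forall y, y ∈ c -> exists x, x ∈ a /\ P x y
}.

(** The Sigma_1 predicates, which form a [collective] class in every model of KP. One unbounded
    quantifier is enough, because a set that contains several witnesses can stand for all of
    them. *)
Definition sigma (M : structure) (P : (nat -> M) -> Prop) : Prop :=
  exists Q : M -> (nat -> M) -> Prop,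
    definable true (fun e => Q (e 0) (fun n => e (S n))) /\
    forall e, P e <-> exists w, Q w e.

Section Sigma.
Context {M : structure} (HKP : KP M).
Notation env := (nat -> M).
Implicit Types P : env -> Prop.

Lemma sigma_delta0 P : definable true P -> sigma P.
Proof.
  intros H. exists (fun _ => P). split.
  - apply (definable_ren S H).
  - intros e. split; [intros H'; exists (e 0); exact H' | intros [_ H']; exact H'].
Qed.

Lemma sigma_ext P Q : sigma P -> (forall e, P e <-> Q e) -> sigma Q.
Proof.
  intros (R & HR & E) EQ. exists R. split; [exact HR|].
  intros e. rewrite <- EQ. apply E.
Qed.

Lemma sigma_definable P : sigma P -> definable false P.
Proof.
  intros (R & HR & E). apply definable_ext with (fun e => exists w, R w e).
  - apply definable_ex, definable_any, HR.
  - intros e. symmetry. apply E.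
Qed.

Lemma sigma_and P Q : sigma P -> sigma Q -> sigma (fun e => P e /\ Q e).
Proof.
  intros (R & HR & E) (R' & HR' & E').
  exists (fun v e => (exists w, w ∈ v /\ R w e) /\ exists w, w ∈ v /\ R' w e). split.
  - apply definable_and; apply definable_bex; cbv beta; try term_tac.
    + apply (definable_ren (fun n => match n with 0 => 0 | S n => S (S n) end) HR).
    + apply (definable_ren (fun n => match n with 0 => 0 | S n => S (S n) end) HR').
  - intros e. rewrite E, E'. split.
    + intros [[w Hw] [w' Hw']]. exists (upair w w').
      split; [exists w | exists w']; (split; [apply in_upair; auto | assumption]).
    + intros (v & (w & _ & H) & (w' & _ & H')). eauto.
Qed.

Lemma sigma_ex (P : M -> env -> Prop) :
  sigma (fun e => P (e 0) (fun n => e (S n))) -> sigma (fun e => exists x, P x e).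
Proof.
  intros (R & HR & E).
  exists (fun v e => exists x, x ∈ v /\ exists w, w ∈ v /\ R w (scons x e)). split.
  - apply definable_bex; [term_tac|]. cbv beta.
    apply definable_bex; [term_tac|]. cbv beta.
    apply (definable_ren
      (fun n => match n with 0 => 0 | 1 => 1 | S n => S (S n) end)) in HR.
    eapply definable_ext; [exact HR|]. intros e. cbv beta.
    match goal with |- R ?x ?f <-> R ?y ?g => replace g with f; [reflexivity|] end.
    apply functional_extensionality. intros [|n]; reflexivity.
  - intros e. split.
    + intros [x Hx]. apply (E (scons x e)) in Hx. destruct Hx as [w Hw].
      exists (upair x w). exists x. split; [apply in_upair; auto|].
      exists w. split; [apply in_upair; auto | exact Hw].
    + intros (v & x & _ & w & _ & H). exists x. apply (E (scons x e)). eauto.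
Qed.

(** Delta_0 collection gathers witnesses for all elements of [t e] into one set [c], which moves the
    unbounded quantifier outside the bounded one. *)
Lemma sigma_ball t (P : M -> env -> Prop) : term t ->
  sigma (fun e => P (e 0) (fun n => e (S n))) ->
  sigma (fun e => forall x, x ∈ t e -> P x e).
Proof.
  intros Ht (R & HR & E).
  exists (fun c e => forall x, x ∈ t e -> exists w, w ∈ c /\ R w (scons x e)). split.
  - apply definable_ball; [term_tac|]. cbv beta.
    apply definable_bex; [term_tac|]. cbv beta.
    apply (definable_ren
      (fun n => match n with 0 => 0 | 1 => 1 | S n => S (S n) end)) in HR.
    eapply definable_ext; [exact HR|]. intros e. cbv beta.
    match goal with |- R ?x ?f <-> R ?y ?g => replace g with f; [reflexivity|] end.
    apply functional_extensionality. intros [|n]; reflexivity.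
  - intros e. split.
    + intros H. apply (delta0_collection HKP (P := fun x w => R w (scons x e))).
      * apply (definable_subst (u := fun i => match i with
          0 => fun e' => e' 1 | 1 => fun e' => e' 0 | S (S n) => fun _ => e n end)) in HR;
          [|intros [|[|i]]; term_tac].
        eapply definable_ext; [exact HR|]. intros e'. cbv beta.
        match goal with |- R ?x ?f <-> R ?y ?g => replace g with f; [reflexivity|] end.
        apply functional_extensionality. intros [|n]; reflexivity.
      * intros x Hx. apply (E (scons x e)). apply H, Hx.
    + intros [c Hc] x Hx. destruct (Hc x Hx) as (w & _ & Hw).
      apply (E (scons x e)). eauto.
Qed.

Lemma sigma_subst P (u : nat -> env -> M) :
  sigma P -> (forall i, term (u i)) -> sigma (fun e => P (fun i => u i e)).
Proof.
  intros (R & HR & E) Hu. exists (fun w e => R w (fun i => u i e)). split.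
  - apply (definable_subst (u := fun i => match i with
      0 => fun e => e 0 | S i => fun e => u i (fun n => e (S n)) end)) in HR.
    + exact HR.
    + intros [|i]; [term_tac|]. apply term_ren, Hu.
  - intros e. apply E.
Qed.

Lemma sigma_collection (P : M -> M -> Prop) : sigma (fun e => P (e 0) (e 1)) ->
  forall a, (forall x, x ∈ a -> exists y, P x y) ->
  exists c, (forall x, x ∈ a -> exists y, y ∈ c /\ P x y) /\
    forall y, y ∈ c -> exists x, x ∈ a /\ P x y.
Proof.
  intros (R & HR & E) a Ha.
  assert (E' : forall x y, P x y <-> exists w, R w (scons x (fun _ => y)))
    by (intros x y; apply (E (scons x (fun _ => y)))).
  assert (D : definable true (fun e => R (e 0) (scons (e 1) (fun _ => e 2)))).
  { apply (definable_subst (u := fun i => match i with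
      0 => fun e => e 0 | 1 => fun e' => e' 1 | S (S n) => fun e => e 2 end)) in HR;
      [|intros [|[|i]]; term_tac].
    eapply definable_ext; [exact HR|]. intros e'. cbv beta.
    match goal with |- R ?x ?f <-> R ?y ?g => replace g with f; [reflexivity|] end.
    apply functional_extensionality. intros [|n]; reflexivity. }
  destruct (delta0_collection HKP (P := fun x v => exists y, y ∈ v /\ exists w, w ∈ v /\
    R w (scons x (fun _ => y)))) with (a := a) as [c Hc].
  - apply definable_bex; [term_tac|]. cbv beta.
    apply definable_bex; [term_tac|]. cbv beta.
    apply (definable_ren (fun n => match n with 0 => 0 | 1 => 2 | _ => 1 end) D).
  - intros x Hx. destruct (Ha x Hx) as [y Hy]. apply E' in Hy. destruct Hy as [w Hw].
    exists (upair y w), y. split; [apply (in_upair HKP); auto|].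
    exists w. split; [apply (in_upair HKP); auto | exact Hw].
  - destruct (separation HKP (P := fun y => exists x, x ∈ a /\ exists w, w ∈ union c /\
      R w (scons x (fun _ => y)))) with (a := union c) as [d Hd].
    { apply definable_bex; [term_tac|]. cbv beta.
      apply definable_bex; [term_tac|]. cbv beta.
      apply (definable_ren (fun n => match n with 0 => 0 | 1 => 1 | _ => 2 end) D). }
    exists d. split.
    + intros x Hx. destruct (Hc x Hx) as (v & Hv & y & Hy & w & Hw & H).
      exists y. split; [|apply E'; eauto]. apply Hd.
      split; [apply (in_union HKP); eauto|]. exists x. split; [exact Hx|].
      exists w. split; [apply (in_union HKP); eauto | exact H].
    + intros y Hy. apply Hd in Hy. destruct Hy as (_ & x & Hx & w & _ & H).
      exists x. split; [exact Hx|]. apply E'. eauto.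
Qed.

Lemma sigma_collective : collective (@sigma M).
Proof.
  constructor.
  - apply sigma_delta0.
  - apply sigma_definable.
  - apply sigma_ext.
  - apply sigma_and.
  - apply sigma_ex.
  - apply sigma_ball.
  - apply sigma_subst.
  - apply sigma_collection.
Qed.

End Sigma.

Section Recursion.
Context {M : structure} (HKP : KP M).
Notation env := (nat -> M).
Variable C : (env -> Prop) -> Prop.
Hypothesis HC : collective C.

Lemma coll_bex t (P : M -> env -> Prop) : term t ->
  C (fun e => P (e 0) (fun n => e (S n))) ->
  C (fun e => exists x, x ∈ t e /\ P x e).
Proof.
  intros Ht HP. apply (coll_ex HC (P := fun x e => x ∈ t e /\ P x e)).
  apply (coll_and HC); [apply (coll_delta0 HC); def_tac | exact HP].
Qed.

Lemma coll_subst2 (R : M -> M -> Prop) t u :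
  C (fun e => R (e 0) (e 1)) -> term t -> term u -> C (fun e => R (t e) (u e)).
Proof.
  intros H Ht Hu.
  apply (coll_subst HC (P := fun e => R (e 0) (e 1))
    (u := fun i => match i with 0 => t | _ => u end)); [exact H|].
  intros [|i]; assumption.
Qed.

Lemma replacement (R : M -> M -> Prop) : C (fun e => R (e 0) (e 1)) ->
  forall a, (forall x, x ∈ a -> exists! y, R x y) ->
  exists c, forall y, y ∈ c <-> exists x, x ∈ a /\ R x y.
Proof.
  intros H a Ha. destruct (coll_collection HC H (a := a)) as (c & H1 & H2).
  - intros x Hx. destruct (Ha x Hx) as (y & Hy & _). eauto.
  - exists c. intros y. split; [apply H2|]. intros (x & Hx & Hxy).
    destruct (H1 x Hx) as (y' & Hy' & Hxy').
    destruct (Ha x Hx) as (z & _ & Hz).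
    rewrite <- (Hz y Hxy), (Hz y' Hxy'). exact Hy'.
Qed.

Lemma image_exists (g : M -> M) : C (fun e => e 1 = g (e 0)) ->
  forall a, exists c, forall y, y ∈ c <-> exists x, x ∈ a /\ y = g x.
Proof.
  intros H a. apply (replacement (R := fun x y => y = g x)); [exact H|].
  intros x _. exists (g x). split; auto.
Qed.

Variable F : M -> M -> Prop.
Hypothesis HF : C (fun e => F (e 0) (e 1)).
Hypothesis F_total : forall r, exists y, F r y.
Hypothesis F_unique : forall r y y', F r y -> F r y' -> y = y'.

(** A derivation: each pair in [s] is justified by [F] from pairs of [s]. It need not be a function,
    and [s] occurs positively in the justification, so unions of derivations are derivations; single
    values are obtained afterwards by induction. *)
Definition progressive (s : M) : Prop := forall p, p ∈ s ->
  exists x y, is_opair p x y /\ exists r,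
    (forall z, z ∈ r -> exists x', x' ∈ x /\ maps s x' z) /\
    (forall x', x' ∈ x -> exists z, z ∈ r /\ maps s x' z) /\ F r y.

Definition rec_val (x y : M) : Prop := exists s, progressive s /\ maps s x y.

Lemma coll_progressive : C (fun e => progressive (e 0)).
Proof.
  apply (coll_ball HC (t := fun e => e 0) (P := fun p e => exists x y, is_opair p x y /\ exists r,
    (forall z, z ∈ r -> exists x', x' ∈ x /\ maps (e 0) x' z) /\
    (forall x', x' ∈ x -> exists z, z ∈ r /\ maps (e 0) x' z) /\ F r y)); [term_tac|].
  refine (coll_ex HC _). refine (coll_ex HC _). cbv beta.
  refine (coll_and HC _ _); [apply (coll_delta0 HC); def_tac|].
  refine (coll_ex HC _). cbv beta.
  refine (coll_and HC _ _); [apply (coll_delta0 HC); def_tac|].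
  refine (coll_and HC _ _); [apply (coll_delta0 HC); def_tac|].
  apply (coll_subst2 HF); term_tac.
Qed.

Lemma coll_rec_val : C (fun e => rec_val (e 0) (e 1)).
Proof.
  refine (coll_ex HC _). cbv beta.
  refine (coll_and HC _ _); [|apply (coll_delta0 HC); def_tac].
  apply (coll_subst HC (u := fun _ e => e 0) coll_progressive). intros; term_tac.
Qed.

Lemma rec_val_unfold x y : rec_val x y -> exists r,
  (forall z, z ∈ r -> exists x', x' ∈ x /\ rec_val x' z) /\
  (forall x', x' ∈ x -> exists z, z ∈ r /\ rec_val x' z) /\ F r y.
Proof.
  intros (s & Hs & p & Hp & Hps). destruct (Hs p Hps) as (x0 & y0 & H0 & r & H1 & H2 & H3).
  apply (is_opair_iff HKP) in Hp, H0. subst p. apply (opair_inj HKP) in H0.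
  destruct H0; subst. exists r. split; [|split; [|exact H3]].
  - intros z Hz. destruct (H1 z Hz) as (x' & Hx' & H). exists x'.
    split; [exact Hx' | exists s; auto].
  - intros x' Hx'. destruct (H2 x' Hx') as (z & Hz & H). exists z.
    split; [exact Hz | exists s; auto].
Qed.

Lemma rec_val_unique x : forall y y', rec_val x y -> rec_val x y' -> y = y'.
Proof.
  revert x. apply (mem_induction HKP
    (P := fun x => forall y y', rec_val x y -> rec_val x y' -> y = y')).
  - assert (D := fun t u Ht Hu =>
      coll_definable HC (coll_subst2 coll_rec_val (t := t) (u := u) Ht Hu)).
    repeat (apply definable_all; cbv beta).
    apply definable_imp; [apply D; term_tac|].
    apply definable_imp; [apply D; term_tac | def_tac].
  - intros x IH y y' Hy Hy'.
    destruct (rec_val_unfold Hy) as (r & H1 & H2 & H3).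
    destruct (rec_val_unfold Hy') as (r' & H1' & H2' & H3').
    replace r' with r in H3'; [apply (F_unique H3 H3')|].
    apply (set_ext HKP). intros z. split.
    + intros Hz. destruct (H1 z Hz) as (x' & Hx' & Hv).
      destruct (H2' x' Hx') as (z' & Hz' & Hv').
      rewrite (IH x' Hx' z z' Hv Hv'). exact Hz'.
    + intros Hz. destruct (H1' z Hz) as (x' & Hx' & Hv).
      destruct (H2 x' Hx') as (z' & Hz' & Hv').
      rewrite (IH x' Hx' z z' Hv Hv'). exact Hz'.
Qed.

Lemma rec_val_exists x : exists y, rec_val x y.
Proof.
  revert x. apply (mem_induction HKP (P := fun x => exists y, rec_val x y)).
  - apply definable_ex, (coll_definable HC), (coll_subst2 coll_rec_val); term_tac.
  - intros x IH.
    destruct (replacement coll_rec_val (a := x)) as [r Hr].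
    { intros x' Hx'. destruct (IH x' Hx') as [z Hz]. exists z. split; [exact Hz|].
      intros z'. apply rec_val_unique, Hz. }
    (* The second clause of collection is essential: every member of [c] is progressive, hence so is
       the union. *)
    destruct (coll_collection HC (P := fun x' s => progressive s /\ exists z, maps s x' z))
      with (a := x) as (c & Hc1 & Hc2).
    { refine (coll_and HC _ _).
      - apply (coll_subst HC (u := fun _ e => e 1) coll_progressive). intros; term_tac.
      - refine (coll_ex HC _). apply (coll_delta0 HC). def_tac. }
    { intros x' Hx'. destruct (IH x' Hx') as (z & s & Hs & Hz). eauto. }
    destruct (F_total r) as [y Hy].
    exists y, (adj (union c) (opair x y)). split.
    + intros p Hp. apply (in_adj HKP) in Hp. destruct Hp as [Hp| ->].
      * apply (in_union HKP) in Hp. destruct Hp as (s & Hps & Hs).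
        destruct (Hc2 s Hs) as (_ & _ & Hprog & _).
        destruct (Hprog p Hps) as (x0 & y0 & H0 & r0 & H1 & H2 & H3).
        assert (Hmono : forall u v, maps s u v -> maps (adj (union c) (opair x y)) u v).
        { intros u v (q & Hq & Hqs). exists q. split; [exact Hq|].
          apply (in_adj HKP). left. apply (in_union HKP). eauto. }
        exists x0, y0. split; [exact H0|]. exists r0. split; [|split; [|exact H3]].
        -- intros z Hz. destruct (H1 z Hz) as (x' & Hx' & H). eauto.
        -- intros x' Hx'. destruct (H2 x' Hx') as (z & Hz & H). eauto.
      * exists x, y. split; [apply (is_opair_iff HKP); reflexivity|].
        assert (Hall : forall x', x' ∈ x ->
          exists z, z ∈ r /\ maps (adj (union c) (opair x y)) x' z).
        { intros x' Hx'. destruct (Hc1 x' Hx') as (s & Hs & Hprog & z & Hz).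
          exists z. split; [apply Hr; exists x'; split; [exact Hx' | exists s; auto]|].
          destruct Hz as (q & Hq & Hqs). exists q. split; [exact Hq|].
          apply (in_adj HKP). left. apply (in_union HKP). eauto. }
        exists r. split; [|split; [exact Hall | exact Hy]].
        intros z Hz. apply Hr in Hz. destruct Hz as (x' & Hx' & Hv).
        exists x'. split; [exact Hx'|].
        destruct (Hall x' Hx') as (z' & Hz' & Hm).
        apply Hr in Hz'.
        (* The derivation behind [Hv] may lie outside [c]; uniqueness identifies its value with the
           value [z''] derived in a member of [c]. *)
        destruct (Hc1 x' Hx') as (s & Hs & Hprog & z'' & Hz'').
        rewrite (rec_val_unique Hv (y' := z'')); [|exists s; auto].
        destruct Hz'' as (q & Hq & Hqs). exists q. split; [exact Hq|].
        apply (in_adj HKP). left. apply (in_union HKP). eauto.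
    + apply (maps_iff HKP), (in_adj HKP). auto.
Qed.

(** Recursion from the set of earlier values, rather than from the function, suffices for ranks,
    closures and the levels of L, which all take unions. *)
Theorem mem_recursion : exists h : M -> M,
  C (fun e => e 1 = h (e 0)) /\
  forall x, exists r, (forall z, z ∈ r <-> exists y, y ∈ x /\ z = h y) /\ F r (h x).
Proof.
  set (h := fun x => proj1_sig (constructive_indefinite_description _ (rec_val_exists x))).
  assert (Hh : forall x, rec_val x (h x)).
  { intros x. unfold h. destruct constructive_indefinite_description. assumption. }
  exists h. split.
  - apply (coll_ext HC coll_rec_val). intros e. split.
    + intros H. apply (rec_val_unique H), Hh.
    + intros ->. apply Hh.
  - intros x. destruct (rec_val_unfold (Hh x)) as (r & H1 & H2 & H3).
    exists r. split; [|exact H3]. intros z. split.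
    + intros Hz. destruct (H1 z Hz) as (y & Hy & Hv). exists y. split; [exact Hy|].
      apply (rec_val_unique Hv), Hh.
    + intros (y & Hy & ->). destruct (H2 y Hy) as (z & Hz & Hv).
      rewrite (rec_val_unique (Hh y) Hv). exact Hz.
Qed.

End Recursion.

(** * Ordinals, ranks and numerals *)

Section DefinableOperations.
Context {M : structure} (HKP : KP M).
Variable b : bool.
Implicit Types t u v : (nat -> M) -> M.

Lemma definable_eq_upair t u v : term t -> term u -> term v ->
  definable b (fun e => t e = upair (u e) (v e)).
Proof.
  intros. eapply definable_ext; [|intros e; apply (is_upair_iff HKP)]. def_tac.
Qed.

Lemma definable_eq_opair t u v : term t -> term u -> term v ->
  definable b (fun e => t e = opair (u e) (v e)).
Proof.
  intros. eapply definable_ext; [|intros e; apply (is_opair_iff HKP)]. def_tac.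
Qed.

Lemma definable_eq_union t u : term t -> term u ->
  definable b (fun e => t e = union (u e)).
Proof.
  intros. apply definable_ext with (fun e =>
    (forall z, z ∈ t e -> exists y, y ∈ u e /\ z ∈ y) /\
    (forall y, y ∈ u e -> forall z, z ∈ y -> z ∈ t e)); [def_tac|].
  intros e. split.
  - intros [Ha Hb]. apply (set_ext HKP). intros z. rewrite (in_union HKP).
    firstorder.
  - intros ->. split.
    + intros z Hz. apply (in_union HKP) in Hz. firstorder.
    + intros y Hy z Hz. apply (in_union HKP). eauto.
Qed.

Lemma definable_eq_cup t u v : term t -> term u -> term v ->
  definable b (fun e => t e = cup (u e) (v e)).
Proof.
  intros. apply definable_ext with (fun e =>
    (forall z, z ∈ t e -> z ∈ u e \/ z ∈ v e) /\
    (forall z, z ∈ u e -> z ∈ t e) /\ (forall z, z ∈ v e -> z ∈ t e)); [def_tac|].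
  intros e. split.
  - intros (Ha & Hb & Hc). apply (set_ext HKP). intros z. rewrite (in_cup HKP).
    firstorder.
  - intros ->. repeat split; intros z; rewrite (in_cup HKP); auto.
Qed.

Lemma definable_eq_adj t u v : term t -> term u -> term v ->
  definable b (fun e => t e = adj (u e) (v e)).
Proof.
  intros. apply definable_ext with (fun e =>
    (forall z, z ∈ t e -> z ∈ u e \/ z = v e) /\
    (forall z, z ∈ u e -> z ∈ t e) /\ v e ∈ t e); [def_tac|].
  intros e. split.
  - intros (Ha & Hb & Hc). apply (set_ext HKP). intros z. rewrite (in_adj HKP).
    split; [apply Ha|]. intros [Hz| ->]; auto.
  - intros ->. repeat split; try intros z; rewrite (in_adj HKP); auto.
Qed.

End DefinableOperations.

#[export] Hint Resolve definable_eq_upair definable_eq_opair definable_eq_union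
  definable_eq_cup definable_eq_adj : definability.

Section Ordinals.
Context {M : structure} (HKP : KP M).
Implicit Types a o x y z k l n m α β γ : M.

Lemma ordinal_mem α β : is_ordinal α -> β ∈ α -> is_ordinal β.
Proof.
  intros [H1 H2] Hβ. split; [auto|]. intros γ Hγ. apply H2. eapply H1; eauto.
Qed.

Lemma ordinal_trans α β γ : is_ordinal α -> β ∈ α -> γ ∈ β -> γ ∈ α.
Proof. intros [H _] H1 H2. eapply H; eauto. Qed.

Lemma ordinal_trichotomy α β : is_ordinal α -> is_ordinal β -> α ∈ β \/ α = β \/ β ∈ α.
Proof.
  intros Hα. revert β. revert α Hα.
  apply (mem_induction HKP (P := fun α => is_ordinal α -> forall β, is_ordinal β ->
    α ∈ β \/ α = β \/ β ∈ α)); [def_tac|].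
  intros α IHα Hα.
  apply (mem_induction HKP (P := fun β => is_ordinal β -> α ∈ β \/ α = β \/ β ∈ α));
    [def_tac|].
  intros β IHβ Hβ.
  destruct (classic (α ∈ β)) as [|N1]; [auto|].
  destruct (classic (β ∈ α)) as [|N2]; [auto|].
  right. left. apply (set_ext HKP). intros z. split; intros Hz.
  - destruct (IHα z Hz (ordinal_mem Hα Hz) β Hβ) as [|[->|H]]; [auto|tauto|].
    destruct N2. eapply ordinal_trans; eauto.
  - destruct (IHβ z Hz (ordinal_mem Hβ Hz)) as [H|[->|H]]; [|tauto|auto].
    destruct N1. eapply ordinal_trans; eauto.
Qed.

Lemma ordinal_succ α : is_ordinal α -> is_ordinal (adj α α).
Proof.
  intros Hα. split.
  - intros x y Hx Hy. apply (in_adj HKP) in Hy. apply (in_adj HKP).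
    destruct Hy as [Hy| ->]; [left; eapply ordinal_trans; eauto | auto].
  - intros β Hβ. apply (in_adj HKP) in Hβ.
    destruct Hβ as [Hβ| ->]; [apply (proj2 Hα), Hβ | apply (proj1 Hα)].
Qed.

Lemma ordinal_empty x : is_empty x -> is_ordinal x.
Proof. intros H. split; [intros y z _ Hz | intros z Hz]; destruct (H _ Hz). Qed.

(** This is the supremum of [o] and the successors of the elements of [x]. *)
Lemma ordinal_cup_union o x : is_ordinal o -> (forall α, α ∈ x -> is_ordinal α) ->
  is_ordinal (cup o (cup x (union x))).
Proof.
  intros Ho Hx. split.
  - intros y z Hy Hz. rewrite !(in_cup HKP), (in_union HKP) in *.
    destruct Hz as [Hz|[Hz|(w & Hz & Hw)]].
    + left. eapply ordinal_trans; eauto.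
    + right. right. eauto.
    + right. right. exists w. split; [|exact Hw]. eapply (ordinal_trans (Hx w Hw)); eauto.
  - intros z Hz. rewrite !(in_cup HKP), (in_union HKP) in Hz.
    destruct Hz as [Hz|[Hz|(w & Hz & Hw)]].
    + apply (proj2 Ho), Hz.
    + apply (proj1 (Hx z Hz)).
    + apply (proj2 (Hx w Hw)), Hz.
Qed.

Lemma ordinal_max α β : is_ordinal α -> is_ordinal β ->
  exists γ, (γ = α \/ γ = β) /\ (α ∈ γ \/ α = γ) /\ (β ∈ γ \/ β = γ).
Proof.
  intros Ha Hb. destruct (ordinal_trichotomy Ha Hb) as [H|[H|H]];
    [exists β | exists α | exists α]; subst; auto.
Qed.

Lemma limit_succ α β : is_limit α -> β ∈ α -> adj β β ∈ α.
Proof.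
  intros (Hα & _ & Hl) Hβ. assert (Ho := ordinal_succ (ordinal_mem Hα Hβ)).
  destruct (ordinal_trichotomy Ho Hα) as [H|[H|H]]; [exact H| |].
  - destruct Hl. exists β. apply (is_succ_iff HKP). auto.
  - apply (in_adj HKP) in H. destruct H as [H| ->].
    + destruct (mem_asym HKP Hβ H).
    + destruct (mem_irrefl HKP Hβ).
Qed.

Lemma ordinal_cases α : is_ordinal α ->
  is_empty α \/ (exists β, is_succ α β) \/ is_limit α.
Proof.
  intros H. destruct (classic (is_empty α)); [auto|].
  destruct (classic (exists β, is_succ α β)); [auto|].
  right. right. split; auto.
Qed.

(** The value [rk x] is the supremum of [o] and all rk y + 1 for y in [x]. The empty [o] gives the
    usual rank, for models without limit ordinals; omega gives ranks whose levels include
    L_omega. *)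
Theorem rank_above o : is_ordinal o -> exists rk : M -> M,
  sigma (fun e => e 1 = rk (e 0)) /\
  forall x, is_ordinal (rk x) /\ (forall z, z ∈ o -> z ∈ rk x) /\
    forall y, y ∈ x -> rk y ∈ rk x.
Proof.
  intros Ho.
  destruct (mem_recursion HKP (sigma_collective HKP)
    (F := fun r y => exists z, z = union r /\ exists w, w = cup r z /\ y = cup o w))
    as (rk & Hdef & Hrk).
  - refine (sigma_ex HKP _). cbv beta.
    refine (sigma_and HKP _ _); [apply sigma_delta0; def_tac|].
    refine (sigma_ex HKP _). cbv beta. apply sigma_delta0. def_tac.
  - intros r. do 2 eexists. split; [reflexivity|]. eauto.
  - intros r y y' (z & -> & w & -> & ->) (z' & -> & w' & -> & ->). reflexivity.
  - exists rk. split; [exact Hdef|].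
    assert (Hord : forall x, is_ordinal (rk x)).
    { apply (mem_induction HKP (P := fun x => is_ordinal (rk x))).
      - apply definable_ext with (fun e => exists y, y = rk (e 0) /\ is_ordinal y).
        + apply definable_ex. apply definable_and; [|def_tac].
          apply (definable_subst2 (R := fun x y => y = rk x) (sigma_definable Hdef));
            term_tac.
        + intros e. split; [intros (y & -> & H); exact H | eauto].
      - intros x IH. destruct (Hrk x) as (r & Hr & z & -> & w & -> & ->).
        apply ordinal_cup_union; [exact Ho|]. intros α Hα. apply Hr in Hα.
        destruct Hα as (y & Hy & ->). apply IH, Hy. }
    intros x. split; [apply Hord|].
    destruct (Hrk x) as (r & Hr & z & -> & w & -> & E). rewrite E. split.
    + intros z Hz. apply (in_cup HKP). auto.
    + intros y Hy. rewrite !(in_cup HKP). right. left. apply Hr. eauto.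
Qed.

Definition is_omega o : Prop := is_limit o /\ forall n, n ∈ o <-> is_natural n.

Lemma natural_mem n k : is_natural n -> k ∈ n -> is_natural k.
Proof.
  intros [H1 H2] Hk. split; [eapply ordinal_mem; eauto|].
  intros l [Hl|Hl]; apply H2; left; [eapply ordinal_trans; eauto | subst; auto].
Qed.

Lemma omega_exists : (exists α, @is_limit M α) -> exists o, is_omega o.
Proof.
  intros [α Hα].
  assert (H : exists o, is_limit o /\ forall n, n ∈ o -> ~ is_limit n).
  { apply NNPP. intros Hn. revert Hα. revert α.
    apply (mem_induction HKP (P := fun α => ~ is_limit α)); [def_tac|].
    intros x IH Hx. apply Hn. eauto. }
  clear α Hα. destruct H as (o & Ho & Hmin). exists o. split; [exact Ho|].
  assert (Hnat : forall n, n ∈ o -> is_natural n).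
  { intros n Hn. assert (On := ordinal_mem (proj1 Ho) Hn). split; [exact On|].
    intros k Hk. assert (Ho' : k ∈ o).
    { destruct Hk as [Hk| ->]; [eapply (ordinal_trans (proj1 Ho)); eauto | exact Hn]. }
    destruct (ordinal_cases (ordinal_mem (proj1 Ho) Ho')) as [H|[H|H]]; auto.
    destruct (Hmin k Ho' H). }
  intros n. split; [apply Hnat|]. intros Hn.
  (* Being natural is tested on the ordinal itself as well as on its elements, so a limit fails. *)
  assert (Hno : ~ is_natural o).
  { intros [_ H]. destruct Ho as (_ & Ho1 & Ho2). destruct (H o); auto. }
  destruct (ordinal_trichotomy (proj1 Hn) (proj1 Ho)) as [H|[H|H]];
    [exact H | subst; tauto |].
  destruct Hno. eapply natural_mem; eauto.
Qed.

Lemma natural_empty x : is_empty x -> is_natural x.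
Proof.
  intros H. split; [apply ordinal_empty, H|].
  intros k [Hk| ->]; [destruct (H _ Hk) | auto].
Qed.

Lemma natural_succ n : is_natural n -> is_natural (adj n n).
Proof.
  intros [H1 H2]. split; [apply ordinal_succ, H1|].
  intros k [Hk| ->].
  - apply (in_adj HKP) in Hk. apply H2. tauto.
  - right. exists n. apply (is_succ_iff HKP). reflexivity.
Qed.

Lemma natural_induction (P : M -> Prop) : definable false (fun e => P (e 0)) ->
  (forall n, is_empty n -> P n) -> (forall n, is_natural n -> P n -> P (adj n n)) ->
  forall n, is_natural n -> P n.
Proof.
  intros HP H0 HS. apply (mem_induction HKP (P := fun n => is_natural n -> P n)).
  - apply definable_imp; [def_tac | exact HP].
  - intros n IH Hn. destruct (proj2 Hn n (or_intror eq_refl)) as [H|[l Hl]]; [auto|].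
    apply (is_succ_iff HKP) in Hl. subst n.
    assert (Hl : l ∈ adj l l) by (apply (in_adj HKP); auto).
    apply HS; [eapply natural_mem | apply IH; [|eapply natural_mem]]; eauto.
Qed.

Lemma numeral_natural d : forall x : M, is_numeral d x -> is_natural x.
Proof.
  induction d; simpl; [apply natural_empty|].
  intros x (y & Hy & Hx). apply (is_succ_iff HKP) in Hx. subst.
  apply natural_succ, IHd, Hy.
Qed.

Lemma succ_inj n m : is_ordinal n -> is_ordinal m -> adj n n = adj m m -> n = m.
Proof.
  intros Hn Hm E.
  assert (H1 : n ∈ adj m m) by (rewrite <- E; apply (in_adj HKP); auto).
  assert (H2 : m ∈ adj n n) by (rewrite E; apply (in_adj HKP); auto).
  apply (in_adj HKP) in H1, H2. destruct H1 as [H1|]; [|auto].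
  destruct H2 as [H2|]; [|auto]. destruct (mem_asym HKP H1 H2).
Qed.

(** These are the standard numerals; [M] may have further natural numbers. *)
Definition num (d : nat) : M := epsilon (inhabits (proj1_sig
  (constructive_indefinite_description _ (KP_empty HKP)))) (is_numeral d).

Lemma num_spec d : is_numeral d (num d).
Proof.
  unfold num. apply epsilon_spec. induction d as [|d [x Hx]]; [apply (KP_empty HKP)|].
  exists (adj x x), x. split; [exact Hx | apply (is_succ_iff HKP); reflexivity].
Qed.

Lemma is_numeral_iff d : forall x : M, is_numeral d x <-> x = num d.
Proof.
  assert (U : forall x y : M, is_numeral d x -> is_numeral d y -> x = y).
  { induction d; simpl.
    - intros x y Hx Hy. apply (set_ext HKP). intros z. specialize (Hx z).
      specialize (Hy z). tauto.
    - intros x y (x' & Hx' & Hx) (y' & Hy' & Hy). apply (is_succ_iff HKP) in Hx, Hy.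
      subst. rewrite (IHd x' y'); auto. }
  intros x. split; [intros H; apply U; [exact H | apply num_spec] | intros ->; apply num_spec].
Qed.

Lemma num_S d : num (S d) = adj (num d) (num d).
Proof.
  symmetry. apply is_numeral_iff. exists (num d). split; [apply num_spec|].
  apply (is_succ_iff HKP). reflexivity.
Qed.

Lemma num_natural d : is_natural (num d).
Proof. eapply numeral_natural, num_spec. Qed.

Lemma num_empty : is_empty (num 0).
Proof. apply (num_spec 0). Qed.

Lemma num_mem d d' : num d ∈ num d' <-> d < d'.
Proof.
  induction d' as [|d' IH].
  - split; [intros H; destruct (num_empty H) | lia].
  - rewrite num_S, (in_adj HKP), IH. split.
    + intros [H|H]; [lia|]. enough (d = d') by lia.
      clear IH. revert d' H. induction d as [|d IH]; intros [|d'] H; auto.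
      * exfalso. apply (num_empty (z := num d')). rewrite H, num_S. apply (in_adj HKP). auto.
      * exfalso. apply (num_empty (z := num d)). rewrite <- H, num_S. apply (in_adj HKP). auto.
      * f_equal. apply IH. rewrite !num_S in H.
        apply succ_inj in H; auto; apply num_natural.
    + intros H. assert (d < d' \/ d = d') as [L| ->] by lia; auto.
Qed.

Lemma num_inj d d' : num d = num d' -> d = d'.
Proof.
  intros H. destruct (Nat.lt_trichotomy d d') as [L|[|L]]; [|auto|];
    apply num_mem in L; rewrite H in L; destruct (mem_irrefl HKP L).
Qed.

(** Standard numerals have only standard elements, so functions on them can be analysed by external
    induction even if omega is nonstandard. *)
Lemma in_num d x : x ∈ num d <-> exists d', d' < d /\ x = num d'.
Proof.
  split; [|intros (d' & H & ->); apply num_mem, H].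
  induction d as [|d IH]; [intros H; destruct (num_empty H)|].
  rewrite num_S, (in_adj HKP). intros [H| ->].
  - destruct (IH H) as (d' & Hd & ->). eauto.
  - eauto.
Qed.

End Ordinals.

(** * Definable functions and images *)

Section DefinableFunctions.
Context {M : structure}.
Variable b : bool.
Implicit Types t u v w : (nat -> M) -> M.

(** Values are quantified as second components of elements of the function, which bounds them.
    Universal statements about components become negated existential ones, the form that
    [definable_ex_opair] covers; the same device serves below. *)
Lemma definable_function_on t u : term t -> term u ->
  definable b (fun e => function_on (t e) (u e)).
Proof.
  intros. apply definable_ext with (fun e =>
    (forall p, p ∈ t e -> exists x y, is_opair p x y /\ x ∈ u e) /\
    forall x, x ∈ u e -> exists p, p ∈ t e /\ exists a y, is_opair p a y /\ (a = x /\
      forall q, q ∈ t e -> ~ exists a' y', is_opair q a' y' /\ (a' = x /\ y <> y')));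
    [def_tac|].
  intros e. unfold function_on. split.
  - intros [Ha Hb]. split;
      [intros p Hp; destruct (Ha p Hp) as (? & ? & ? & ?); eauto|]. intros x Hx.
    destruct (Hb x Hx) as (p & Hp & a & y & Hpa & -> & Hu). exists y. split.
    + exists p. auto.
    + intros y' (q & Hq & Hqt). apply NNPP. intros Hn. apply (Hu q Hqt). eauto.
  - intros [Ha Hb]. split;
      [intros p Hp; destruct (Ha p Hp) as (? & ? & ? & ?); eauto|]. intros x Hx.
    destruct (Hb x Hx) as (y & (p & Hp & Hpt) & Hu).
    exists p. split; [exact Hpt|]. exists x, y. split; [exact Hp|]. split; [reflexivity|].
    intros q Hq (a & y' & Hqa & -> & Hn). apply Hn, Hu. exists q. auto.
Qed.
Hint Resolve definable_function_on : definability.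

Lemma definable_assignment t u v : term t -> term u -> term v ->
  definable b (fun e => assignment (t e) (u e) (v e)).
Proof.
  intros. apply definable_ext with (fun e => function_on (v e) (u e) /\
    forall p, p ∈ v e -> ~ exists i x, is_opair p i x /\ x ∉ t e); [def_tac|].
  intros e. unfold assignment. split; intros [Ha Hb]; (split; [exact Ha|]).
  - intros i x (p & Hp & Hv). apply NNPP. intros Hn. apply (Hb p Hv). eauto.
  - intros p Hp (i & x & Hpi & Hn). apply Hn, (Hb i). exists p. auto.
Qed.
Hint Resolve definable_assignment : definability.

Lemma definable_maps_iff t u v : term t -> term u -> term v ->
  definable b (fun e => forall y, maps (t e) (v e) y <-> maps (u e) (v e) y).
Proof.
  intros. apply definable_ext with (fun e =>
    (forall p, p ∈ t e -> ~ exists a y, is_opair p a y /\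
       (a = v e /\ ~ maps (u e) (v e) y)) /\
    (forall p, p ∈ u e -> ~ exists a y, is_opair p a y /\
       (a = v e /\ ~ maps (t e) (v e) y))); [def_tac|].
  intros e. split.
  - intros [Ha Hb] y. split; intros (p & Hp & Hpt); apply NNPP; intros Hn.
    + apply (Ha p Hpt). eauto 6.
    + apply (Hb p Hpt). eauto 6.
  - intros Ha. split; intros p Hp (a & y & Hpa & -> & Hn); apply Hn, Ha; exists p; auto.
Qed.
Hint Resolve definable_maps_iff : definability.

Lemma definable_update t1 t2 t3 t4 t5 t6 :
  term t1 -> term t2 -> term t3 -> term t4 -> term t5 -> term t6 ->
  definable b (fun e => update (t1 e) (t2 e) (t3 e) (t4 e) (t5 e) (t6 e)).
Proof.
  intros. unfold update. apply definable_and; [auto with definability|].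
  apply definable_and; [auto with definability|].
  refine (@definable_ball _ _ _ _ _ _); [assumption|]. cbv beta.
  apply definable_imp; [def_tac|]. apply definable_maps_iff; term_tac.
Qed.

Lemma definable_entry t u v w : term t -> term u -> term v -> term w ->
  definable b (fun e => entry (t e) (u e) (v e) (w e)).
Proof.
  intros. apply definable_ext with (fun e => exists q, q ∈ t e /\
    exists a p, is_opair q a p /\ (a = u e /\ is_opair p (v e) (w e))); [def_tac|].
  intros e. unfold entry, maps. split.
  - intros (q & Hq & a & p & Hqa & -> & Hp). eauto.
  - intros (p & (q & Hq & Hqt) & Hp). eauto 7.
Qed.

Lemma definable_is_code d t u v : term t -> term u -> term v ->
  definable b (fun e => is_code d (t e) (u e) (v e)).
Proof.
  intros. apply definable_ext with (fun e => exists k q, is_opair (t e) k q /\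
    (is_numeral d k /\ is_opair q (u e) (v e))); [def_tac|].
  intros e. unfold is_code. split; intros (k & q & Ha & Hb & Hc); eauto 6.
Qed.

End DefinableFunctions.
#[export] Hint Resolve definable_function_on definable_assignment definable_maps_iff
  definable_update definable_entry definable_is_code : definability.

Section Images.
Context {M : structure}.
Notation env := (nat -> M).
Variable C : (env -> Prop) -> Prop.
Hypothesis HC : collective C.

(** Replacement is applied twice: to [g x] on [b], then to the map that sends [x] to the resulting
    image, whose graph is again in [C]. The union of the images is the set sought. *)
Lemma image2_exists (HKP : KP M) (g : M -> M -> M) :
  C (fun e => e 2 = g (e 0) (e 1)) ->
  forall a b, exists c, forall y, y ∈ c <-> exists x z, x ∈ a /\ z ∈ b /\ y = g x z.
Proof.
  intros Hg a b.
  assert (Hg3 : forall t u v, term t -> term u -> term v -> C (fun e => v e = g (t e) (u e))).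
  { intros t u v Ht Hu Hv. apply (coll_subst HC (u := fun i => match i with
      0 => t | 1 => u | _ => v end) Hg). intros [|[|i]]; assumption. }
  destruct (replacement HC (R := fun x w => (forall y, y ∈ w -> exists z, z ∈ b /\ y = g x z) /\
    forall z, z ∈ b -> exists y, y ∈ w /\ y = g x z)) with (a := a) as [c Hc].
  - apply (coll_and HC).
    + refine (coll_ball HC _ _); [term_tac|]. refine (coll_bex HC _ _); [term_tac|].
      apply Hg3; term_tac.
    + refine (coll_ball HC _ _); [term_tac|]. refine (coll_bex HC _ _); [term_tac|].
      apply Hg3; term_tac.
  - intros x _. destruct (image_exists HC (g := g x)) with (a := b) as [w Hw].
    { apply Hg3; term_tac. }
    exists w. split.
    + split; [intros y Hy; apply Hw, Hy|]. intros z Hz. exists (g x z).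
      split; [apply Hw; eauto | reflexivity].
    + intros w' [H1 H2]. apply (set_ext HKP). intros y. rewrite Hw. split.
      * intros (z & Hz & ->). destruct (H2 z Hz) as (y & Hy & ->). exact Hy.
      * apply H1.
  - exists (union c). intros y. rewrite (in_union HKP). split.
    + intros (w & Hy & Hw). apply Hc in Hw. destruct Hw as (x & Hx & H1 & _).
      destruct (H1 y Hy) as (z & Hz & ->). eauto.
    + intros (x & z & Hx & Hz & ->).
      destruct (image_exists HC (g := g x)) with (a := b) as [w Hw].
      { apply Hg3; term_tac. }
      exists w. split; [apply Hw; eauto|]. apply Hc. exists x. split; [exact Hx|].
      split; [intros y Hy; apply Hw, Hy|]. intros z' Hz'. exists (g x z').
      split; [apply Hw; eauto | reflexivity].
Qed.

End Images.

(** * Finite sequences and standard formulas *)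

Section FiniteSequences.
Context {M : structure} (HKP : KP M).
Implicit Types a p s t x y z A B R S φ ψ : M.
Implicit Types v w : nat -> M.
Notation num := (num HKP).

(** Sequences of standard length suffice to show that a formula written down externally is a formula
    in the sense of [M]. *)
Fixpoint fseq (n : nat) v : M :=
  match n with
  | 0 => num 0
  | S n => adj (fseq n v) (opair (num n) (v n))
  end.

Definition upd v (i : nat) x (k : nat) : M := if Nat.eqb k i then x else v k.

Lemma upd_eq v i x : upd v i x i = x.
Proof. unfold upd. rewrite Nat.eqb_refl. reflexivity. Qed.

Lemma upd_neq v i x k : k <> i -> upd v i x k = v k.
Proof. unfold upd. intros H. apply Nat.eqb_neq in H. rewrite H. reflexivity. Qed.

Lemma in_fseq n v p : p ∈ fseq n v <-> exists i, i < n /\ p = opair (num i) (v i).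
Proof.
  induction n as [|n IH]; simpl.
  - split; [intros H; destruct (num_empty H) | intros (i & H & _); lia].
  - rewrite (in_adj HKP), IH. split.
    + intros [(i & Hi & ->)| ->]; eauto.
    + intros (i & Hi & ->). assert (i < n \/ i = n) as [L| ->] by lia; eauto.
Qed.

Lemma maps_fseq n v a x :
  maps (fseq n v) a x <-> exists i, i < n /\ a = num i /\ x = v i.
Proof.
  rewrite (maps_iff HKP), in_fseq. split.
  - intros (i & Hi & E). apply (opair_inj HKP) in E. destruct E. eauto.
  - intros (i & Hi & -> & ->). eauto.
Qed.

Lemma maps_fseq_num n v i x : maps (fseq n v) (num i) x <-> i < n /\ x = v i.
Proof.
  rewrite maps_fseq. split.
  - intros (j & Hj & E & ->). apply num_inj in E. subst. auto.
  - intros [Hi ->]. eauto.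
Qed.

Lemma function_on_fseq n v : function_on (fseq n v) (num n).
Proof.
  split.
  - intros p Hp. apply in_fseq in Hp. destruct Hp as (i & Hi & ->).
    exists (num i), (v i). rewrite (is_opair_iff HKP), num_mem. auto.
  - intros x Hx. apply in_num in Hx. destruct Hx as (i & Hi & ->).
    exists (v i). split; [apply maps_fseq_num; auto|].
    intros y Hy. apply maps_fseq_num in Hy. symmetry. apply Hy.
Qed.

Lemma fseq_ext n v w : (forall i, i < n -> v i = w i) -> fseq n v = fseq n w.
Proof.
  intros H. apply (set_ext HKP). intros p. rewrite !in_fseq.
  split; intros (i & Hi & ->); exists i; rewrite H by exact Hi; auto.
Qed.

Lemma fseq_inj n v w : fseq n v = fseq n w -> forall i, i < n -> v i = w i.
Proof.
  intros E i Hi. assert (H : maps (fseq n w) (num i) (v i))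
    by (rewrite <- E; apply maps_fseq_num; auto).
  apply maps_fseq_num in H. apply H.
Qed.

Lemma function_on_num n s : function_on s (num n) -> exists v, s = fseq n v.
Proof.
  intros [H1 H2].
  exists (fun i => epsilon (inhabits s) (maps s (num i))).
  assert (Hv : forall i, i < n -> maps s (num i) (epsilon (inhabits s) (maps s (num i)))).
  { intros i Hi. apply epsilon_spec. destruct (H2 (num i)) as (y & Hy & _);
      [apply num_mem, Hi | eauto]. }
  apply (set_ext HKP). intros p. rewrite in_fseq. split.
  - intros Hp. destruct (H1 p Hp) as (x & y & Hx & E).
    apply in_num in Hx. destruct Hx as (i & Hi & ->). exists i. split; [exact Hi|].
    destruct (H2 (num i)) as (z & _ & Hz); [apply num_mem, Hi|].
    rewrite <- (Hz _ (Hv i Hi)). rewrite (Hz y); [apply (is_opair_iff HKP), E|].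
    exists p. auto.
  - intros (i & Hi & ->). apply (maps_iff HKP), Hv, Hi.
Qed.

Lemma assignment_fseq A n v : assignment A (num n) (fseq n v) <-> forall i, i < n -> v i ∈ A.
Proof.
  split.
  - intros [_ H] i Hi. apply (H (num i)), maps_fseq_num. auto.
  - intros H. split; [apply function_on_fseq|]. intros a x Hx.
    apply maps_fseq in Hx. destruct Hx as (i & Hi & _ & ->). auto.
Qed.

Lemma assignment_num A n s : assignment A (num n) s ->
  exists v, (forall i, i < n -> v i ∈ A) /\ s = fseq n v.
Proof.
  intros H. destruct (function_on_num (proj1 H)) as [v ->].
  exists v. split; [apply assignment_fseq, H | reflexivity].
Qed.

(** The hypotheses cover both uses of [update]: changing a variable ([k = m]) and appending the last
    one ([i = k], [m = S k]). *)
Lemma update_fseq A m k v i x t : i < m -> (forall j, j < k -> v j ∈ A) ->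
  (forall j, j < m -> j <> i -> j < k) ->
  update A (num m) (fseq k v) (num i) x t <-> x ∈ A /\ t = fseq m (upd v i x).
Proof.
  intros Hi Hv Hk. split.
  - intros (Ht & Hx & Hu). destruct (assignment_num Ht) as (w & Hw & ->).
    apply maps_fseq_num in Hx. destruct Hx as [_ ->]. split; [auto|].
    apply fseq_ext. intros j Hj. destruct (Nat.eq_dec j i) as [->|N];
      [rewrite upd_eq; reflexivity|]. rewrite upd_neq by exact N.
    assert (Hm : maps (fseq m w) (num j) (v j)).
    { apply Hu; [apply num_mem, Hj | intros E; apply num_inj in E; auto|].
      apply maps_fseq_num. auto. }
    apply maps_fseq_num in Hm. symmetry. apply Hm.
  - intros [Hx ->]. split; [|split].
    + apply assignment_fseq. intros j Hj. destruct (Nat.eq_dec j i) as [->|N];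
        [rewrite upd_eq; exact Hx | rewrite upd_neq by exact N; auto].
    + apply maps_fseq_num. rewrite upd_eq. auto.
    + intros a Ha Hai y. apply in_num in Ha. destruct Ha as (j & Hj & ->).
      assert (N : j <> i) by congruence.
      rewrite !maps_fseq_num, upd_neq by exact N. specialize (Hk j Hj N). tauto.
Qed.

(** External induction on the standard number [m], adjoining one pair at a time, takes the place of
    the missing power set. *)
Lemma assignments_exist A m : exists B, forall s, s ∈ B <-> assignment A (num m) s.
Proof.
  induction m as [|m [B HB]].
  - exists (upair (num 0) (num 0)). intros s. rewrite (in_upair HKP). split.
    + intros H. replace s with (fseq 0 (fun _ => A)) by (simpl; symmetry; tauto).
      apply assignment_fseq. lia.
    + intros H. destruct (assignment_num H) as (v & _ & ->). auto.
  - destruct (image2_exists (sigma_collective HKP) HKP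
      (g := fun s x => adj s (opair (num m) x))) with (a := B) (b := A) as [B' HB'].
    { apply (sigma_ext (P := fun e => exists p, p = opair (num m) (e 1) /\
        e 2 = adj (e 0) p)).
      - refine (sigma_ex HKP _). apply (sigma_delta0 ). def_tac.
      - intros e. split; [intros (p & -> & H); exact H | eauto]. }
    exists B'. intros s. rewrite HB'. split.
    + intros (s' & x & Hs' & Hx & ->). apply HB in Hs'.
      destruct (assignment_num Hs') as (v & Hv & ->).
      rewrite (fseq_ext (w := upd v m x)) by (intros; rewrite upd_neq; auto; lia).
      replace x with (upd v m x m) at 2 by apply upd_eq.
      apply (assignment_fseq A (S m)). intros i Hi.
      destruct (Nat.eq_dec i m) as [->|N]; [rewrite upd_eq; exact Hx|].
      rewrite upd_neq by exact N. apply Hv. lia.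
    + intros H. destruct (assignment_num H) as (v & Hv & ->).
      exists (fseq m v), (v m). split; [apply HB, assignment_fseq; auto|]. auto.
Qed.

(* [w] lists, for [k < n], pairs (formula, satisfaction set) built from earlier
   entries. *)
Definition listed A m n w : Prop := forall k, k < n -> exists φ R,
  w k = opair φ R /\
  forall N, k <= N -> sat_step A (num m) (fseq N w) (num k) φ R.

(** The sequence enters [sat_step] only through entries before [k], and only positively. *)
Lemma sat_step_local A m f g k φ R :
  (forall l ψ S, l ∈ k -> entry f l ψ S -> entry g l ψ S) ->
  sat_step A m f k φ R -> sat_step A m g k φ R.
Proof.
  intros H [H'|[H'|[H'|[H'|H']]]].
  - left. exact H'.
  - right. left. exact H'.
  - right. right. left. destruct H' as (l & ψ & S & Hl & He & Hr).
    exists l, ψ, S. auto.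
  - right. right. right. left.
    destruct H' as (l & ψ & S & l' & ψ' & S' & Hl & He & Hl' & He' & Hr).
    exists l, ψ, S, l', ψ', S'. auto 10.
  - right. right. right. right. destruct H' as (i & l & ψ & S & Hi & Hl & He & Hr).
    exists i, l, ψ, S. auto.
Qed.

Lemma entry_fseq n w l ψ S : entry (fseq n w) (num l) ψ S <-> l < n /\ w l = opair ψ S.
Proof.
  unfold entry. split.
  - intros (p & Hp & Ho). apply maps_fseq_num in Hp. apply (is_opair_iff HKP) in Ho.
    destruct Hp. subst. auto.
  - intros [Hl E]. exists (w l). rewrite maps_fseq_num, (is_opair_iff HKP). auto.
Qed.

Lemma listed_extend A m n w φ R : listed A m n w ->
  sat_step A (num m) (fseq n w) (num n) φ R -> listed A m (S n) (upd w n (opair φ R)).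
Proof.
  intros Hw Hs.
  assert (Hloc : forall k N N' φ R, k <= n -> k <= N' ->
    sat_step A (num m) (fseq N w) (num k) φ R ->
    sat_step A (num m) (fseq N' (upd w n (opair φ R))) (num k) φ R).
  { intros k N N' φ' R' Hk HN. apply sat_step_local. intros l ψ S Hl He.
    apply in_num in Hl. destruct Hl as (l' & Hl & ->).
    apply entry_fseq in He. apply entry_fseq. split; [lia|].
    rewrite upd_neq by lia. apply He. }
  intros k Hk. destruct (Nat.eq_dec k n) as [->|N].
  - exists φ, R. split; [apply upd_eq|]. intros N HN. eapply Hloc; eauto.
  - destruct (Hw k) as (ψ & S & E & H); [lia|]. exists ψ, S.
    split; [rewrite upd_neq; auto|]. intros N' HN.
    specialize (H k (le_n k)). revert H. apply sat_step_local. intros l χ T Hl He.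
    apply in_num in Hl. destruct Hl as (l' & Hl & ->).
    apply entry_fseq in He. apply entry_fseq. split; [lia|].
    rewrite upd_neq by lia. apply He.
Qed.

(* Any construction sequence can be continued to one that lists a formula
   defining [Q]: this avoids concatenating sequences. *)
Definition representable A m (Q : (nat -> M) -> Prop) : Prop :=
  forall n w, listed A m n w -> exists n' w' l φ R,
    n <= n' /\ listed A m n' w' /\ (forall i, i < n -> w' i = w i) /\
    l < n' /\ w' l = opair φ R /\
    forall s, s ∈ R <-> exists v, (forall i, i < m -> v i ∈ A) /\ s = fseq m v /\ Q v.

(** The set [fseq m v] determines [v] only below [m], so a predicate can be recovered from a
    satisfaction set only up to this agreement. *)
Definition local m (Q : (nat -> M) -> Prop) : Prop :=
  forall v w, (forall i, i < m -> v i = w i) -> Q v -> Q w.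

Lemma code_exists d a b : exists c, is_code d c a b.
Proof.
  exists (opair (num d) (opair a b)), (num d), (opair a b).
  rewrite !(is_opair_iff HKP). split; [apply num_spec | auto].
Qed.

Section Representable.
Variables (A : M) (m : nat).

Lemma representable_extend n n1 w w1 φ R (Q : (nat -> M) -> Prop) :
  n <= n1 -> listed A m n1 w1 -> (forall i, i < n -> w1 i = w i) ->
  sat_step A (num m) (fseq n1 w1) (num n1) φ R ->
  (forall s, s ∈ R <-> exists v, (forall i, i < m -> v i ∈ A) /\ s = fseq m v /\ Q v) ->
  exists n' w' l φ R,
    n <= n' /\ listed A m n' w' /\ (forall i, i < n -> w' i = w i) /\
    l < n' /\ w' l = opair φ R /\
    forall s, s ∈ R <-> exists v, (forall i, i < m -> v i ∈ A) /\ s = fseq m v /\ Q v.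
Proof.
  intros Hn Hl He Hs HR. exists (S n1), (upd w1 n1 (opair φ R)), n1, φ, R.
  repeat split; try lia; try apply HR.
  - apply listed_extend; assumption.
  - intros i Hi. rewrite upd_neq by lia. auto.
  - apply upd_eq.
Qed.

Lemma representable_atom d (P : M -> M -> Prop) i j : i < m -> j < m ->
  definable true (fun e => P (e 0) (e 1)) ->
  (forall f k φ R a b, a ∈ num m -> b ∈ num m -> is_code d φ a b ->
    (forall s, s ∈ R <-> assignment A (num m) s /\
       exists x y, maps s a x /\ maps s b y /\ P x y) ->
    sat_step A (num m) f k φ R) ->
  representable A m (fun v => P (v i) (v j)).
Proof.
  intros Hi Hj HP Hstep n w Hw.
  destruct (code_exists d (num i) (num j)) as [φ Hφ].
  destruct (assignments_exist A m) as [B HB].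
  destruct (separation HKP (P := fun s => exists x, x ∈ A /\ exists y, y ∈ A /\
    (maps s (num i) x /\ maps s (num j) y /\ P x y))) with (a := B) as [R HR].
  { assert (D := definable_subst2 HP (t := fun e => e 1) (u := fun e => e 0)
      (term_var 1) (term_var 0)).
    repeat (refine (@definable_bex _ _ _ _ _ _); [term_tac|]; cbv beta).
    def_tac; exact D. }
  assert (HR' : forall s, s ∈ R <-> assignment A (num m) s /\
       exists x y, maps s (num i) x /\ maps s (num j) y /\ P x y).
  { intros s. rewrite HR, HB. split.
    - intros (Hs & x & _ & y & _ & H). eauto.
    - intros (Hs & x & y & Hx & Hy & H). split; [exact Hs|].
      exists x. split; [eapply Hs, Hx|]. exists y. split; [eapply Hs, Hy|]. auto. }
  apply (@representable_extend n n w w φ R); auto.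
  - eapply Hstep; [apply num_mem, Hi | apply num_mem, Hj | exact Hφ | exact HR'].
  - intros s. rewrite HR'. split.
    + intros (Hs & x & y & Hx & Hy & H). destruct (assignment_num Hs) as (v & Hv & ->).
      apply maps_fseq_num in Hx, Hy. destruct Hx as [_ ->], Hy as [_ ->]. eauto.
    + intros (v & Hv & -> & H). split; [apply assignment_fseq, Hv|].
      exists (v i), (v j). rewrite !maps_fseq_num. auto.
Qed.

Lemma representable_mem i j : i < m -> j < m ->
  representable A m (fun v => v i ∈ v j).
Proof.
  intros Hi Hj. apply (representable_atom (d := 0) (P := @mem M) Hi Hj); [def_tac|].
  intros f k φ R a b Ha Hb Hc HR. left. eauto 6.
Qed.

Lemma representable_eq i j : i < m -> j < m ->
  representable A m (fun v => v i = v j).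
Proof.
  intros Hi Hj. apply (representable_atom (d := 1) (P := @eq M) Hi Hj); [def_tac|].
  intros f k φ R a b Ha Hb Hc HR. right. left. eauto 6.
Qed.

Lemma representable_not Q : local m Q -> representable A m Q ->
  representable A m (fun v => ~ Q v).
Proof.
  intros Hloc HQ n w Hw.
  destruct (HQ n w Hw) as (n1 & w1 & l & ψ & S & Hn & Hw1 & He & Hl & Hlw & HS).
  destruct (code_exists 2 ψ ψ) as [φ Hφ].
  destruct (assignments_exist A m) as [B HB].
  destruct (separation HKP (P := fun s => s ∉ S)) with (a := B) as [R HR]; [def_tac|].
  apply (@representable_extend n n1 w w1 φ R); auto.
  - right. right. left. exists (num l), ψ, S. rewrite num_mem, entry_fseq.
    split; [exact Hl|]. split; [auto|]. split; [exact Hφ|].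
    intros s. rewrite HR, HB. reflexivity.
  - intros s. rewrite HR, HB. split.
    + intros [Hs Hn']. destruct (assignment_num Hs) as (v & Hv & ->).
      exists v. split; [exact Hv|]. split; [reflexivity|]. intros Hq. apply Hn', HS. eauto.
    + intros (v & Hv & -> & H). split; [apply assignment_fseq, Hv|].
      intros Hs. apply HS in Hs. destruct Hs as (v' & _ & E & Hq). apply H.
      apply (Hloc v'); [|exact Hq]. intros i Hi. symmetry. apply (fseq_inj E Hi).
Qed.

Lemma representable_and Q Q' : local m Q ->
  representable A m Q -> representable A m Q' ->
  representable A m (fun v => Q v /\ Q' v).
Proof.
  intros Hloc HQ HQ' n w Hw.
  destruct (HQ n w Hw) as (n1 & w1 & l & ψ & S & Hn & Hw1 & He & Hl & Hlw & HS).
  (* The sequence [w1] is continued, so the entry for [Q] keeps its position [l]. *)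
  destruct (HQ' n1 w1 Hw1) as (n2 & w2 & l' & ψ' & S' & Hn' & Hw2 & He' & Hl' & Hlw' & HS').
  destruct (code_exists 3 ψ ψ') as [φ Hφ].
  destruct (separation HKP (P := fun s => s ∈ S')) with (a := S) as [R HR]; [def_tac|].
  apply (@representable_extend n n2 w w2 φ R); auto; try lia.
  - intros i Hi. rewrite He' by lia. auto.
  - right. right. right. left. exists (num l), ψ, S, (num l'), ψ', S'.
    rewrite !num_mem, !entry_fseq, He' by exact Hl.
    split; [lia|]. split; [split; [lia | exact Hlw]|].
    split; [lia|]. split; [split; [lia | exact Hlw']|]. split; [exact Hφ|].
    intros s. rewrite HR. split; [|tauto]. intros [H1 H2]. split; [|auto].
    apply HS in H1. destruct H1 as (v & Hv & -> & _). apply assignment_fseq, Hv.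
  - intros s. rewrite HR, HS, HS'. split.
    + intros [(v & Hv & -> & Hq) (v' & Hv' & E & Hq')]. exists v'.
      split; [exact Hv'|]. split; [exact E|]. split; [|exact Hq'].
      apply (Hloc v); [|exact Hq]. apply (fseq_inj E).
    + intros (v & Hv & -> & Hq & Hq'). split; exists v; auto.
Qed.

Lemma representable_ex Q i : i < m -> local m Q -> representable A m Q ->
  representable A m (fun v => exists x, x ∈ A /\ Q (upd v i x)).
Proof.
  intros Hi Hloc HQ n w Hw.
  destruct (HQ n w Hw) as (n1 & w1 & l & ψ & S & Hn & Hw1 & He & Hl & Hlw & HS).
  destruct (code_exists 4 (num i) ψ) as [φ Hφ].
  destruct (assignments_exist A m) as [B HB].
  destruct (separation HKP (P := fun s => exists x, x ∈ A /\ exists t, t ∈ S /\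
    update A (num m) s (num i) x t)) with (a := B) as [R HR]; [def_tac|].
  assert (HR' : forall s, s ∈ R <-> assignment A (num m) s /\
    exists x t, x ∈ A /\ update A (num m) s (num i) x t /\ t ∈ S).
  { intros s. rewrite HR, HB. split.
    - intros (Hs & x & Hx & t & Ht & H). split; eauto.
    - intros (Hs & x & t & Hx & H & Ht). split; eauto. }
  apply (@representable_extend n n1 w w1 φ R); auto.
  - right. right. right. right. exists (num i), (num l), ψ, S.
    rewrite !num_mem, entry_fseq. auto 10.
  - intros s. rewrite HR'. split.
    + intros (Hs & x & t & Hx & Hu & Ht). destruct (assignment_num Hs) as (v & Hv & ->).
      apply update_fseq in Hu; auto. destruct Hu as [_ ->].
      apply HS in Ht. destruct Ht as (v' & _ & E & Hq).
      exists v. split; [exact Hv|]. split; [reflexivity|]. exists x. split; [exact Hx|].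
      apply (Hloc v'); [|exact Hq]. intros k Hk. symmetry. apply (fseq_inj E Hk).
    + intros (v & Hv & -> & x & Hx & Hq). split; [apply assignment_fseq, Hv|].
      exists x, (fseq m (upd v i x)). split; [exact Hx|]. split.
      * apply update_fseq; auto.
      * apply HS. exists (upd v i x). split; [|auto]. intros k Hk.
        destruct (Nat.eq_dec k i) as [->|N]; [rewrite upd_eq; exact Hx|].
        rewrite upd_neq; auto.
Qed.

End Representable.

(** The bridge from external to internal definability: the empty construction sequence is continued
    until it lists a formula for [Q], then cut at [S l] to make that formula the last entry.
    Variables below [m] carry parameters and variable [m] is the free one. *)
Lemma definable_over_representable A m v (Q : (nat -> M) -> Prop) y :
  (forall i, i < m -> v i ∈ A) -> local (S m) Q -> representable A (S m) Q ->
  (forall x, x ∈ y <-> x ∈ A /\ Q (upd v m x)) -> definable_over A y.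
Proof.
  intros Hv Hloc HQ Hy.
  destruct (HQ 0 v) as (n & w & l & φ & R & _ & Hw & _ & Hl & Hlw & HR);
    [intros k Hk; lia|].
  exists (num m), (num (S m)), (fseq m v), φ, R.
  split; [apply num_natural|].
  split; [apply (is_succ_iff HKP), num_S|].
  split; [apply assignment_fseq, Hv|]. split.
  - exists (num l), (num (S l)), (fseq (S l) w). split; [apply num_natural|].
    split; [apply (is_succ_iff HKP), num_S|]. split; [apply function_on_fseq|]. split.
    + intros k Hk. apply in_num in Hk. destruct Hk as (k' & Hk & ->).
      destruct (Hw k') as (ψ & S' & E & Hs); [lia|]. exists ψ, S'.
      split; [apply entry_fseq; auto|]. apply Hs. lia.
    + apply entry_fseq. auto.
  - assert (Hu : forall x t, update A (num (S m)) (fseq m v) (num m) x t <->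
      x ∈ A /\ t = fseq (S m) (upd v m x)) by (intros; apply update_fseq; auto; lia).
    intros x. rewrite Hy. split.
    + intros [Hx Hq]. split; [exact Hx|]. exists (fseq (S m) (upd v m x)).
      rewrite Hu. split; [auto|]. apply HR. exists (upd v m x). split; [|auto].
      intros i Hi. destruct (Nat.eq_dec i m) as [->|N]; [rewrite upd_eq; exact Hx|].
      rewrite upd_neq by exact N. apply Hv. lia.
    + intros (Hx & t & Ht & HtR). split; [exact Hx|]. apply Hu in Ht.
      destruct Ht as [_ ->]. apply HR in HtR. destruct HtR as (v' & _ & E & Hq).
      apply (Hloc v'); [|exact Hq]. intros i Hi. symmetry. apply (fseq_inj E Hi).
Qed.

End FiniteSequences.

(** * The constructible hierarchy *)

Section DefinableSubsets.
Context {M : structure} (HKP : KP M).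
Implicit Types a b x y A B : M.

Lemma definable_over_subset A y x : definable_over A y -> x ∈ y -> x ∈ A.
Proof. intros (m & m' & s & φ & R & _ & _ & _ & _ & H) Hx. apply H, Hx. Qed.

Lemma representable_ext A m (P Q : (nat -> M) -> Prop) :
  representable HKP A m P -> (forall v, P v <-> Q v) -> representable HKP A m Q.
Proof.
  intros HP E n w Hw.
  destruct (HP n w Hw) as (n' & w' & l & φ & R & H1 & H2 & H3 & H4 & H5 & HR).
  exists n', w', l, φ, R. repeat (split; [assumption|]).
  intros s. rewrite HR. split; intros (v & Hv & Es & Hq); exists v;
    (split; [exact Hv | split; [exact Es | apply E, Hq]]).
Qed.

(** Codes have no disjunction, so it is expressed by De Morgan's law. *)
Lemma representable_or A m P Q : local m P -> local m Q ->
  representable HKP A m P -> representable HKP A m Q ->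
  representable HKP A m (fun v => P v \/ Q v).
Proof.
  intros HlP HlQ HP HQ.
  assert (N : forall P : (nat -> M) -> Prop, local m P -> local m (fun v => ~ P v)).
  { intros P' H v w E Hn Hw. apply Hn, (H w); [|exact Hw]. intros; symmetry; auto. }
  apply representable_ext with (fun v => ~ (~ P v /\ ~ Q v)); [|intros; tauto].
  apply representable_not.
  - intros v w E [H1 H2]. split; [apply (N P HlP v) | apply (N Q HlQ v)]; assumption.
  - apply representable_and; auto; apply representable_not; auto.
Qed.

Lemma definable_over_element A a : is_transitive A -> a ∈ A -> definable_over A a.
Proof.
  intros HA Ha. apply (definable_over_representable (HKP := HKP) (m := 1)
    (v := fun _ => a) (Q := fun v => v 1 ∈ v 0)).
  - auto.
  - intros v w E. rewrite !E; auto.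
  - apply representable_mem; lia.
  - intros x. unfold upd. simpl. split; [|tauto]. intros H. split; [|exact H].
    eapply HA; eauto.
Qed.

Lemma definable_over_adj A y a : is_transitive A -> y ∈ A -> a ∈ A ->
  definable_over A (adj y a).
Proof.
  intros HA Hy Ha. apply (definable_over_representable (HKP := HKP) (m := 2)
    (v := fun i => match i with 0 => y | _ => a end)
    (Q := fun v => v 2 ∈ v 0 \/ v 2 = v 1)).
  - intros [|i]; auto.
  - intros v w E. rewrite !E; auto.
  - apply representable_or.
    + intros v w E. rewrite !E; auto.
    + intros v w E. rewrite !E; auto.
    + apply representable_mem; lia.
    + apply representable_eq; lia.
  - intros x. unfold upd. simpl. rewrite (in_adj HKP). split; [|tauto].
    intros H. split; [|exact H]. destruct H as [H| ->]; [eapply HA; eauto | exact Ha].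
Qed.

(** [A] may be empty and so offer no parameters; v_0 ∈ v_0 uses none and fails by foundation. *)
Lemma definable_over_empty A x : is_empty x -> definable_over A x.
Proof.
  intros Hx. apply (definable_over_representable (HKP := HKP) (m := 0)
    (v := fun _ => A) (Q := fun v => v 0 ∈ v 0)).
  - lia.
  - intros v w E. rewrite !E; auto.
  - apply representable_mem; lia.
  - intros z. unfold upd. simpl. split; [intros H; destruct (Hx z H)|].
    intros [_ H]. destruct (mem_irrefl HKP H).
Qed.

End DefinableSubsets.

(** * The levels of L over any collective class that contains the graph of Def *)

Section Hierarchy.
Context {M : structure} (HKP : KP M).
Variable C : ((nat -> M) -> Prop) -> Prop.
Hypothesis HC : collective C.
Hypothesis Def_total : forall A : M, exists D, is_Def A D.
Hypothesis Def_definable : C (fun e => is_Def (e 0) (e 1)).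
Implicit Types a b x y X Y Z D α β γ : M.

Lemma Def_unique X D D' : is_Def X D -> is_Def X D' -> D = D'.
Proof.
  intros H H'. apply (set_ext HKP). intros z. rewrite (H z). symmetry. apply H'.
Qed.

(** A single clause, the union of all Def(Lv β) with β in x, is used for every set x in place of the
    cases zero, successor and limit; [Lv_sequence] derives those on ordinals. *)
Theorem hierarchy_exists : exists Lv : M -> M,
  C (fun e => e 1 = Lv (e 0)) /\
  forall x y, y ∈ Lv x <-> exists β, β ∈ x /\ definable_over (Lv β) y.
Proof.
  assert (HD : forall t u, term t -> term u -> C (fun e => is_Def (t e) (u e)))
    by (intros; apply (coll_subst2 HC Def_definable); assumption).
  (* Both inclusions say [exists D], so that [is_Def] occurs only positively and the predicate stays
     in [C]. *)
  destruct (mem_recursion HKP HC (F := fun r Y =>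
    (forall y, y ∈ Y -> exists Z, Z ∈ r /\ exists D, is_Def Z D /\ y ∈ D) /\
    (forall Z, Z ∈ r -> exists D, is_Def Z D /\ forall y, y ∈ D -> y ∈ Y)))
    as (Lv & Hg & HLv).
  - apply (coll_and HC).
    + refine (coll_ball HC _ _); [term_tac|]. refine (coll_bex HC _ _); [term_tac|].
      refine (coll_ex HC _). apply (coll_and HC); [apply HD; term_tac|].
      apply (coll_delta0 HC). def_tac.
    + refine (coll_ball HC _ _); [term_tac|].
      refine (coll_ex HC _). apply (coll_and HC); [apply HD; term_tac|].
      apply (coll_delta0 HC). def_tac.
  - intros r. destruct (replacement HC Def_definable (a := r)) as [c Hc].
    { intros Z _. destruct (Def_total Z) as [D HZ]. exists D. split; [exact HZ|].
      intros D'. apply Def_unique, HZ. }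
    exists (union c). split.
    + intros y Hy. apply (in_union HKP) in Hy. destruct Hy as (D & Hy & HDc).
      apply Hc in HDc. destruct HDc as (Z & HZ & H). eauto.
    + intros Z HZ. destruct (Def_total Z) as [D H]. exists D. split; [exact H|].
      intros y Hy. apply (in_union HKP). exists D. split; [exact Hy|]. apply Hc. eauto.
  - intros r Y Y' [H1 H2] [H1' H2']. apply (set_ext HKP). intros y. split; intros Hy.
    + destruct (H1 y Hy) as (Z & HZ & D & H & HyD). destruct (H2' Z HZ) as (D' & H' & Hs).
      apply Hs. rewrite (Def_unique H' H). exact HyD.
    + destruct (H1' y Hy) as (Z & HZ & D & H & HyD). destruct (H2 Z HZ) as (D' & H' & Hs).
      apply Hs. rewrite (Def_unique H' H). exact HyD.
  - exists Lv. split; [exact Hg|]. intros x y.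
    destruct (HLv x) as (r & Hr & H1 & H2). split.
    + intros Hy. destruct (H1 y Hy) as (Z & HZ & D & HD' & HyD).
      apply Hr in HZ. destruct HZ as (β & Hβ & ->). exists β. split; [exact Hβ|].
      apply HD', HyD.
    + intros (β & Hβ & Hy). destruct (H2 (Lv β)) as (D & HD' & Hs); [apply Hr; eauto|].
      apply Hs, HD', Hy.
Qed.

Variable Lv : M -> M.
Hypothesis Lv_definable : C (fun e => e 1 = Lv (e 0)).
Hypothesis in_Lv : forall x y, y ∈ Lv x <-> exists β, β ∈ x /\ definable_over (Lv β) y.

Lemma Lv_definable_over α β y : β ∈ α -> definable_over (Lv β) y -> y ∈ Lv α.
Proof. intros Hβ Hy. apply in_Lv. eauto. Qed.

Lemma Lv_mono α β x : is_ordinal α -> β ∈ α -> x ∈ Lv β -> x ∈ Lv α.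
Proof.
  intros Hα Hβ Hx. apply in_Lv in Hx. destruct Hx as (γ & Hγ & Hx).
  eapply Lv_definable_over; [|exact Hx]. eapply ordinal_trans; eauto.
Qed.

Lemma Lv_mono_eq α β x : is_ordinal α -> β ∈ α \/ β = α -> x ∈ Lv β -> x ∈ Lv α.
Proof. intros Hα [Hβ| ->]; [apply Lv_mono; assumption | auto]. Qed.

Lemma Lv_transitive α : is_ordinal α -> is_transitive (Lv α).
Proof.
  intros Hα y z Hz Hy. apply in_Lv in Hy. destruct Hy as (β & Hβ & Hy).
  apply (Lv_mono Hα Hβ). eapply definable_over_subset; eauto.
Qed.

Lemma Lv_adj α β y a : is_ordinal α -> β ∈ α -> y ∈ Lv β -> a ∈ Lv β ->
  adj y a ∈ Lv α.
Proof.
  intros Hα Hβ Hy Ha. apply (Lv_definable_over Hβ), definable_over_adj; auto.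
  eapply Lv_transitive, ordinal_mem; eauto.
Qed.

Lemma Lv_sequence α : is_ordinal α -> exists f, L_sequence α f /\ maps f α (Lv α).
Proof.
  intros Hα.
  destruct (image_exists HC (g := fun β => opair β (Lv β))) with (a := adj α α)
    as [f Hf].
  { apply (coll_ext HC (P := fun e => exists Y, Y = Lv (e 0) /\ e 1 = opair (e 0) Y)).
    - refine (coll_ex HC _). apply (coll_and HC).
      + apply (coll_subst2 HC (R := fun x y => y = Lv x) Lv_definable); term_tac.
      + apply (coll_delta0 HC). def_tac.
    - intros e. split; [intros (Y & -> & H); exact H | eauto]. }
  assert (Hm : forall β X, maps f β X <-> β ∈ adj α α /\ X = Lv β).
  { intros β X. rewrite (maps_iff HKP), Hf. split.
    - intros (γ & Hγ & E). apply (opair_inj HKP) in E. destruct E; subst. auto.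
    - intros [Hβ ->]. eauto. }
  exists f. split; [|apply Hm; rewrite (in_adj HKP); auto].
  split; [exact Hα|]. exists (adj α α). split; [apply (is_succ_iff HKP); reflexivity|].
  split.
  - split.
    + intros p Hp. apply Hf in Hp. destruct Hp as (β & Hβ & ->).
      exists β, (Lv β). rewrite (is_opair_iff HKP). auto.
    + intros β Hβ. exists (Lv β). split; [apply Hm; auto|].
      intros Y HY. apply Hm in HY. symmetry. apply HY.
  - intros β X Hβ HX. apply Hm in HX. destruct HX as [_ ->].
    assert (Oβ : is_ordinal β) by (eapply ordinal_mem; [apply (ordinal_succ HKP Hα) | exact Hβ]).
    split; [|split].
    + intros He y Hy. apply in_Lv in Hy. destruct Hy as (γ & Hγ & _).
      apply (He γ Hγ).
    + intros γ Y Hs HY. apply Hm in HY. destruct HY as [_ ->].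
      assert (Hγ : γ ∈ β) by (apply Hs; auto).
      assert (Oγ : is_ordinal γ) by (eapply ordinal_mem; eauto).
      intros y. split.
      (* For [δ] below [γ], [y] is an element of the transitive set [Lv γ], hence definable over it
         with itself as parameter. *)
      * intros Hy. apply in_Lv in Hy. destruct Hy as (δ & Hδ & Hy).
        apply Hs in Hδ. destruct Hδ as [Hδ| ->]; [|exact Hy].
        apply (definable_over_element HKP); [apply Lv_transitive, Oγ|].
        apply (Lv_definable_over Hδ Hy).
      * apply Lv_definable_over, Hγ.
    + intros Hlim x. split.
      (* What is definable over [Lv γ] appears at the next level, which is still below a limit. *)
      * intros Hx. apply in_Lv in Hx. destruct Hx as (γ & Hγ & Hx).
        assert (Hsucc := limit_succ HKP Hlim Hγ).
        exists (adj γ γ), (Lv (adj γ γ)). split; [exact Hsucc|]. split.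
        -- apply Hm. split; [|reflexivity].
           eapply ordinal_trans; [apply (ordinal_succ HKP Hα)| exact Hβ | exact Hsucc].
        -- apply (Lv_definable_over (β := γ)); [apply (in_adj HKP); auto | exact Hx].
      * intros (γ & Y & Hγ & HY & Hx). apply Hm in HY. destruct HY as [_ ->].
        apply (Lv_mono Oβ Hγ Hx).
Qed.

Lemma Lv_constructible α x : is_ordinal α -> x ∈ Lv α -> constructible x.
Proof.
  intros Hα Hx. destruct (Lv_sequence Hα) as (f & Hf & Hm).
  exists α, f, (Lv α). auto.
Qed.

End Hierarchy.

(** * Closure under set operations *)

Section Closure.
Context {M : structure} (HKP : KP M).
Variable o : M.
Hypothesis Ho : is_omega o.
Variable V : M.
Variable T : M -> M -> M -> Prop.
Hypothesis HT : definable true (fun e => T (e 0) (e 1) (e 2)).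
Implicit Types a f p r w x y z A U X Y : M.

Definition is_sep w x y : Prop :=
  (forall s, s ∈ w -> s ∈ V /\ T x y s) /\ (forall s, s ∈ V -> T x y s -> s ∈ w).

Lemma definable_is_sep t u v : term t -> term u -> term v ->
  definable true (fun e => is_sep (t e) (u e) (v e)).
Proof.
  intros Ht Hu Hv. assert (D := fun t u v => definable_subst3 (t := t) (u := u) (v := v) HT).
  apply definable_and; (refine (@definable_ball _ _ _ _ _ _); [term_tac|]); cbv beta.
  - apply definable_and; [def_tac | apply D; term_tac].
  - apply definable_imp; [apply D; term_tac | def_tac].
Qed.
Hint Resolve definable_is_sep : definability.

Lemma is_sep_sep x y : is_sep (sep V (T x y)) x y.
Proof.
  assert (H : definable true (fun e => T x y (e 0)))
    by (apply (definable_subst3 (t := fun _ => x) (u := fun _ => y)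
          (v := fun e => e 0) HT); term_tac).
  split; intros s; rewrite (in_sep HKP _ H); auto.
Qed.

Lemma is_sep_unique w w' x y : is_sep w x y -> is_sep w' x y -> w = w'.
Proof.
  intros [H1 H2] [H1' H2']. apply (set_ext HKP). intros z. split; intros Hz.
  - destruct (H1 z Hz). auto.
  - destruct (H1' z Hz). auto.
Qed.

(** [X] determines [Y]; the clauses are spelled out with bounded quantifiers so that recursion along
    Sigma_1 predicates applies. *)
Definition closure_step X Y : Prop :=
  (forall w, w ∈ Y -> w ∈ X \/ (exists v, v ∈ X /\ w ∈ v) \/
     exists x, x ∈ X /\ exists y, y ∈ X /\
       (w = upair x y \/ w = cup x y \/ is_sep w x y)) /\
  (forall x, x ∈ X -> x ∈ Y) /\
  (forall x, x ∈ X -> forall y, y ∈ x -> y ∈ Y) /\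
  (forall x, x ∈ X -> forall y, y ∈ X ->
     (exists w, w ∈ Y /\ w = upair x y) /\ (exists w, w ∈ Y /\ w = cup x y) /\
     exists w, w ∈ Y /\ is_sep w x y).

Lemma closure_step_exists X : exists Y, closure_step X Y.
Proof.
  assert (I : forall g : M -> M -> M, definable true (fun e => e 2 = g (e 0) (e 1)) ->
    exists c, forall y, y ∈ c <-> exists x z, x ∈ X /\ z ∈ X /\ y = g x z).
  { intros g Hg. apply (image2_exists (sigma_collective HKP) HKP).
    apply sigma_delta0, Hg. }
  destruct (I upair) as [c1 H1]; [def_tac|].
  destruct (I cup) as [c2 H2]; [def_tac|].
  destruct (I (fun x y => sep V (T x y))) as [c3 H3].
  { apply definable_ext with (fun e => is_sep (e 2) (e 0) (e 1)); [def_tac|].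
    intros e. split; [intros H; apply (is_sep_unique H), is_sep_sep|].
    intros ->. apply is_sep_sep. }
  exists (cup (cup X (union X)) (cup c1 (cup c2 c3))).
  repeat split; intros.
  - rewrite !(in_cup HKP), (in_union HKP), H1, H2, H3 in H.
    destruct H as [[H|(v & Hv & H)]|[(x & z & Hx & Hz & ->)|[(x & z & Hx & Hz & ->)|
      (x & z & Hx & Hz & ->)]]]; eauto; right; right; exists x; (split; [exact Hx|]);
      exists z; (split; [exact Hz|]); auto using is_sep_sep.
  - rewrite !(in_cup HKP). auto.
  - rewrite !(in_cup HKP), (in_union HKP). eauto.
  - exists (upair x y). split; [|reflexivity]. rewrite !(in_cup HKP), H1. eauto 8.
  - exists (cup x y). split; [|reflexivity]. rewrite !(in_cup HKP), H2. eauto 9.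
  - exists (sep V (T x y)). split; [|apply is_sep_sep].
    rewrite !(in_cup HKP), H3. eauto 9.
Qed.

Lemma closure_step_subset X Y Y' : closure_step X Y -> closure_step X Y' ->
  forall w, w ∈ Y -> w ∈ Y'.
Proof.
  intros (H & _) (_ & H1 & H2 & H3) w Hw.
  destruct (H w Hw) as [Hx|[(v & Hv & Hx)|(x & Hx & y & Hy & E)]]; [auto | eauto|].
  destruct (H3 x Hx y Hy) as ((w1 & Hw1 & E1) & (w2 & Hw2 & E2) & (w3 & Hw3 & E3)).
  destruct E as [E|[E|E]]; [congruence | congruence|].
  rewrite (is_sep_unique E E3). exact Hw3.
Qed.

(** Stage [h n] is one step applied to [X] together with all earlier stages, and [U] is the union of
    the stages in omega. Elements from stages [n] and [m] are combined at the stage after the larger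
    of the two. *)
Lemma closure_exists X : exists U, (forall x, x ∈ X -> x ∈ U) /\ is_transitive U /\
  forall x y, x ∈ U -> y ∈ U ->
    upair x y ∈ U /\ cup x y ∈ U /\ exists w, w ∈ U /\ is_sep w x y.
Proof.
  destruct (mem_recursion HKP (sigma_collective HKP) (F := fun r Y =>
    exists z, z = union r /\ exists x, x = cup X z /\ closure_step x Y))
    as (h & Hg & Hh).
  - refine (sigma_ex HKP _). cbv beta.
    refine (sigma_and HKP _ _); [apply sigma_delta0; def_tac|].
    refine (sigma_ex HKP _). cbv beta. apply sigma_delta0.
    apply definable_and; [def_tac|]. unfold closure_step. def_tac.
  - intros r. destruct (closure_step_exists (cup X (union r))) as [Y HY]. eauto 8.
  - intros r y y' (z & -> & w & -> & H) (z' & -> & w' & -> & H').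
    apply (set_ext HKP). intros x.
    split; [apply (closure_step_subset H H') | apply (closure_step_subset H' H)].
  - destruct (image_exists (sigma_collective HKP) Hg o) as [c Hc].
    assert (S : forall n, exists x, closure_step x (h n) /\ (forall y, y ∈ X -> y ∈ x) /\
      forall k, k ∈ n -> forall y, y ∈ h k -> y ∈ x).
    { intros n. destruct (Hh n) as (r & Hr & z & -> & x & -> & H).
      exists (cup X (union r)). split; [exact H|].
      split; [intros y Hy; apply (in_cup HKP); auto|].
      intros k Hk y Hy. apply (in_cup HKP). right. apply (in_union HKP).
      exists (h k). split; [exact Hy|]. apply Hr. eauto. }
    assert (HU : forall x, x ∈ union c <-> exists n, n ∈ o /\ x ∈ h n).
    { intros x. rewrite (in_union HKP). split.
      - intros (y & Hx & Hy). apply Hc in Hy. destruct Hy as (n & Hn & ->). eauto.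
      - intros (n & Hn & Hx). exists (h n). split; [exact Hx|]. apply Hc. eauto. }
    assert (Lo : is_limit o) by apply Ho.
    exists (union c). split; [|split].
    + intros x Hx. apply HU. exists (num HKP 0). split; [apply Ho, num_natural|].
      destruct (S (num HKP 0)) as (y & (_ & Hy & _) & HX & _). auto.
    + intros y z Hz Hy. apply HU in Hy. destruct Hy as (n & Hn & Hy).
      apply HU. exists (adj n n). split; [apply (limit_succ HKP Lo Hn)|].
      destruct (S (adj n n)) as (x & (_ & _ & Hx & _) & _ & Hk).
      apply (Hx y); [|exact Hz]. apply (Hk n); [apply (in_adj HKP); auto | exact Hy].
    + intros x y Hx Hy. apply HU in Hx, Hy.
      destruct Hx as (n & Hn & Hx), Hy as (m & Hm & Hy).
      destruct (ordinal_max HKP (ordinal_mem (proj1 Lo) Hn) (ordinal_mem (proj1 Lo) Hm))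
        as (l & Hl & Hnl & Hml).
      assert (Hlo : l ∈ o) by (destruct Hl; subst; assumption).
      assert (Hs := limit_succ HKP Lo Hlo).
      destruct (S (adj l l)) as (z & (_ & _ & _ & Hz) & _ & Hk).
      destruct (Hz x) with (y := y) as ((w1 & Hw1 & E1) & (w2 & Hw2 & E2) & (w3 & Hw3 & E3)).
      { apply (Hk n); [apply (in_adj HKP), Hnl | exact Hx]. }
      { apply (Hk m); [apply (in_adj HKP), Hml | exact Hy]. }
      subst. split; [apply HU; eauto | split; [apply HU; eauto|]].
      exists w3. split; [apply HU; eauto | exact E3].
Qed.

End Closure.

(** * Definable subsets in the presence of omega *)

Section Restriction.
Context {M : structure} (HKP : KP M).
Implicit Types a f g k l m n p r s w x y z A R S φ ψ : M.

Lemma function_on_succ n f : function_on f (adj n n) -> exists g x,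
  function_on g n /\ f = adj g (opair n x) /\
  forall a y, a ∈ n -> maps f a y -> maps g a y.
Proof.
  intros [H1 H2].
  destruct (separation HKP (P := fun p => exists a y, is_opair p a y /\ a ∈ n))
    with (a := f) as [g Hg]; [def_tac|].
  destruct (H2 n) as (x & Hx & Ux); [apply (in_adj HKP); auto|].
  assert (Hm : forall a y, a ∈ n -> maps f a y -> maps g a y).
  { intros a y Ha (p & Hp & Hf). exists p. split; [exact Hp|]. apply Hg. eauto. }
  exists g, x. split; [split|split].
  - intros p Hp. apply Hg in Hp. destruct Hp as (_ & a & y & Hp & Ha). eauto.
  - intros a Ha. destruct (H2 a) as (y & Hy & Uy); [apply (in_adj HKP); auto|].
    exists y. split; [apply Hm; assumption|]. intros y' (p & Hp & Hpg). apply Uy.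
    exists p. split; [exact Hp | apply Hg, Hpg].
  - apply (set_ext HKP). intros p. rewrite (in_adj HKP), Hg. split.
    + intros Hp. destruct (H1 p Hp) as (a & y & Ha & Ho).
      apply (in_adj HKP) in Ha. destruct Ha as [Ha| ->]; [left; eauto|]. right.
      rewrite (Ux y); [apply (is_opair_iff HKP), Ho | exists p; auto].
    + intros [[Hp _]| ->]; [exact Hp | apply (maps_iff HKP), Hx].
  - exact Hm.
Qed.

Lemma adj_maps g n x a y : maps g a y -> maps (adj g (opair n x)) a y.
Proof. rewrite !(maps_iff HKP), (in_adj HKP). auto. Qed.

Definition sat_mem A m i j s : Prop := assignment A m s /\
  exists x, x ∈ A /\ exists y, y ∈ A /\ (maps s i x /\ maps s j y /\ x ∈ y).
Definition sat_eq A m i j s : Prop := assignment A m s /\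
  exists x, x ∈ A /\ exists y, y ∈ A /\ (maps s i x /\ maps s j y /\ x = y).
Definition sat_not A m S s : Prop := assignment A m s /\ s ∉ S.
Definition sat_and A m S S' s : Prop := assignment A m s /\ s ∈ S /\ s ∈ S'.
Definition sat_ex A m i S s : Prop := assignment A m s /\
  exists x, x ∈ A /\ exists t, t ∈ S /\ update A m s i x t.
(** The condition by which [definable_over] carves out a set: [q] holds the parameters, [i] is the
    free variable and [R] the satisfaction set. *)
Definition cut A m i q R x : Prop := x ∈ A /\ exists t, t ∈ R /\ update A m q i x t.

Definition is_collection (R : M) (P : M -> Prop) : Prop := forall s, s ∈ R <-> P s.

(* [sat_step] with the quantifiers over elements of [A] and of satisfaction
   sets made bounded; [I] says that a set is the collection of the [s] with a
   given property, [E] restricts the quantifiers over entries. *)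
Definition sat_case (I : M -> (M -> Prop) -> Prop) (E : M -> Prop) A m f k φ R : Prop :=
  (exists i, i ∈ m /\ exists j, j ∈ m /\
     (is_code 0 φ i j /\ I R (sat_mem A m i j))) \/
  (exists i, i ∈ m /\ exists j, j ∈ m /\
     (is_code 1 φ i j /\ I R (sat_eq A m i j))) \/
  (exists l, l ∈ k /\ exists ψ, E ψ /\ exists S, E S /\
     (entry f l ψ S /\ is_code 2 φ ψ ψ /\ I R (sat_not A m S))) \/
  (exists l, l ∈ k /\ exists ψ, E ψ /\ exists S, E S /\
   exists l', l' ∈ k /\ exists ψ', E ψ' /\ exists S', E S' /\
     (entry f l ψ S /\ entry f l' ψ' S' /\ is_code 3 φ ψ ψ' /\
      I R (sat_and A m S S'))) \/
  (exists i, i ∈ m /\ exists l, l ∈ k /\ exists ψ, E ψ /\ exists S, E S /\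
     (entry f l ψ S /\ is_code 4 φ i ψ /\ I R (sat_ex A m i S))).

Lemma sat_case_iff A m f k φ R : sat_step A m f k φ R <->
  sat_case is_collection (fun _ => True) A m f k φ R.
Proof.
  assert (EQ : forall P Q : M -> Prop, (forall s, P s <-> Q s) ->
    (is_collection R Q <-> forall s, s ∈ R <-> P s)).
  { intros P Q H. unfold is_collection.
    split; intros H' s; [rewrite H | rewrite <- H]; apply H'. }
  assert (E0 : forall (B : M -> M -> Prop) i j s,
    (assignment A m s /\ exists x y, maps s i x /\ maps s j y /\ B x y) <->
    (assignment A m s /\ exists x, x ∈ A /\ exists y, y ∈ A /\
      (maps s i x /\ maps s j y /\ B x y))).
  { intros B i j s. split; intros [Hs H]; (split; [exact Hs|]).
    - destruct H as (x & y & Hx & Hy & H). exists x. split; [apply (proj2 Hs i x Hx)|].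
      exists y. split; [apply (proj2 Hs j y Hy) | auto].
    - destruct H as (x & _ & y & _ & H). eauto. }
  assert (Em : forall i j s, (assignment A m s /\
    exists x y, maps s i x /\ maps s j y /\ x ∈ y) <-> sat_mem A m i j s)
    by exact (E0 (@mem M)).
  assert (Ee : forall i j s, (assignment A m s /\
    exists x y, maps s i x /\ maps s j y /\ x = y) <-> sat_eq A m i j s)
    by exact (E0 eq).
  assert (E4 : forall i S s, (assignment A m s /\
      exists x t, x ∈ A /\ update A m s i x t /\ t ∈ S) <-> sat_ex A m i S s).
  { intros i S s. unfold sat_ex. split; intros [Hs H]; (split; [exact Hs|]).
    - destruct H as (x & t & Hx & Hu & Ht). eauto.
    - destruct H as (x & Hx & t & Ht & Hu). eauto. }
  unfold sat_step, sat_case. split.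
  - intros [(i & j & Hi & Hj & Hc & H)|[(i & j & Hi & Hj & Hc & H)|
      [(l & ψ & S & Hl & He & Hc & H)|
      [(l & ψ & S & l' & ψ' & S' & Hl & He & Hl' & He' & Hc & H)|
       (i & l & ψ & S & Hi & Hl & He & Hc & H)]]]].
    + left. apply (EQ _ _ (Em i j)) in H. eauto 10.
    + right. left. apply (EQ _ _ (Ee i j)) in H. eauto 10.
    + right. right. left. exists l. eauto 10.
    + right. right. right. left. exists l. split; [exact Hl|]. exists ψ.
      split; [exact I|]. exists S. split; [exact I|]. exists l'. eauto 10.
    + right. right. right. right. apply (EQ _ _ (E4 i S)) in H.
      exists i. split; [exact Hi|]. eauto 10.
  - intros [(i & Hi & j & Hj & Hc & H)|[(i & Hi & j & Hj & Hc & H)|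
      [(l & Hl & ψ & _ & S & _ & He & Hc & H)|
      [(l & Hl & ψ & _ & S & _ & l' & Hl' & ψ' & _ & S' & _ & He & He' & Hc & H)|
       (i & Hi & l & Hl & ψ & _ & S & _ & He & Hc & H)]]]].
    + left. assert (H' := proj1 (EQ _ _ (Em i j)) H). exists i, j. auto.
    + right. left. assert (H' := proj1 (EQ _ _ (Ee i j)) H). exists i, j. auto.
    + right. right. left. exists l, ψ, S. auto.
    + right. right. right. left. exists l, ψ, S, l', ψ', S'. auto 10.
    + right. right. right. right. assert (H' := proj1 (EQ _ _ (E4 i S)) H).
      exists i, l, ψ, S. auto.
Qed.

End Restriction.

Section DefWithOmega.
Context {M : structure} (HKP : KP M).
Variable o : M.
Hypothesis Ho : is_omega o.
Implicit Types a f g k l m n p r s w x y z q A R S U V φ ψ : M.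

(* The parameters of the operation are packed into [x = (S, S')] and
   [y = (d, (m, (i, j)))], where [d] selects the operation. *)
Definition operation A x y s : Prop :=
  exists d r, is_opair y d r /\ exists m r', is_opair r m r' /\
  exists i j, is_opair r' i j /\ exists S S', is_opair x S S' /\
  ((is_numeral 0 d /\ sat_mem A m i j s) \/ (is_numeral 1 d /\ sat_eq A m i j s) \/
   (is_numeral 2 d /\ sat_not A m S s) \/ (is_numeral 3 d /\ sat_and A m S S' s) \/
   (is_numeral 4 d /\ sat_ex A m i S s) \/ (is_numeral 5 d /\ cut A m i j S s)).

Lemma definable_operation A :
  definable true (fun e => operation A (e 0) (e 1) (e 2)).
Proof.
  unfold operation, sat_mem, sat_eq, sat_not, sat_and, sat_ex, cut. def_tac.
Qed.

Lemma operation_opair A d m i j S S' s :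
  operation A (opair S S') (opair d (opair m (opair i j))) s <->
  ((is_numeral 0 d /\ sat_mem A m i j s) \/ (is_numeral 1 d /\ sat_eq A m i j s) \/
   (is_numeral 2 d /\ sat_not A m S s) \/ (is_numeral 3 d /\ sat_and A m S S' s) \/
   (is_numeral 4 d /\ sat_ex A m i S s) \/ (is_numeral 5 d /\ cut A m i j S s)).
Proof.
  split.
  - intros (d' & r & E & m' & r' & E' & i' & j' & E'' & S1 & S2 & E3 & H).
    apply (is_opair_iff HKP) in E, E', E'', E3. subst.
    apply (opair_inj HKP) in E. destruct E as [? E]. subst.
    apply (opair_inj HKP) in E. destruct E as [? E]. subst.
    apply (opair_inj HKP) in E. destruct E as [? E]. subst.
    apply (opair_inj HKP) in E3. destruct E3. subst. exact H.
  - intros H. do 2 eexists. split; [apply (is_opair_iff HKP); reflexivity|].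
    do 2 eexists. split; [apply (is_opair_iff HKP); reflexivity|].
    do 2 eexists. split; [apply (is_opair_iff HKP); reflexivity|].
    do 2 eexists. split; [apply (is_opair_iff HKP); reflexivity|]. exact H.
Qed.

Definition pair_cup_closed U : Prop := is_transitive U /\
  forall x, x ∈ U -> forall y, y ∈ U ->
    (exists w, w ∈ U /\ w = upair x y) /\ exists w, w ∈ U /\ w = cup x y.

(** Two layers: [V] contains all assignments, since it is closed under adjoining pairs of a natural
    number and an element of [A]. Satisfaction sets are subsets of [V], and [U] is closed under
    forming them; it then contains formula codes and construction sequences as well. *)
Definition good A V U : Prop :=
  pair_cup_closed V /\ (forall a, a ∈ A -> a ∈ V) /\ (forall n, n ∈ o -> n ∈ V) /\
  pair_cup_closed U /\ V ∈ U /\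
  forall x, x ∈ U -> forall y, y ∈ U -> exists w, w ∈ U /\
    ((forall s, s ∈ w -> s ∈ V /\ operation A x y s) /\
     (forall s, s ∈ V -> operation A x y s -> s ∈ w)).

Lemma good_exists A : exists V U, good A V U.
Proof.
  (* With the false predicate, the separation operation yields just the empty set, so [V] is a
     closure under pairs and unions. *)
  destruct (closure_exists HKP Ho o (T := fun _ _ _ => False) (definable_const true False)
    (cup A o)) as (V & HV & TV & CV).
  destruct (closure_exists HKP Ho V (definable_operation A) (upair V V)) as (U & HU & TU & CU).
  exists V, U. split; [|split; [|split; [|split; [|split]]]].
  - split; [exact TV|]. intros x Hx y Hy. destruct (CV x y Hx Hy) as (H1 & H2 & _).
    split; eauto.
  - intros a Ha. apply HV, (in_cup HKP). auto.
  - intros a Ha. apply HV, (in_cup HKP). auto.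
  - split; [exact TU|]. intros x Hx y Hy. destruct (CU x y Hx Hy) as (H1 & H2 & _).
    split; eauto.
  - apply HU, (in_upair HKP). auto.
  - intros x Hx y Hy. apply (CU x y Hx Hy).
Qed.

Section PairCupClosed.
Variable U : M.
Hypothesis HU : pair_cup_closed U.

Lemma closed_upair x y : x ∈ U -> y ∈ U -> upair x y ∈ U.
Proof.
  intros Hx Hy. destruct (proj2 HU x Hx y Hy) as [(w & Hw & ->) _]. exact Hw.
Qed.

Lemma closed_opair x y : x ∈ U -> y ∈ U -> opair x y ∈ U.
Proof. intros Hx Hy. repeat apply closed_upair; assumption. Qed.

Lemma closed_adj x y : x ∈ U -> y ∈ U -> adj x y ∈ U.
Proof.
  intros Hx Hy.
  destruct (proj2 HU x Hx (upair y y)) as [_ (w & Hw & ->)]; [|exact Hw].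
  apply closed_upair; assumption.
Qed.

Lemma closed_components x y : opair x y ∈ U -> x ∈ U /\ y ∈ U.
Proof.
  intros H. assert (H' : upair x y ∈ U).
  { eapply (proj1 HU); [|exact H]. apply (in_upair HKP). auto. }
  split; (eapply (proj1 HU); [|exact H']; apply (in_upair HKP); auto).
Qed.

End PairCupClosed.

Section Good.
Variables A V U : M.
Hypothesis HG : good A V U.

Lemma good_V : pair_cup_closed V. Proof. apply HG. Qed.
Lemma good_U : pair_cup_closed U. Proof. apply HG. Qed.

Lemma good_V_U x : x ∈ V -> x ∈ U.
Proof.
  intros Hx. destruct HG as (_ & _ & _ & HU & HVU & _).
  apply (proj1 HU V x Hx HVU).
Qed.

Lemma good_A a : a ∈ A -> a ∈ V. Proof. apply (proj1 (proj2 HG)). Qed.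

Lemma good_omega_V n : n ∈ o -> n ∈ V. Proof. apply HG. Qed.

Lemma good_omega n : n ∈ o -> n ∈ U.
Proof. intros H. apply good_V_U, good_omega_V, H. Qed.

Lemma good_num d : num HKP d ∈ U.
Proof. apply good_omega, Ho, num_natural. Qed.

(** The length may be nonstandard, so the induction is internal: an assignment is a shorter one with
    one pair adjoined. *)
Lemma good_assignment n : n ∈ o -> forall s, assignment A n s -> s ∈ V.
Proof.
  intros Hn. apply Ho in Hn. revert n Hn.
  apply (natural_induction HKP (P := fun n => forall s, assignment A n s -> s ∈ V)).
  - def_tac.
  - intros n Hn s [[H1 _] _]. replace s with n; [apply good_omega_V, Ho, natural_empty, Hn|].
    apply (set_ext HKP). intros z. split; intros Hz; [destruct (Hn z Hz)|].
    destruct (H1 z Hz) as (x & _ & Hx & _). destruct (Hn x Hx).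
  - intros n Hn IH s [H1 H2]. destruct (function_on_succ HKP H1) as (g & x & Hg & -> & _).
    apply (closed_adj good_V).
    + apply IH. split; [exact Hg|]. intros i y Hi. apply (H2 i), (adj_maps HKP), Hi.
    + apply (closed_opair good_V); [apply good_omega_V, Ho, Hn|].
      apply good_A, (H2 n). apply (maps_iff HKP), (in_adj HKP). auto.
Qed.

Lemma good_operation d m i j S S' (P : M -> Prop) : m ∈ U -> i ∈ U -> j ∈ U ->
  S ∈ U -> S' ∈ U -> (forall s, P s -> s ∈ V) ->
  (forall s, operation A (opair S S') (opair (num HKP d) (opair m (opair i j))) s <-> P s) ->
  forall R, is_collection R P -> R ∈ U.
Proof.
  intros Hm Hi Hj HS HS' HP HE R HR.
  destruct HG as (_ & _ & _ & _ & _ & H).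
  destruct (H (opair S S')) with (y := opair (num HKP d) (opair m (opair i j)))
    as (w & Hw & H1 & H2).
  - apply (closed_opair good_U); assumption.
  - repeat apply (closed_opair good_U); try assumption. apply good_num.
  - replace R with w; [exact Hw|]. apply (set_ext HKP). intros s. rewrite (HR s). split.
    + intros Hs. apply HE, H1, Hs.
    + intros Hs. apply H2; [apply HP, Hs | apply HE, Hs].
Qed.

Ltac operation_tac :=
  intros; rewrite operation_opair, !(is_numeral_iff HKP);
  split;
    [ intros [[N ?]|[[N ?]|[[N ?]|[[N ?]|[[N ?]|[N ?]]]]]]; apply num_inj in N;
      first [discriminate N | assumption]
    | tauto ].

Lemma good_sat_step m f k φ R : m ∈ o ->
  (forall l ψ S, l ∈ k -> entry f l ψ S -> ψ ∈ U /\ S ∈ U) ->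
  sat_step A m f k φ R -> φ ∈ U /\ R ∈ U.
Proof.
  intros Hm He H.
  assert (Hcode : forall d a b, a ∈ U -> b ∈ U -> is_code d φ a b -> φ ∈ U).
  { intros d a b Ha Hb (t & q & Ht & Hq & Hc).
    apply (is_opair_iff HKP) in Hq, Hc. apply (is_numeral_iff HKP) in Ht. subst.
    repeat apply (closed_opair good_U); try assumption. apply good_num. }
  assert (HmU := good_omega Hm).
  assert (Hi : forall i, i ∈ m -> i ∈ U).
  { intros i Hi. apply good_omega, Ho. apply natural_mem with m; [apply Ho, Hm | exact Hi]. }
  assert (HA := good_assignment Hm).
  apply sat_case_iff in H.
  destruct H as [(i & Hi' & j & Hj & Hc & H)|[(i & Hi' & j & Hj & Hc & H)|
      [(l & Hl & ψ & _ & S & _ & He1 & Hc & H)|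
      [(l & Hl & ψ & _ & S & _ & l' & Hl' & ψ' & _ & S' & _ & He1 & He' & Hc & H)|
       (i & Hi' & l & Hl & ψ & _ & S & _ & He1 & Hc & H)]]]].
  (* Here and below, slots that the chosen operation ignores are filled with [m], which lies in
     [U]. *)
  - split; [eauto|]. refine (good_operation (d := 0) (m := m) (i := i) (j := j) (S := m) (S' := m)
      (P := sat_mem A m i j)
      _ _ _ _ _ _ _ H);
      auto; [intros s [Hs _]; auto|]. operation_tac.
  - split; [eauto|]. refine (good_operation (d := 1) (m := m) (i := i) (j := j) (S := m) (S' := m)
      (P := sat_eq A m i j)
      _ _ _ _ _ _ _ H);
      auto; [intros s [Hs _]; auto|]. operation_tac.
  - destruct (He _ _ _ Hl He1). split; [eauto|].
    refine (good_operation (d := 2) (m := m) (i := m) (j := m) (S := S) (S' := m)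
      (P := sat_not A m S)
      _ _ _ _ _ _ _ H);
      auto; [intros s [Hs _]; auto|]. operation_tac.
  - destruct (He _ _ _ Hl He1), (He _ _ _ Hl' He'). split; [eauto|].
    refine (good_operation (d := 3) (m := m) (i := m) (j := m) (S := S) (S' := S')
      (P := sat_and A m S S')
      _ _ _ _ _ _ _ H);
      auto; [intros s [Hs _]; auto|]. operation_tac.
  - destruct (He _ _ _ Hl He1). split; [eauto|].
    refine (good_operation (d := 4) (m := m) (i := i) (j := m) (S := S) (S' := m)
      (P := sat_ex A m i S)
      _ _ _ _ _ _ _ H);
      auto; [intros s [Hs _]; auto|]. operation_tac.
Qed.

Lemma good_cut m m' q R y : m ∈ o -> m' ∈ o -> assignment A m q -> R ∈ U ->
  is_collection y (cut A m' m q R) -> y ∈ U.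
Proof.
  intros Hm Hm' Hq HR H.
  refine (good_operation (d := 5) (m := m') (i := m) (j := q) (S := R) (S' := R)
      (P := cut A m' m q R)
      _ _ _ _ _ _ _ H);
    eauto using good_omega, good_V_U, good_assignment.
  - intros s [Hs _]. apply good_A, Hs.
  - operation_tac.
Qed.

Lemma entry_closed f l ψ S : f ∈ U -> entry f l ψ S -> ψ ∈ U /\ S ∈ U.
Proof.
  intros Hf (p & Hp & Ho'). apply (is_opair_iff HKP) in Ho'. subst.
  apply (maps_iff HKP) in Hp. apply (closed_components good_U).
  apply (closed_components good_U (x := l)). apply (proj1 good_U) with f; assumption.
Qed.

(** Internal induction on the length. Without its last value a construction sequence is still one,
    because [sat_step] is local; the last entry is built from entries already in [U]. *)
Lemma good_sequence m n : m ∈ o -> n ∈ o -> forall f, function_on f n ->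
  (forall k, k ∈ n -> exists ψ S, entry f k ψ S /\ sat_step A m f k ψ S) -> f ∈ U.
Proof.
  intros Hm Hn. apply Ho in Hn. revert n Hn.
  apply (natural_induction HKP (P := fun n => forall f, function_on f n ->
    (forall k, k ∈ n -> exists ψ S, entry f k ψ S /\ sat_step A m f k ψ S) -> f ∈ U)).
  - unfold sat_step. def_tac.
  - intros n Hn s [H1 _] _. replace s with n; [apply good_omega, Ho, natural_empty, Hn|].
    apply (set_ext HKP). intros z. split; intros Hz; [destruct (Hn z Hz)|].
    destruct (H1 z Hz) as (x & _ & Hx & _). destruct (Hn x Hx).
  - intros n Hn IH f Hf Hs. destruct (function_on_succ HKP Hf) as (g & x & Hg & E & Hmaps).
    assert (Hent : forall l ψ S, l ∈ n -> entry f l ψ S -> entry g l ψ S).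
    { intros l ψ S Hl (p & Hp & Hpo). exists p. split; [apply Hmaps; assumption | exact Hpo]. }
    assert (HgU : g ∈ U).
    { apply IH; [exact Hg|]. intros k Hk.
      destruct (Hs k) as (ψ & S & He & H); [apply (in_adj HKP); auto|].
      exists ψ, S. split; [apply Hent; assumption|].
      revert H. apply sat_step_local. intros l χ T Hl. apply Hent.
      apply (ordinal_trans (proj1 Hn) Hk Hl). }
    destruct (Hs n) as (ψ & S & (p & Hp & Hpo) & H); [apply (in_adj HKP); auto|].
    apply good_sat_step in H; [|exact Hm|].
    + rewrite E. apply (closed_adj good_U); [exact HgU|].
      apply (closed_opair good_U); [apply good_omega, Ho, Hn|].
      assert (x = p).
      { destruct (proj2 Hf n) as (z & _ & Hz); [apply (in_adj HKP); auto|].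
        rewrite <- (Hz p Hp). symmetry. apply Hz. rewrite E.
        apply (maps_iff HKP), (in_adj HKP). auto. }
      subst x. apply (is_opair_iff HKP) in Hpo. subst p.
      apply (closed_opair good_U); apply H.
    + intros l χ T Hl He. apply (entry_closed (f := g) (l := l)); [exact HgU|].
      apply Hent; assumption.
Qed.

(** The bounded counterpart of [is_collection]: both agree when [P] holds only of elements of [V],
    as it does for every clause of satisfaction. *)
Definition collects R (P : M -> Prop) : Prop :=
  (forall s, s ∈ R -> P s) /\ (forall s, s ∈ V -> P s -> s ∈ R).

Definition bounded_definable y : Prop :=
  exists m, m ∈ o /\ exists m', m' ∈ o /\ exists q, q ∈ V /\
  exists φ, φ ∈ U /\ exists R, R ∈ U /\
  (is_succ m' m /\ assignment A m q /\
   (exists n, n ∈ o /\ exists n', n' ∈ o /\ exists f, f ∈ U /\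
     (is_succ n' n /\ function_on f n' /\
      (forall k, k ∈ n' -> exists ψ, ψ ∈ U /\ exists S, S ∈ U /\
        (entry f k ψ S /\ sat_case collects (fun x => x ∈ U) A m' f k ψ S)) /\
      entry f n φ R)) /\
   (forall x, x ∈ y -> cut A m' m q R x) /\
   (forall x, x ∈ A -> cut A m' m q R x -> x ∈ y)).

Lemma collects_iff R (P : M -> Prop) : (forall s, P s -> s ∈ V) ->
  collects R P <-> is_collection R P.
Proof.
  intros HP. unfold collects, is_collection. split.
  - intros [H1 H2] s. split; auto.
  - intros H. split; intros s; [|intros _]; apply H.
Qed.

Lemma sat_case_bounded m f k φ R : m ∈ o -> f ∈ U ->
  sat_step A m f k φ R <-> sat_case collects (fun x => x ∈ U) A m f k φ R.
Proof.
  intros Hm Hf. assert (HA := good_assignment Hm).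
  assert (E1 : forall i j, collects R (sat_mem A m i j) <-> is_collection R (sat_mem A m i j))
    by (intros; apply collects_iff; intros s [Hs _]; auto).
  assert (E2 : forall i j, collects R (sat_eq A m i j) <-> is_collection R (sat_eq A m i j))
    by (intros; apply collects_iff; intros s [Hs _]; auto).
  assert (E3 : forall S, collects R (sat_not A m S) <-> is_collection R (sat_not A m S))
    by (intros; apply collects_iff; intros s [Hs _]; auto).
  assert (E4 : forall S S', collects R (sat_and A m S S') <-> is_collection R (sat_and A m S S'))
    by (intros; apply collects_iff; intros s [Hs _]; auto).
  assert (E5 : forall i S, collects R (sat_ex A m i S) <-> is_collection R (sat_ex A m i S))
    by (intros; apply collects_iff; intros s [Hs _]; auto).
  rewrite sat_case_iff. unfold sat_case. split.
  - intros [(i & Hi' & j & Hj & Hc & H)|[(i & Hi' & j & Hj & Hc & H)|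
      [(l & Hl & ψ & _ & S & _ & He1 & Hc & H)|
      [(l & Hl & ψ & _ & S & _ & l' & Hl' & ψ' & _ & S' & _ & He1 & He' & Hc & H)|
       (i & Hi' & l & Hl & ψ & _ & S & _ & He1 & Hc & H)]]]].
    + left. apply E1 in H. eauto 10.
    + right. left. apply E2 in H. eauto 10.
    + right. right. left. apply E3 in H. destruct (entry_closed Hf He1).
      exists l. eauto 10.
    + right. right. right. left. apply E4 in H.
      destruct (entry_closed Hf He1), (entry_closed Hf He').
      exists l. split; [exact Hl|]. exists ψ. split; [assumption|].
      exists S. split; [assumption|]. exists l'. eauto 10.
    + right. right. right. right. apply E5 in H. destruct (entry_closed Hf He1).
      exists i. split; [assumption|]. eauto 10.
  - intros [(i & Hi' & j & Hj & Hc & H)|[(i & Hi' & j & Hj & Hc & H)|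
      [(l & Hl & ψ & _ & S & _ & He1 & Hc & H)|
      [(l & Hl & ψ & _ & S & _ & l' & Hl' & ψ' & _ & S' & _ & He1 & He' & Hc & H)|
       (i & Hi' & l & Hl & ψ & _ & S & _ & He1 & Hc & H)]]]].
    + left. apply E1 in H. eauto 10.
    + right. left. apply E2 in H. eauto 10.
    + right. right. left. apply E3 in H. exists l. eauto 10.
    + right. right. right. left. apply E4 in H.
      exists l. split; [exact Hl|]. exists ψ. split; [exact I|].
      exists S. split; [exact I|]. exists l'. eauto 10.
    + right. right. right. right. apply E5 in H.
      exists i. split; [assumption|]. eauto 10.
Qed.

Lemma bounded_definable_iff y : definable_over A y <-> bounded_definable y.
Proof.
  split.
  - intros (m & m' & q & φ & R & Hm & Hm' & Hq & (n & n' & f & Hn & Hn' & Hf & Hk & He) & Hy).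
    apply Ho in Hm, Hn.
    assert (Sm : m' ∈ o) by (apply (is_succ_iff HKP) in Hm'; subst;
      apply Ho, natural_succ, Ho; assumption).
    assert (Sn : n' ∈ o) by (apply (is_succ_iff HKP) in Hn'; subst;
      apply Ho, natural_succ, Ho; assumption).
    assert (HfU : f ∈ U) by (apply (good_sequence Sm Sn Hf Hk)).
    destruct (entry_closed HfU He) as [Hφ HR].
    exists m. split; [exact Hm|]. exists m'. split; [exact Sm|].
    exists q. split; [apply (good_assignment Hm Hq)|]. exists φ. split; [exact Hφ|].
    exists R. split; [exact HR|]. split; [exact Hm'|]. split; [exact Hq|]. split; [|split].
    + exists n. split; [exact Hn|]. exists n'. split; [exact Sn|].
      exists f. split; [exact HfU|]. repeat (split; [assumption|]). split; [|exact He].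
      intros k Hk'. destruct (Hk k Hk') as (ψ & S & He' & Hs).
      destruct (entry_closed HfU He'). exists ψ. split; [assumption|].
      exists S. split; [assumption|]. split; [exact He'|].
      apply sat_case_bounded; assumption.
    + intros x Hx. apply Hy in Hx. destruct Hx as (Hx & t & Ht & HtR).
      split; [exact Hx|]. eauto.
    + intros x Hx (_ & t & Ht & HtR). apply Hy. eauto.
  - intros (m & Hm & m' & Sm & q & Hq' & φ & Hφ & R & HR & Hm' & Hq &
      (n & Hn & n' & Sn & f & HfU & Hn' & Hf & Hk & He) & Hy1 & Hy2).
    exists m, m', q, φ, R. split; [apply Ho, Hm|]. repeat (split; [assumption|]). split.
    + exists n, n', f. split; [apply Ho, Hn|]. repeat (split; [assumption|]).
      split; [|exact He].
      intros k Hk'. destruct (Hk k Hk') as (ψ & _ & S & _ & He' & Hs).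
      exists ψ, S. split; [exact He'|]. apply sat_case_bounded; assumption.
    + intros x. split.
      * intros Hx. destruct (Hy1 x Hx) as (HxA & t & Ht & Hu). eauto.
      * intros (Hx & t & Hu & Ht). apply Hy2; [exact Hx|]. split; [exact Hx|]. eauto.
Qed.

(** Def(A) is therefore part of [U] and can be separated from it, with no appeal to power sets. *)
Lemma definable_over_in_U y : definable_over A y -> y ∈ U.
Proof.
  intros H. destruct (proj1 (bounded_definable_iff y) H) as
    (m & Hm & m' & Sm & q & Hq' & φ & Hφ & R & HR & Hm' & Hq & _ & H1 & H2).
  apply (good_cut Hm Sm Hq HR). intros x. split; [apply H1|].
  intros Hx. apply H2; [apply Hx | exact Hx].
Qed.

End Good.

Lemma definable_bounded_definable (t u v w : (nat -> M) -> M) : term t -> term u -> term v -> term w ->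
  definable true (fun e => bounded_definable (t e) (u e) (v e) (w e)).
Proof.
  intros. unfold bounded_definable, sat_case, collects, sat_mem, sat_eq, sat_not,
    sat_and, sat_ex, cut.
  def_tac.
Qed.

(** Only [V] and [U] are quantified without bound, and every good pair gives the same answer, so an
    existential quantifier over them is correct and Def is Sigma_1. *)
Lemma is_Def_iff A D : is_Def A D <-> exists V U, good A V U /\
  (forall y, y ∈ D -> bounded_definable A V U y) /\
  (forall y, y ∈ U -> bounded_definable A V U y -> y ∈ D).
Proof.
  split.
  - intros H. destruct (good_exists A) as (V & U & HG). exists V, U.
    split; [exact HG|]. split; intros y.
    + intros Hy. apply (bounded_definable_iff HG), H, Hy.
    + intros _ Hy. apply H, (bounded_definable_iff HG), Hy.
  - intros (V & U & HG & H1 & H2) y. rewrite (bounded_definable_iff HG). split; [apply H1|].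
    intros Hy. apply H2; [|exact Hy].
    apply (definable_over_in_U HG), (bounded_definable_iff HG), Hy.
Qed.

Lemma is_Def_sigma : sigma (fun e : nat -> M => is_Def (e 0) (e 1)).
Proof.
  apply (sigma_ext (P := fun e => exists V U, good (e 0) V U /\
    (forall y, y ∈ e 1 -> bounded_definable (e 0) V U y) /\
    (forall y, y ∈ U -> bounded_definable (e 0) V U y -> y ∈ e 1)));
    [|intros e; symmetry; apply is_Def_iff].
  refine (sigma_ex HKP _). refine (sigma_ex HKP _). cbv beta. apply sigma_delta0.
  apply definable_and; [|apply definable_and].
  - unfold good, pair_cup_closed, operation, sat_mem, sat_eq, sat_not, sat_and, sat_ex, cut.
    def_tac.
  - refine (@definable_ball _ _ _ _ _ _); [term_tac|].
    apply definable_bounded_definable; term_tac.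
  - refine (@definable_ball _ _ _ _ _ _); [term_tac|]. apply definable_imp; [|def_tac].
    apply definable_bounded_definable; term_tac.
Qed.

Lemma is_Def_total A : exists D, is_Def A D.
Proof.
  destruct (good_exists A) as (V & U & HG).
  destruct (separation HKP (P := bounded_definable A V U)) with (a := U) as [D HD].
  { apply (definable_bounded_definable (t := fun _ => A) (u := fun _ => V)
      (v := fun _ => U)); term_tac. }
  exists D. apply is_Def_iff. exists V, U. split; [exact HG|].
  split; intros y; [|intros HU]; rewrite HD; tauto.
Qed.

End DefWithOmega.

(** * Models without limit ordinals *)

Section Finite.
Context {M : structure} (HKP : KP M).
Implicit Types a b k n p s w x y z W : M.

(** Finiteness as derivability from the empty set by adjoining elements. The indices [n] are
    arbitrary sets that decrease along membership, which turns induction on derivations into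
    membership induction. *)
Definition fin_derivation s : Prop := forall p, p ∈ s ->
  exists n y, is_opair p n y /\
    (is_empty y \/ exists k, k ∈ n /\ exists y' a, maps s k y' /\ y = adj y' a).

Definition fin x : Prop := exists s, fin_derivation s /\ exists n, maps s n x.

Lemma definable_fin t : term t -> definable false (fun e => fin (t e)).
Proof. intros. unfold fin, fin_derivation. def_tac. Qed.
Hint Resolve definable_fin : definability.

Lemma fin_induction (P : M -> Prop) : definable false (fun e => P (e 0)) ->
  (forall y, is_empty y -> P y) -> (forall y a, P y -> P (adj y a)) ->
  forall x, fin x -> P x.
Proof.
  intros HP H0 H1 x (s & Hs & n & Hx). revert x Hx. revert n.
  apply (mem_induction HKP (P := fun n => forall x, maps s n x -> P x)).
  - refine (definable_all (P := fun x e => maps s (e 0) x -> P x) _). cbv beta.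
    apply definable_imp; [def_tac | exact HP].
  - intros n IH x (p & Hp & Hps). destruct (Hs p Hps) as (n' & y & Hp' & H).
    apply (is_opair_iff HKP) in Hp, Hp'. subst p. apply (opair_inj HKP) in Hp'.
    destruct Hp'. subst.
    destruct H as [H|(k & Hk & y' & a & Hm & ->)]; [auto|].
    apply H1, (IH k Hk), Hm.
Qed.

Lemma fin_empty x : is_empty x -> fin x.
Proof.
  intros Hx. exists (upair (opair x x) (opair x x)). split.
  - intros p Hp. apply (in_upair HKP) in Hp. exists x, x.
    rewrite (is_opair_iff HKP). tauto.
  - exists x. apply (maps_iff HKP), (in_upair HKP). auto.
Qed.

Lemma fin_adj x a : fin x -> fin (adj x a).
Proof.
  intros (s & Hs & n & Hx).
  assert (Hmono : forall u v, maps s u v -> maps (adj s (opair (upair n n) (adj x a))) u v).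
  { intros u v H. apply (maps_iff HKP), (in_adj HKP). left. apply (maps_iff HKP), H. }
  (* The singleton of [n] is an index with [n] below it. *)
  exists (adj s (opair (upair n n) (adj x a))). split.
  - intros p Hp. apply (in_adj HKP) in Hp. destruct Hp as [Hp| ->].
    + destruct (Hs p Hp) as (m & y & Ho & [H|(k & Hk & y' & b & H & ->)]).
      * eauto.
      * exists m, (adj y' b). split; [exact Ho|]. right. exists k. eauto 6.
    + exists (upair n n), (adj x a). split; [apply (is_opair_iff HKP); reflexivity|].
      right. exists n. split; [apply (in_upair HKP); auto|]. eauto.
  - exists (upair n n). apply (maps_iff HKP), (in_adj HKP). auto.
Qed.

Lemma remove_exists x a : exists y, forall z, z ∈ y <-> z ∈ x /\ z <> a.
Proof. apply (separation HKP (P := fun z => z <> a)). def_tac. Qed.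

Lemma fin_subset x : fin x -> forall y, (forall z, z ∈ y -> z ∈ x) -> fin y.
Proof.
  revert x. apply (fin_induction (P := fun x => forall y, (forall z, z ∈ y -> z ∈ x) -> fin y)).
  - def_tac.
  - intros x Hx y Hy. apply fin_empty. intros z Hz. apply (Hx z), Hy, Hz.
  - intros x a IH y Hy. destruct (remove_exists y a) as [y' Hy'].
    assert (Hf : fin y').
    { apply IH. intros z Hz. apply Hy' in Hz. destruct Hz as [Hz Hza].
      apply Hy, (in_adj HKP) in Hz. tauto. }
    destruct (classic (a ∈ y)) as [Ha|Ha].
    + replace y with (adj y' a); [apply fin_adj, Hf|]. apply (set_ext HKP). intros z.
      rewrite (in_adj HKP), Hy'. split; [intros [[H _]| ->]; assumption|].
      intros Hz. destruct (classic (z = a)); auto.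
    + replace y with y'; [exact Hf|]. apply (set_ext HKP). intros z. rewrite Hy'.
      split; [tauto|]. intros Hz. split; [exact Hz|]. intros ->. auto.
Qed.

(** A subset of [adj x a] is a subset of [x], possibly with [a] adjoined, so a bound for [x] has to
    be enlarged by its image under adjoining [a]. *)
Lemma fin_power x : fin x ->
  exists W, fin W /\ forall y, (forall z, z ∈ y -> z ∈ x) -> y ∈ W.
Proof.
  revert x. apply (fin_induction
    (P := fun x => exists W, fin W /\ forall y, (forall z, z ∈ y -> z ∈ x) -> y ∈ W)).
  - def_tac.
  - intros x Hx. exists (adj x x). split; [apply fin_adj, fin_empty, Hx|].
    intros y Hy. apply (in_adj HKP). right. apply (set_ext HKP). intros z.
    split; [apply Hy|]. intros Hz. destruct (Hx z Hz).
  - intros x a (W & HW & Hsub).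
    assert (HI : exists W', fin W' /\ (forall z, z ∈ W -> z ∈ W') /\
      forall z, z ∈ W -> adj z a ∈ W').
    (* The induction is on [w] with [W] held fixed; [w] is taken to be [W] at the end. *)
    { assert (H : forall w, fin w -> exists W', fin W' /\ (forall z, z ∈ W -> z ∈ W') /\
        forall z, z ∈ w -> exists y, y = adj z a /\ y ∈ W').
      { apply (fin_induction (P := fun w => exists W', fin W' /\
          (forall z, z ∈ W -> z ∈ W') /\
          forall z, z ∈ w -> exists y, y = adj z a /\ y ∈ W')).
        - def_tac.
        - intros w Hw. exists W. split; [exact HW|]. split; [auto|].
          intros z Hz. destruct (Hw z Hz).
        - intros w b (W' & HW' & H1 & H2). exists (adj W' (adj b a)).
          split; [apply fin_adj, HW'|].
          split; [intros z Hz; apply (in_adj HKP); auto|].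
          intros z Hz. exists (adj z a). split; [reflexivity|].
          apply (in_adj HKP) in Hz. apply (in_adj HKP).
          destruct Hz as [Hz| ->]; [|auto]. left. destruct (H2 z Hz) as (y & -> & Hy).
          exact Hy. }
      destruct (H W HW) as (W' & H1 & H2 & H3). exists W'. repeat (split; [assumption|]).
      intros z Hz. destruct (H3 z Hz) as (y & -> & Hy). exact Hy. }
    destruct HI as (W' & HW' & H1 & H2). exists W'. split; [exact HW'|].
    intros y Hy. destruct (remove_exists y a) as [y' Hy'].
    assert (Hf : y' ∈ W).
    { apply Hsub. intros z Hz. apply Hy' in Hz. destruct Hz as [Hz Hza].
      apply Hy, (in_adj HKP) in Hz. tauto. }
    destruct (classic (a ∈ y)) as [Ha|Ha].
    + replace y with (adj y' a); [apply H2, Hf|]. apply (set_ext HKP). intros z.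
      rewrite (in_adj HKP), Hy'. split; [intros [[H _]| ->]; assumption|].
      intros Hz. destruct (classic (z = a)); auto.
    + replace y with y'; [apply H1, Hf|]. apply (set_ext HKP). intros z. rewrite Hy'.
      split; [tauto|]. intros Hz. split; [exact Hz|]. intros ->. auto.
Qed.

Hypothesis no_limit : forall a, ~ is_limit a.

(** By induction on the ordinal [a], the sets of rank below [a] lie in one finite set: a successor
    is handled by [fin_power], and limits do not occur. *)
Lemma all_fin x : fin x.
Proof.
  destruct (rank_above HKP (ordinal_empty (@num_empty M HKP))) as (rk & Hdef & Hrk).
  assert (H : forall a, is_ordinal a -> exists W, fin W /\
    forall x r, r = rk x -> r ∈ a -> x ∈ W).
  { apply (mem_induction HKP (P := fun a => is_ordinal a -> exists W, fin W /\
      forall x r, r = rk x -> r ∈ a -> x ∈ W)).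
    - apply definable_imp; [def_tac|]. apply definable_ex. cbv beta.
      apply definable_and; [def_tac|].
      do 2 (apply definable_all; cbv beta). apply definable_imp; [|def_tac].
      apply (definable_subst2 (R := fun x y => y = rk x) (sigma_definable Hdef)); term_tac.
    - intros a IH Ha. destruct (ordinal_cases Ha) as [H|[[b Hb]|H]].
      + exists (num HKP 0). split; [apply fin_empty, (@num_empty M HKP)|].
        intros y r _ Hr. destruct (H r Hr).
      + apply (is_succ_iff HKP) in Hb. subst a.
        assert (Hbb : b ∈ adj b b) by (apply (in_adj HKP); auto).
        assert (Ob : is_ordinal b) by (eapply ordinal_mem; eauto).
        destruct (IH b Hbb Ob) as (W & HW & HWb).
        destruct (fin_power HW) as (W' & HW' & Hsub).
        exists W'. split; [exact HW'|]. intros y r -> Hr. apply Hsub. intros z Hz.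
        apply (HWb z (rk z)); [reflexivity|].
        (* Whether the rank of [y] is below [b] or equal to it, the elements of [y] have rank below
           [b]. *)
        apply (in_adj HKP) in Hr. destruct Hr as [Hr| <-]; [|apply Hrk, Hz].
        apply (ordinal_trans Ob Hr). apply Hrk, Hz.
      + destruct (no_limit H). }
  destruct (H (rk x)) as (W & HW & HWx); [apply Hrk|].
  apply (fin_subset HW). intros z Hz. apply (HWx z (rk z)); [reflexivity | apply Hrk, Hz].
Qed.

Lemma full_separation (P : M -> Prop) : definable false (fun e => P (e 0)) ->
  forall a, exists c, forall x, x ∈ c <-> x ∈ a /\ P x.
Proof.
  intros HP a. generalize (all_fin a). revert a.
  apply (fin_induction (P := fun a => exists c, forall x, x ∈ c <-> x ∈ a /\ P x)).
  - apply definable_ex. cbv beta. apply definable_all. cbv beta.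
    apply definable_iff; [def_tac|]. apply definable_and; [def_tac|].
    exact HP.
  - intros y Hy. exists y. intros x. specialize (Hy x). tauto.
  - intros y a [c Hc]. destruct (classic (P a)) as [Ha|Ha].
    + exists (adj c a). intros x. rewrite !(in_adj HKP), Hc.
      split; [intros [H| ->]; tauto | tauto].
    + exists c. intros x. rewrite !(in_adj HKP), Hc. split; [tauto|].
      intros [[H| ->] Hx]; tauto.
Qed.

(** Collection for all formulas follows by induction along the finite set [a], with one new value
    for each adjoined element. Recursion thus applies with no bound on complexity. *)
Lemma definable_collective : collective (@definable M false).
Proof.
  constructor.
  - intros P. apply definable_any.
  - auto.
  - apply definable_ext.
  - apply definable_and.
  - apply definable_ex.
  - apply definable_ball.
  - apply definable_subst.
  - intros P HP a. generalize (all_fin a). revert a.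
    apply (fin_induction (P := fun a => (forall x, x ∈ a -> exists y, P x y) ->
      exists c, (forall x, x ∈ a -> exists y, y ∈ c /\ P x y) /\
        forall y, y ∈ c -> exists x, x ∈ a /\ P x y)).
    + assert (D := fun t u => definable_subst2 (t := t) (u := u) HP).
      apply definable_imp.
      * refine (@definable_ball _ _ _ _ _ _); [term_tac|]. apply definable_ex. cbv beta.
        apply D; term_tac.
      * apply definable_ex. cbv beta.
        apply definable_and; (refine (@definable_ball _ _ _ _ _ _); [term_tac|]); cbv beta;
          (refine (@definable_bex _ _ _ _ _ _); [term_tac|]); apply D; term_tac.
    + intros y Hy _. exists y. split; intros x Hx; destruct (Hy x Hx).
    + intros y a IH H. destruct IH as (c & H1 & H2).
      { intros x Hx. apply H, (in_adj HKP). auto. }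
      destruct (H a) as [b Hb]; [apply (in_adj HKP); auto|].
      exists (adj c b). split.
      * intros x Hx. apply (in_adj HKP) in Hx. destruct Hx as [Hx| ->].
        -- destruct (H1 x Hx) as (z & Hz & Hxz). exists z.
           rewrite (in_adj HKP). auto.
        -- exists b. rewrite (in_adj HKP). auto.
      * intros z Hz. apply (in_adj HKP) in Hz. destruct Hz as [Hz| ->].
        -- destruct (H2 z Hz) as (x & Hx & Hxz). exists x. rewrite (in_adj HKP). auto.
        -- exists a. rewrite (in_adj HKP). auto.
Qed.

Lemma definable_definable_over (t u : (nat -> M) -> M) : term t -> term u ->
  definable false (fun e => definable_over (t e) (u e)).
Proof. intros. unfold definable_over, satisfaction_set, sat_step. def_tac. Qed.

Lemma is_Def_total_fin (A : M) : exists D, is_Def A D.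
Proof.
  destruct (fin_power (all_fin A)) as (W & _ & HW).
  destruct (full_separation (P := definable_over A)) with (a := W) as [D HD].
  - apply (definable_definable_over (t := fun _ => A)); term_tac.
  - exists D. intros y. rewrite HD. split; [tauto|]. intros Hy. split; [|exact Hy].
    apply HW. intros z. apply definable_over_subset, Hy.
Qed.

Lemma is_Def_definable : definable false (fun e : nat -> M => is_Def (e 0) (e 1)).
Proof.
  apply definable_all. cbv beta. apply definable_iff; [def_tac|].
  apply definable_definable_over; term_tac.
Qed.

(** By membership induction the elements of [x] lie in one level [Lv d]; being finite, [x] is then
    reached from the empty set by finitely many adjunctions, each of which leads to a further
    level. *)
Theorem all_constructible x : constructible x.
Proof.
  assert (HC := definable_collective).
  destruct (hierarchy_exists HKP HC is_Def_total_fin is_Def_definable) as (Lv & Hg & HLv).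
  assert (Dg : forall t u, term t -> term u -> definable false (fun e => t e ∈ Lv (u e))).
  { intros t u Ht Hu. apply definable_ext with (fun e => exists y, y = Lv (u e) /\ t e ∈ y).
    - apply definable_ex. apply definable_and; [|def_tac].
      apply (definable_subst2 (R := fun x y => y = Lv x) Hg); term_tac.
    - intros e. split; [intros (y & -> & H); exact H | eauto]. }
  enough (H : exists a, is_ordinal a /\ x ∈ Lv a).
  { destruct H as (a & Ha & Hx). eapply (Lv_constructible HKP HC); eauto. }
  revert x. apply (mem_induction HKP (P := fun x => exists a, is_ordinal a /\ x ∈ Lv a)).
  - apply definable_ex. cbv beta. apply definable_and; [def_tac | apply Dg; term_tac].
  - intros x IH.
    destruct (coll_collection HC (P := fun x a => is_ordinal a /\ x ∈ Lv a))
      with (a := x) as (c & H1 & H2); [|exact IH|].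
    { apply definable_and; [def_tac | apply Dg; term_tac]. }
    set (d := cup (num HKP 0) (cup c (union c))).
    assert (Hd : is_ordinal d).
    { apply (ordinal_cup_union HKP (ordinal_empty (@num_empty M HKP))).
      intros a Ha. destruct (H2 a Ha) as (_ & _ & H & _). exact H. }
    assert (Hx : forall y, y ∈ x -> y ∈ Lv d).
    { intros y Hy. destruct (H1 y Hy) as (a & Ha & _ & Hya).
      apply (Lv_mono HLv Hd (β := a)); [|exact Hya].
      apply (in_cup HKP). right. apply (in_cup HKP). auto. }
    (* A second induction, on finiteness, with [d] fixed. *)
    clear IH H1 H2. revert Hx. generalize (all_fin x). revert x.
    apply (fin_induction (P := fun x => (forall y, y ∈ x -> y ∈ Lv d) ->
      exists a, is_ordinal a /\ x ∈ Lv a)).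
    + apply definable_imp.
      * refine (@definable_ball _ _ _ _ _ _); [term_tac|]. apply (Dg _ (fun _ => d)); term_tac.
      * apply definable_ex. cbv beta. apply definable_and; [def_tac | apply Dg; term_tac].
    + intros y Hy _. exists (num HKP 1). split; [apply num_natural|].
      apply (Lv_definable_over HLv (β := num HKP 0)); [apply num_mem; lia|].
      apply (definable_over_empty HKP _ Hy).
    + intros y a IH Hya. destruct IH as (b & Hb & Hyb).
      { intros z Hz. apply Hya, (in_adj HKP). auto. }
      destruct (ordinal_max HKP Hb Hd) as (m & Hm & Hbm & Hdm).
      assert (Om : is_ordinal m) by (destruct Hm; subst; assumption).
      exists (adj m m). split; [apply (ordinal_succ HKP Om)|].
      apply (Lv_adj HKP HLv (ordinal_succ HKP Om) (β := m)).
      * apply (in_adj HKP). auto.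
      * apply (Lv_mono_eq HLv Om Hbm Hyb).
      * apply (Lv_mono_eq HLv Om Hdm). apply Hya, (in_adj HKP). auto.
Qed.

End Finite.

(** * The embedding *)

Section Embedding.
Context {M : structure} (HKP : KP M).
Implicit Types a b x y z : M.
Notation num := (num HKP).

(** [P] may be any external predicate: only finitely many elements are adjoined, so the result is a
    set of [M] all the same. *)
Fixpoint collect (base : M) (P : nat -> Prop) (g : nat -> M) (n : nat) : M :=
  match n with
  | 0 => base
  | S n => if excluded_middle_informative (P n)
           then adj (collect base P g n) (g n) else collect base P g n
  end.

Lemma in_collect base P g n z :
  z ∈ collect base P g n <-> z ∈ base \/ exists k, k < n /\ P k /\ z = g k.
Proof.
  induction n as [|n IH]; simpl.
  - split; [auto|]. intros [H|(k & Hk & _)]; [exact H | lia].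
  - destruct (excluded_middle_informative (P n)) as [H|H].
    + rewrite (in_adj HKP), IH. split.
      * intros [[Hz|(k & Hk & HP & ->)]| ->]; eauto 7.
      * intros [Hz|(k & Hk & HP & ->)]; [auto|].
        assert (k < n \/ k = n) as [L| ->] by lia; eauto 7.
    + rewrite IH. split.
      * intros [Hz|(k & Hk & HP & ->)]; eauto 7.
      * intros [Hz|(k & Hk & HP & ->)]; [auto|].
        assert (k < n \/ k = n) as [L| ->] by lia; [eauto 7 | tauto].
Qed.

Variable idx : M -> nat.
Hypothesis idx_inj : forall a b, idx a = idx b -> a = b.

(** Arbitrary when [k] is no index, whence the test [idx (at_index k) = k] below. *)
Definition at_index (k : nat) : M := epsilon (inhabits (num 0)) (fun b => idx b = k).

Lemma at_index_idx b : at_index (idx b) = b.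
Proof. apply idx_inj. unfold at_index. apply epsilon_spec. eauto. Qed.

(** With s = [idx a], [code a], [out_part a] and [in_part a] are c_s, e_s and d_s. *)
Definition code a : M := num (2 * idx a + 1).

Definition out_part a : M :=
  collect (adj (adj (num 0) (num 0)) (num (2 * idx a + 2)))
    (fun k => a ∈ at_index k /\ idx (at_index k) = k) (fun k => num (2 * k + 1)) (idx a).

Definition in_part a : M :=
  collect (num 0) (fun k => at_index k ∈ a /\ idx (at_index k) = k)
    (fun k => out_part (at_index k)) (idx a).

Lemma in_out_part a z : z ∈ out_part a <-> z = num 0 \/ z = num (2 * idx a + 2) \/
  exists b, idx b < idx a /\ a ∈ b /\ z = code b.
Proof.
  unfold out_part. rewrite in_collect, !(in_adj HKP). split.
  - intros [[[H|H]|H]|(k & Hk & [H1 H2] & ->)]; auto.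
    + destruct (num_empty H).
    + right. right. exists (at_index k). unfold code. rewrite H2. auto.
  - intros [H|[H|(b & Hb & Ha & ->)]]; auto.
    right. exists (idx b). rewrite at_index_idx. auto.
Qed.

Lemma in_in_part a z : z ∈ in_part a <->
  exists b, idx b < idx a /\ b ∈ a /\ z = out_part b.
Proof.
  unfold in_part. rewrite in_collect. split.
  - intros [H|(k & Hk & [H1 H2] & ->)]; [destruct (num_empty H)|].
    exists (at_index k). rewrite H2. auto.
  - intros (b & Hb & Ha & ->). right. exists (idx b). rewrite at_index_idx. auto.
Qed.

Lemma zero_in_out_part a : num 0 ∈ out_part a.
Proof. apply in_out_part. auto. Qed.

Lemma code_in_out_part a b : code b ∈ out_part a <-> idx b < idx a /\ a ∈ b.
Proof.
  rewrite in_out_part. unfold code. split.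
  - intros [H|[H|(c & Hc & Ha & H)]]; apply num_inj in H; try lia.
    replace b with c; [auto|]. apply idx_inj. lia.
  - intros [H1 H2]. right. right. eauto.
Qed.

Lemma out_part_inj a b : out_part a = out_part b -> a = b.
Proof.
  intros E. assert (H : num (2 * idx a + 2) ∈ out_part b)
    by (rewrite <- E; apply in_out_part; auto).
  apply in_out_part in H. unfold code in H.
  destruct H as [H|[H|(c & _ & _ & H)]]; apply num_inj in H; try lia.
  apply idx_inj. lia.
Qed.

Lemma out_part_in_in_part a b : out_part a ∈ in_part b <-> idx a < idx b /\ a ∈ b.
Proof.
  rewrite in_in_part. split.
  - intros (c & Hc & Hb & H). apply out_part_inj in H. subst. auto.
  - intros [H1 H2]. eauto.
Qed.

Variable stage : M -> M.
Hypothesis out_part_stage : forall a, out_part a ∈ stage a.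

(** The test [num 0 ∉ y] keeps out every other [out_part], since each of them contains 0. *)
Definition selected a y : Prop := y = out_part a \/
  (num 0 ∉ y /\ exists z, z ∈ y /\ (num 0 ∈ z /\ (code a ∈ z \/ z ∈ in_part a))).

Definition target a : M := sep (stage a) (selected a).

Lemma in_target a y : y ∈ target a <-> y ∈ stage a /\ selected a y.
Proof.
  unfold target. apply (in_sep HKP). unfold selected. def_tac.
Qed.

Lemma zero_not_in_target a : num 0 ∉ target a.
Proof.
  intros H. apply in_target in H. destruct H as (_ & [H|(_ & z & Hz & _)]).
  - apply (num_empty (HKP := HKP) (z := num 0)). rewrite H at 2. apply zero_in_out_part.
  - destruct (num_empty Hz).
Qed.

(* [out_part a] is the only element of [target a] that contains the empty set,
   so it is what decides whether [target a] is selected for [target b]. *)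
Lemma selected_target a b : selected b (target a) <-> a ∈ b.
Proof.
  assert (Ha : out_part a ∈ target a) by (apply in_target; unfold selected; auto).
  split.
  - intros [H|(_ & z & Hz & H0 & H)].
    + destruct (@zero_not_in_target a). rewrite H. apply zero_in_out_part.
    + assert (z = out_part a).
      { apply in_target in Hz. destruct Hz as (_ & [Hz|(Hz & _)]); [exact Hz | tauto]. }
      subst z. rewrite code_in_out_part, out_part_in_in_part in H. tauto.
  - intros H. right. split; [apply zero_not_in_target|].
    exists (out_part a). split; [exact Ha|]. split; [apply zero_in_out_part|].
    rewrite code_in_out_part, out_part_in_in_part.
    (* The two indices differ because no set is its own element; the element with the larger index
       records the relation. *)
    assert (idx a <> idx b).
    { intros E. apply idx_inj in E. subst. destruct (mem_irrefl HKP H). }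
    assert (idx b < idx a \/ idx a < idx b) as [L|L] by lia; auto.
Qed.

Lemma target_definable a A : A = stage a -> is_transitive A ->
  num 0 ∈ A -> code a ∈ A -> in_part a ∈ A -> definable_over A (target a).
Proof.
  intros HA TA H0 Hc Hi. assert (Ho : out_part a ∈ A) by (subst; apply out_part_stage).
  (* Variables 0 to 3 hold the parameters, 4 is the bound variable, whose value here is a filler,
     and 5 is the free one. *)
  set (v := fun i => match i with 0 => out_part a | 1 => num 0 | 2 => code a
    | 3 => in_part a | _ => num 0 end).
  set (R := fun v : nat -> M => v 4 ∈ v 5 /\ (v 1 ∈ v 4 /\ (v 2 ∈ v 4 \/ v 4 ∈ v 3))).
  assert (LR : local 6 R).
  { intros u w E. unfold R. rewrite !E by lia. auto. }
  assert (L3 : local 6 (fun v => exists x, x ∈ A /\ R (upd v 4 x))).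
  { intros u w E (x & Hx & H). exists x. split; [exact Hx|].
    revert H. apply LR. intros i Hk. unfold upd. destruct (Nat.eqb i 4); auto. }
  apply (definable_over_representable (HKP := HKP) (m := 5) (v := v)
    (Q := fun v => v 5 = v 0 \/ (~ v 1 ∈ v 5 /\ exists x, x ∈ A /\ R (upd v 4 x)))).
  - intros [|[|[|[|i]]]] _; assumption.
  - intros u w E. rewrite !E by lia. intros [H|[H1 H2]]; [auto|]. right.
    split; [exact H1|]. apply (L3 u); assumption.
  - apply representable_or.
    + intros u w E. rewrite !E by lia. auto.
    + intros u w E. rewrite !E by lia. intros [H1 H2].
      split; [exact H1|]. apply (L3 u); assumption.
    + apply representable_eq; lia.
    + apply representable_and.
      * intros u w E. rewrite !E by lia. auto.
      * apply representable_not; [|apply representable_mem; lia].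
        intros u w E. rewrite !E by lia. auto.
      * apply (@representable_ex _ HKP A 6 R 4); [lia | exact LR|].
        apply representable_and; [|apply representable_mem; lia|].
        { intros u w E. rewrite !E by lia. auto. }
        apply representable_and; [|apply representable_mem; lia|].
        { intros u w E. rewrite !E by lia. auto. }
        apply representable_or; try (apply representable_mem; lia);
          intros u w E; rewrite !E by lia; auto.
  - intros x. rewrite in_target, <- HA. unfold selected, R, upd, v. simpl.
    split; intros [Hx H]; (split; [exact Hx|]).
    + destruct H as [H|(Hn & z & Hz & H)]; [auto|]. right. split; [exact Hn|].
      (* Transitivity of [A] ensures that a quantifier over [A] reaches every element of [x]. *)
      exists z. split; [apply (TA x z Hz Hx) | auto].
    + destruct H as [H|(Hn & z & _ & H)]; [auto|]. right. split; [exact Hn|]. eauto.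
Qed.

End Embedding.

(** Injectivity comes from extensionality: points with the same image have the same elements. *)
Lemma embedding_of_reflecting (M : structure) (HKP : KP M) (j : M -> L M) :
  (forall x y, x ∈ y <-> j x ∈ j y) -> embedding j.
Proof.
  intros H. split; [|split].
  - intros x y E. apply (f_equal (@proj1_sig _ _)) in E. simpl in E.
    apply (set_ext HKP). intros z. rewrite (H z x), (H z y), E. reflexivity.
  - intros [y [x <-]]. exists x. reflexivity.
  - exact H.
Qed.

Lemma Lv_omega_adj (M : structure) (HKP : KP M) (o : M) (Lv : M -> M) :
  is_limit o ->
  (forall x y, y ∈ Lv x <-> exists β, β ∈ x /\ definable_over (Lv β) y) ->
  forall y a, y ∈ Lv o -> a ∈ Lv o -> adj y a ∈ Lv o.
Proof.
  intros Ho HLv.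
  assert (S : forall y, y ∈ Lv o -> exists β, β ∈ o /\ y ∈ Lv β).
  { intros y Hy. apply HLv in Hy. destruct Hy as (β & Hβ & Hy). exists (adj β β).
    split; [apply (limit_succ HKP Ho Hβ)|].
    apply (Lv_definable_over HLv (β := β)); [apply (in_adj HKP); auto | exact Hy]. }
  intros y a Hy Ha. destruct (S y Hy) as (β & Hβ & Hyβ). destruct (S a Ha) as (γ & Hγ & Haγ).
  assert (Oβ := ordinal_mem (proj1 Ho) Hβ). assert (Oγ := ordinal_mem (proj1 Ho) Hγ).
  destruct (ordinal_max HKP Oβ Oγ) as (m & Hm & Hbm & Hcm).
  assert (Hmo : m ∈ o) by (destruct Hm; subst; assumption).
  assert (Om := ordinal_mem (proj1 Ho) Hmo).
  apply (Lv_adj HKP HLv (proj1 Ho) Hmo).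
  - apply (Lv_mono_eq HLv Om Hbm Hyβ).
  - apply (Lv_mono_eq HLv Om Hcm Haγ).
Qed.

Theorem theorem1 (M : structure) (HKP : KP M) (Hcount : countable M) :
  exists j : M -> L M,
    (forall x y : M, x ∈ y <-> j x ∈ j y) /\ embedding j.
Proof.
  enough (H : exists g : M -> M, (forall x, constructible (g x)) /\
    forall x y, x ∈ y <-> g x ∈ g y).
  { destruct H as (g & Hg & Hmem).
    set (j := fun x => exist _ (g x) (Hg x) : L M).
    assert (Hj : forall x y, x ∈ y <-> j x ∈ j y) by exact Hmem.
    exists j. split; [exact Hj | exact (embedding_of_reflecting HKP Hj)]. }
  destruct (classic (exists α, @is_limit M α)) as [Hlim|Hno].
  2:{ exists (fun x => x). split; [|reflexivity].
      apply (all_constructible HKP). intros a Ha. apply Hno. eauto. }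
  destruct Hcount as [idx Hidx].
  destruct (omega_exists HKP Hlim) as [o Ho].
  destruct (rank_above HKP (proj1 (proj1 Ho))) as (rk & _ & Hrk).
  destruct (hierarchy_exists HKP (sigma_collective HKP) (is_Def_total HKP Ho)
    (is_Def_sigma HKP Ho)) as (Lv & Hg & HLv).
  assert (Hadj := Lv_omega_adj HKP (proj1 Ho) HLv).
  assert (Hnum : forall d, num HKP d ∈ Lv o).
  { induction d as [|d IH]; [|rewrite num_S; auto].
    apply (Lv_definable_over HLv (β := num HKP 0)); [apply Ho, num_natural|].
    apply (definable_over_empty HKP), num_empty. }
  assert (Hcol : forall base P f n, base ∈ Lv o -> (forall k, f k ∈ Lv o) ->
    collect base P f n ∈ Lv o).
  { intros base P f n Hb Hf. induction n as [|n IH]; simpl; [exact Hb|].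
    destruct (excluded_middle_informative (P n)); auto. }
  assert (Hout : forall a, out_part HKP idx a ∈ Lv o)
    by (intros a; apply Hcol; auto).
  assert (Hin : forall a, in_part HKP idx a ∈ Lv o)
    by (intros a; apply Hcol; auto).
  (* [rk a] includes omega, so [Lv (rk a)] is a union over at least the same stages. *)
  assert (Hup : forall a x, x ∈ Lv o -> x ∈ Lv (rk a)).
  { intros a x Hx. apply HLv in Hx. destruct Hx as (β & Hβ & Hx).
    apply HLv. exists β. split; [apply Hrk, Hβ | exact Hx]. }
  set (g := target HKP idx (fun a => Lv (rk a))).
  assert (Hdef : forall a, definable_over (Lv (rk a)) (g a)).
  { intros a. apply (target_definable (HKP := HKP) (idx := idx)); auto.
    - apply (Lv_transitive HLv), Hrk.
    - apply Hup, Hnum. }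
  exists g. split.
  - intros a. apply (Lv_constructible HKP (sigma_collective HKP) Hg HLv
      (ordinal_succ HKP (proj1 (Hrk a)))).
    apply (Lv_definable_over HLv (β := rk a)); [apply (in_adj HKP); auto | apply Hdef].
  - intros a b. unfold g at 2. rewrite (in_target HKP).
    unfold g at 2. rewrite (selected_target Hidx); [|auto].
    split; [|tauto]. intros Hab. split; [|exact Hab].
    (* The rank does its work here: from [rk a ∈ rk b], the set [g a] lies in [Lv (rk b)], from
       which [g b] is separated. *)
    apply (Lv_definable_over HLv (β := rk a)); [apply Hrk, Hab | apply Hdef].
Qed.
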